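(* There exist $\lambda_2>0$ and a constant $C>0$ independent of $\lambda$ such that for every $\lambda\in(0,\lambda_2]$ and every $v\in L^2(\Omega)$ $$\int_\Omega (A^\lambda_{m_A}v)(\xi)\,v(\xi)\,d\xi\ \ge\ -C\lambda^2\int_\Omega v^2(\xi)\,d\xi .$$
   Context: Interaction. $\beta>1$, $\sigma(m)=\beta(1-m^2)$, $m_\beta>0$ is the strictly positive solution of $m=\tanh(\beta m)$. $J:\mathbb R^2\to[0,\infty)$ is a smooth (at least $C^1$) spherically symmetric probability density with support $\{|\xi|\le 1\}$; $\bar J(x)=\int_{\mathbb R}J(x,y)\,dy$; for $\lambda\in(0,1]$, $J^\lambda(\xi)=\lambda^{-2}J(\xi/\lambda)$. $\bar m$ is the unique antisymmetric solution on $\mathbb R$ of $\bar m=\tanh(\beta\,\bar J\star\bar m)$ with $\bar m(0)=0$ and $\lim_{z\to\pm\infty}\bar m(z)=\pm m_\beta$ (it is smooth and strictly increasing). Geometry. $\Omega\subset\mathbb R^2$ is a bounded domain with sufficiently smooth boundary, $\Gamma\subset\Omega$ a simple smooth closed curve, boundary of an open set $\Omega^-$, and $\Omega^+=\Omega\setminus(\Omega^-\cup\Gamma)$. $L$ is the length of $\Gamma$, $T$ a circle of length $L$, $\gamma:T\to\Gamma$, $\gamma\in C^5(T)$, the arc-length parametrization, $\nu(s)$ a smoothly varying unit normal at $\gamma(s)$, and $k(s)$ the signed curvature, $\nu'(s)=-k(s)\gamma'(s)$. $r(\xi,\Gamma)$ is the signed distance from $\Gamma$, negative in $\Omega^-$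 and positive in $\Omega^+$. For $\delta>0$, $\mathcal N(\delta)=\{\xi:\ d(\xi,\Gamma)\le\delta\}$, $d$ being the Euclidean distance. $d_0>0$ is such that $\mathcal N(d_0)\subset\Omega$, the map $(s,r)\mapsto\xi=\gamma(s)+\nu(s)r$ is a diffeomorphism $T\times[-d_0,d_0]\to\mathcal N(d_0)$, and $\sup_s|k(s)|d_0\le\frac12$; $(s(\xi),r(\xi,\Gamma))$ are the corresponding coordinates of $\xi\in\mathcal N(d_0)$. The function $m_A=m_A^\lambda$. $m_A$ is a family of smooth functions on $\Omega$, indexed by $\lambda\in(0,\lambda_0]$ for some $\lambda_0\in(0,1]$, satisfying, with constants $C$ independent of $\lambda$: (i) for $\xi\in\mathcal N(d_0)$, $m_A(\xi)=\bar m(r(\xi,\Gamma)/\lambda)+\lambda[h_1(r(\xi,\Gamma)/\lambda)g(s(\xi))+\phi(\xi)]+\lambda^2q^\lambda(\xi)$, where $h_1\in C^1(\mathbb R)\cap L^\infty(\mathbb R)$ is even and tends to $0$ exponentially fast as $|z|\to\infty$, $g$ and $\phi$ are at least $C^3$, $\|\phi\|_{\mathrm{Lip}(\mathcal N(d_0))}\le C$, and $\sup_{\lambda}\sup_{\xi\in\mathcal N(d_0)}(|g(s(\xi))|+|\phi(\xi)|+|q^\lambda(\xi)|)\le C$; (ii) $|\nabla^\Gamma m_A(\xi)|\le C\lambda$ on $\mathcal N(d_0)$, where $\nabla^\Gamma$ is the derivative tangential to $\Gamma$; (iii) $|m_A(\xi)\mp m_\beta|\le C\lambda$ for $\xi\in\Omega^\pm\setminus\mathcal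 N(d_0)$; (iv) there is $C^*>1$ with $\inf_{\xi\in\Omega\setminus\mathcal N(d_0/2)}1/\sigma(m_A(\xi))>C^*$; (v) there is $a>0$ with $a\le\sigma(m_A(\xi))\le\beta$ for all $\xi\in\Omega$. Operator. For $v\in L^2(\Omega)$, $(A^\lambda_{m_A}v)(\xi)=\dfrac{v(\xi)}{\sigma(m_A(\xi))}-\displaystyle\int_\Omega J^\lambda(\xi-\xi')v(\xi')\,d\xi'$, $\xi\in\Omega$. *)

(* Defs.v *)
From HB Require Import structures.
From mathcomp Require Import all_boot all_order all_algebra.
From mathcomp Require Import all_classical all_reals all_analysis.

Set Implicit Arguments.
Unset Strict Implicit.
Unset Printing Implicit Defensive.
Import Order.TTheory GRing.Theory Num.Theory.
Import numFieldNormedType.Exports.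

Local Open Scope classical_set_scope.
Local Open Scope ring_scope.

Section Plane.
Context {R : realType}.
Implicit Types (x y : R * R) (A U : set (R * R)) (f : R * R -> R).

(* The library norm on [R * R] is the sup norm; all distances in the geometry
   are Euclidean, hence [enorm].  The topology is the same. *)
Definition dotp x y : R := x.1 * y.1 + x.2 * y.2.
Definition enorm x : R := Num.sqrt (dotp x x).

Definition edist_set A x : R := inf [set enorm (x - p) | p in A].

Definition bdry A : set (R * R) := closure A `\` A°.

(* [f] is of class C^k on the open set [U]. *)
Fixpoint Ck_open (k : nat) U f : Prop :=
  (forall x, U x -> {for x, continuous f}) /\
  match k with
  | 0%N => True
  | k'.+1 => [/\ forall x, U x -> derivable f x (1, 0) /\ derivable f x (0, 1),
                 Ck_open k' U ('D_(1, 0) f) & Ck_open k' U ('D_(0, 1) f)]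
  end.

(* For a set that need not be open: agreement with a function that is C^k on
   an open neighbourhood of the set. *)
Definition Ck_on (k : nat) A f : Prop :=
  exists U f', [/\ open U, A `<=` U, Ck_open k U f' &
    forall x, A x -> f' x = f x].

(* C^k functions of one variable, scalar or plane-valued. *)
Definition Ck_line (V : normedModType R) (k : nat) (f : R -> V) : Prop :=
  (forall j, (j < k)%N -> forall s, derivable (derive1n j f) s 1) /\
  continuous (derive1n k f).

Definition mu1 := @lebesgue_measure R.
Definition mu2 := (@lebesgue_measure R \x @lebesgue_measure R)%E.

(* L^2(A): the extension by zero is (Borel) measurable and square integrable
   over the plane. *)
Definition L2 A f : Prop :=
  (f \_ A : measurableTypeR R * measurableTypeR R -> R) \in Lfun mu2 2%:E.

End Plane.

Section Interaction.
Context {R : realType}.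
Implicit Types (J m v : R * R -> R) (beta lam : R).

Definition tanh (x : R) : R :=
  (expR x - expR (- x)) / (expR x + expR (- x)).

Definition sigma beta (m : R) : R := beta * (1 - m ^+ 2).

Definition Jbar J (x : R) : R := \int[mu1]_y J (x, y).

Definition Jscaled J lam (xi : R * R) : R :=
  lam ^- 2 * J (xi.1 / lam, xi.2 / lam).

Definition convol (f g : R -> R) (x : R) : R := \int[mu1]_y (f (x - y) * g y).

Record interaction_kernel J : Prop := {
  kernel_C1 : Ck_open 1 setT J;
  kernel_ge0 : forall xi, 0 <= J xi;
  kernel_radial : forall xi eta, enorm xi = enorm eta -> J xi = J eta;
  kernel_mass : (\int[mu2]_xi (J xi)%:E = 1)%E;
  kernel_supp : closure [set xi | J xi != 0] = [set xi | enorm xi <= 1]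
}.

(* [mbar] is the instanton connecting the phases [- mb] and [mb].  Smoothness
   and strict monotonicity are known properties of the solution. *)
Record instanton beta J (mb : R) (mbar : R -> R) : Prop := {
  instanton_smooth : forall k, Ck_line k (mbar : R -> R^o);
  instanton_incr : {homo mbar : z z' / z < z'};
  instanton_odd : forall z, mbar (- z) = - mbar z;
  instanton_0 : mbar 0 = 0;
  instanton_eq : forall z, mbar z = tanh (beta * convol (Jbar J) mbar z);
  instanton_pinfty : mbar z @[z --> +oo] --> mb;
  instanton_ninfty : mbar z @[z --> -oo] --> - mb
}.

Definition Aop J beta (Omega : set (R * R)) lam m v (xi : R * R) : R :=
  v xi / sigma beta (m xi) -
  \int[mu2]_(xi' in Omega) (Jscaled J lam (xi - xi') * v xi').

End Interaction.

Section Geometry.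
Context {R : realType}.
Implicit Types (Omega Omegam Gamma : set (R * R)) (gamma nu : R -> R * R).

Record C1_domain Omega : Prop := {
  domain_nonempty : Omega !=set0;
  domain_open : open Omega;
  domain_connected : connected Omega;
  domain_bounded : bounded_set Omega;
  (* near each boundary point, [Omega] is a sublevel set of a C^1 function
     with nonvanishing gradient *)
  domain_boundary : forall p, bdry Omega p ->
    exists U (rho : R * R -> R),
      [/\ open U, U p, Ck_open 1 U rho,
          forall xi, U xi -> ('D_(1, 0) rho xi, 'D_(0, 1) rho xi) != (0, 0) &
          forall xi, U xi -> (Omega xi <-> rho xi < 0)]
}.

(* The circle of length [L] is R / LZ: functions on it are [L]-periodic
   functions on R. *)
Definition same_mod (L s s' : R) : Prop := exists n : int, s' = s + n%:~R * L.

Record arclength_curve (L : R) gamma : Prop := {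
  curve_length : 0 < L;
  curve_periodic : forall s, gamma (s + L) = gamma s;
  curve_simple : forall s s', gamma s = gamma s' -> same_mod L s s';
  curve_C5 : Ck_line 5 gamma;
  curve_unit : forall s, enorm (derive1 gamma s) = 1
}.

(* [nu] is a unit normal and [kap] the signed curvature. *)
Record normal_field (L : R) gamma nu (kap : R -> R) : Prop := {
  normal_periodic : forall s, nu (s + L) = nu s;
  normal_C4 : Ck_line 4 nu;
  normal_unit : forall s, enorm (nu s) = 1;
  normal_orth : forall s, dotp (nu s) (derive1 gamma s) = 0;
  normal_curvature : forall s, derive1 nu s = - kap s *: derive1 gamma s
}.

Definition tube Gamma (delta : R) : set (R * R) :=
  [set xi | edist_set Gamma xi <= delta].

(* Signed distance, negative exactly in [Omegam]. *)
Definition sdist Omegam Gamma (xi : R * R) : R :=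
  if xi \in Omegam then - edist_set Gamma xi else edist_set Gamma xi.

Definition normal_map gamma nu (s r : R) : R * R := gamma s + r *: nu s.

(* [normal_map] is a diffeomorphism from (R / LZ) x [-d0, d0] onto the tube.
   It is C^4 since [gamma] and [nu] are; the last field says that its inverse
   is C^1, in terms of local real-valued lifts of the angular coordinate. *)
Record tubular_diffeo (L d0 : R) gamma nu : Prop := {
  tubular_onto :
    [set xi | exists s r, `|r| <= d0 /\ xi = normal_map gamma nu s r] =
    tube (range gamma) d0;
  tubular_inj : forall s s' r r', `|r| <= d0 -> `|r'| <= d0 ->
    normal_map gamma nu s r = normal_map gamma nu s' r' ->
    same_mod L s s' /\ r = r';
  tubular_inv : forall p, tube (range gamma) d0 p ->
    exists U (S T : R * R -> R),
      [/\ open U, U p, Ck_open 1 U S, Ck_open 1 U T &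
          forall xi, U xi -> tube (range gamma) d0 xi ->
            `|T xi| <= d0 /\ normal_map gamma nu (S xi) (T xi) = xi]
}.

(* [sc xi] is a real representative of the tangential coordinate s(xi); it is
   only meaningful modulo [L].  The normal coordinate is the signed distance,
   so that [nu] points out of [Omegam]. *)
Record geometry Omega Omegam (L d0 : R) gamma nu (kap : R -> R)
    (sc : R * R -> R) : Prop := {
  geo_domain : C1_domain Omega;
  geo_curve : arclength_curve L gamma;
  geo_normal : normal_field L gamma nu kap;
  geo_curve_sub : range gamma `<=` Omega;
  geo_inner_open : open Omegam;
  geo_inner_sub : Omegam `<=` Omega;
  geo_inner_bdry : bdry Omegam = range gamma;
  geo_d0 : 0 < d0;
  geo_tube_sub : tube (range gamma) d0 `<=` Omega;
  geo_tubular : tubular_diffeo L d0 gamma nu;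
  geo_curvature : forall s, `|kap s| * d0 <= 2^-1;
  geo_coord : forall xi, tube (range gamma) d0 xi ->
    normal_map gamma nu (sc xi) (sdist Omegam (range gamma) xi) = xi
}.

Definition outer Omega Omegam Gamma : set (R * R) :=
  Omega `\` (Omegam `|` Gamma).

End Geometry.

Section Family.
Context {R : realType}.

Record approx_family (beta mb : R) (mbar : R -> R)
    (Omega Omegam : set (R * R)) (L d0 : R) (gamma : R -> R * R)
    (sc : R * R -> R) (lam0 : R) (h1 g : R -> R) (phi : R * R -> R)
    (q mA : R -> R * R -> R) : Prop := {
  fam_lam0 : 0 < lam0 <= 1;
  fam_C1 : forall lam, 0 < lam <= lam0 -> Ck_open 1 Omega (mA lam);
  fam_expansion : forall lam, 0 < lam <= lam0 ->
    forall xi, tube (range gamma) d0 xi ->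
    let r := sdist Omegam (range gamma) xi in
    mA lam xi = mbar (r / lam) + lam * (h1 (r / lam) * g (sc xi) + phi xi)
                + lam ^+ 2 * q lam xi;
  fam_h1_C1 : Ck_line 1 (h1 : R -> R^o);
  fam_h1_bounded : exists M, forall z, `|h1 z| <= M;
  fam_h1_even : forall z, h1 (- z) = h1 z;
  fam_h1_decay : exists C c, 0 < c /\
    forall z, `|h1 z| <= C * expR (- (c * `|z|));
  fam_g_periodic : forall s, g (s + L) = g s;
  fam_g_C3 : Ck_line 3 (g : R -> R^o);
  fam_phi_C3 : Ck_on 3 (tube (range gamma) d0) phi;
  fam_phi_Lip : exists C, forall xi eta,
    tube (range gamma) d0 xi -> tube (range gamma) d0 eta ->
    `|phi xi - phi eta| <= C * enorm (xi - eta);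
  fam_bounded : exists C, forall lam, 0 < lam <= lam0 ->
    forall xi, tube (range gamma) d0 xi ->
    `|g (sc xi)| + `|phi xi| + `|q lam xi| <= C;
  (* derivative in the direction of the unit tangent at the foot point *)
  fam_tangential : exists C, forall lam, 0 < lam <= lam0 ->
    forall xi, tube (range gamma) d0 xi ->
    `|'D_(derive1 gamma (sc xi)) (mA lam) xi| <= C * lam;
  fam_outside : exists C, forall lam, 0 < lam <= lam0 ->
    (forall xi, (outer Omega Omegam (range gamma) `\`
                 tube (range gamma) d0) xi -> `|mA lam xi - mb| <= C * lam) /\
    (forall xi, (Omegam `\` tube (range gamma) d0) xi ->
                `|mA lam xi + mb| <= C * lam);
  fam_stable : exists Cstar, 1 < Cstar /\ forall lam, 0 < lam <= lam0 ->
    (Cstar%:E < ereal_inf [set ((sigma beta (mA lam xi))^-1)%:E |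
                  xi in Omega `\` tube (range gamma) (d0 / 2)])%E;
  fam_sigma : exists a, 0 < a /\ forall lam, 0 < lam <= lam0 ->
    forall xi, Omega xi -> a <= sigma beta (mA lam xi) <= beta
}.

End Family.

(* Main.v *)
Require Import Defs.
From HB Require Import structures.
From mathcomp Require Import all_boot all_order all_algebra.
From mathcomp Require Import all_classical all_reals all_analysis.
From mathcomp Require Import measurable_realfun ring lra.
Import Order.TTheory GRing.Theory Num.Theory.
Import numFieldNormedType.Exports.
Local Open Scope classical_set_scope.
Local Open Scope ring_scope.
Set Implicit Arguments.
Unset Strict Implicit.
Unset Printing Implicit Defensive.

(** The lower bound follows from a Schur test.  If [w > 0] satisfies
      [J^lam * w <= (1 / sigma(m_A) + D lam^2) w]  on [Omega],
    then [2 |v(x) v(y)| <= v(x)^2 w(y) / w(x) + v(y)^2 w(x) / w(y)] and the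
    symmetry of the kernel bound the double integral of [J^lam] against
    [|v| |v|] by the integral of [(1 / sigma(m_A) + D lam^2) v^2]
    ([schur_test], [quadratic_form_bound]).  So no spectral information on the
    operator is needed, only a positive supersolution that is accurate to
    second order ([supersolution]).

    Away from the curve [1 / sigma(m_A) > C* > 1] and a constant [w] would do.
    Near the curve, at leading order, the equation in the normal variable
    [z = r / lam] is [K mu = mu / sigma(mbar)], where [mu = mbar'] and [K]
    ([Jstar]) is convolution with [Jbar]: this is the derivative of the
    instanton equation ([mu_eq]), and [mu > 0].  Two corrections of order [lam] are added.
    - The curvature.  A point at tangential offset [lam y] from a point of
      curvature [k] has normal coordinate [z + x - lam k y^2 / 2 + O(lam^2)]
      ([pull_rho]).  Isotropy of [J] turns the average of [y^2 mu'(z + x)] into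
      that of [x mu(z + x)] ([Eav_radial]); the resulting term is exactly
      cancelled by the factor [1 + k r / 2] in the ansatz.
    - The perturbation [lam (h_1 g + phi)] of [mbar] in [m_A].  It contributes
      [S'(mbar) b mu] with [S = 1 / sigma] and [b] even, hence an odd function
      because [mbar] is odd; it is removed by solving
      [psi / sigma(mbar) - K psi = - S'(mbar) b mu] up to [O(lam)]
      ([corrector]).  The operator [psi |-> sigma(mbar) K psi] fixes [mu], but
      it is a strict contraction of the odd functions for a weighted sup norm
      ([odd_contraction]), so that finitely many terms of the Neumann series
      suffice.  The weight is comparable to [sqrt mu] at infinity, so that
      [lam psi <= mu / 4 + O(lam^2)] and positivity is not lost.

    With [w0] the resulting ansatz, [J^lam * w0 = w0 / sigma(m_A) + O(lam^2)]
    ([inner_estimate]).  The weight is [w = lam^2 K_c + w0] on a tube and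
    [lam^2 K_c] outside; the cut is harmless because [mu = O(z^-2)] makes [w0]
    of order [lam^2] there.  For [|z|] large, [1 / sigma(m_A) - 1] is bounded
    below and a large [K_c] absorbs the absolute [O(lam^2)] errors; for [|z|]
    bounded, [w] is bounded below and the errors are absorbed by
    [D lam^2 w].

    All estimates in the tube compare a point with its interaction disc only.
    They use Taylor expansion along the curve and one compactness argument,
    which turns the injectivity of the normal map into a Lipschitz bound for
    its inverse ([tubular_separation], [chart_comparison]). *)


(** * Integration over the plane *)

Section PlaneMeasure.
Context {R : realType}.
Notation RR := (measurableTypeR R * measurableTypeR R)%type.
Notation leb := (@lebesgue_measure R).

Lemma open_measurable2 (U : set (R * R)) : open U -> measurable (U : set RR).
Proof.
move=> oU.
pose box (k : rat * rat * nat) : set RR :=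
  `](ratr k.1.1 - k.2.+1%:R^-1), (ratr k.1.1 + k.2.+1%:R^-1)[%classic `*`
  `](ratr k.1.2 - k.2.+1%:R^-1), (ratr k.1.2 + k.2.+1%:R^-1)[%classic.
pose F n : set RR := if unpickle n is Some k then
  (if `[< box k `<=` U >] then box k else set0) else set0.
have -> : U = \bigcup_n F n.
  apply/seteqP; split => [[x y] Uxy|[x y] [n _]]; last first.
    rewrite /F; case: unpickle => // k; case: ifPn => // /asboolP; exact.
  have /nbhs_ballP[e /= e0 eU] := open_nbhs_nbhs (conj oU Uxy).
  have [n ne] : exists n : nat, n.+1%:R^-1 < e / 2.
    have e20 : 0 < e / 2 by rewrite divr_gt0.
    have [N _ HN] := near_infty_natSinv_lt (PosNum e20).
    by exists N; exact: HN (leqnn N).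
  have n0 : 0 < n.+1%:R^-1 :> R by rewrite invr_gt0.
  have rat_near (t : R) : exists q : rat,
      t - n.+1%:R^-1 < ratr q < t + n.+1%:R^-1.
    have [|q] := @rat_in_itvoo R (t - n.+1%:R^-1) (t + n.+1%:R^-1).
      by rewrite ltrD2l gt0_cp.
    by rewrite in_itv/= => qP; exists q.
  have [q1 q1P] := rat_near x; have [q2 q2P] := rat_near y.
  suff [bxy bU] : box (q1, q2, n) (x, y) /\ box (q1, q2, n) `<=` U.
    by exists (pickle (q1, q2, n)); [exact: I|rewrite /F pickleK ifT//; apply/asboolP].
  rewrite /box [(_, n).2]/= [(q1, _, n).1]/= [(q1, _).1]/= [(q1, _).2]/=.
  move: n0 ne q1P q2P; set i := n.+1%:R^-1 => n0 ne /andP[? ?] /andP[? ?].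
  split.
    by split; rewrite /= in_itv/=; apply/andP; split; lra.
  move=> [c d] [] /=; rewrite !in_itv/= => /andP[? ?] /andP[? ?].
  by apply: eU; split => /=; rewrite /ball/= ltr_norml; apply/andP; split; lra.
apply: bigcup_measurable => n _; rewrite /F; case: unpickle => // k; case: ifPn => // _.
by apply: measurableX; exact: measurable_itv.
Qed.

Lemma closed_measurable2 (A : set (R * R)) : closed A -> measurable (A : set RR).
Proof. by move/closed_openC/open_measurable2/measurableC; rewrite setCK. Qed.

Lemma within_continuous_measurable2 (D : set (R * R)) (f : R * R -> R) :
  measurable (D : set RR) -> {within D, continuous f} ->
  measurable_fun (D : set RR) (f : RR -> R).
Proof.
move=> mD /continuousP cf; apply: (measurability _ (RGenOInfty.measurableE R)).
move=> _ [_ [a ->] <-].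
have oa : open (`]a, +oo[%classic : set R) by apply: interval_open.
have /open_subspaceP [V oV VD] := cf _ oa.
by rewrite setIC -VD; apply: measurableI => //; exact: open_measurable2.
Qed.

Lemma continuous_measurable2 (f : R * R -> R) : continuous f ->
  measurable_fun setT (f : RR -> R).
Proof.
move=> cf; apply: within_continuous_measurable2 => //.
exact: continuous_subspaceT.
Qed.

Section affine.
Variables (a b : R).
Hypothesis a0 : 0 < a.
Let phi : measurableTypeR R -> measurableTypeR R := fun x => a * x + b.
Let mphi : measurable_fun setT phi.
Proof.
apply: continuous_measurable_fun => x.
by apply: cvgD; [apply: cvgM; [exact: cvg_cst|exact: cvg_id]|exact: cvg_cst].
Qed.
Let m : {measure set (measurableTypeR R) -> \bar R} :=
  @measure_function_pushforward__canonical__measure_function_Measure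
    _ _ _ _ R leb phi mphi.

Let lebesgue_affine (A : set R) : measurable A ->
  (a%:E * pushforward leb phi A)%E = leb A.
Proof.
move=> mA; pose k : {nonneg R} := NngNum (ltW a0).
apply/esym/(@lebesgue_measure_unique R (mscale k m)) => //= _ [[c d]] _ <-.
rewrite /mscale/= /pushforward.
have -> : phi @^-1` `]c, d] = `](c - b) / a, (d - b) / a]%classic.
  apply/seteqP; split => x /=; rewrite !in_itv/= /phi.
    by move=> /andP[? ?]; apply/andP; rewrite ltr_pdivrMr// ler_pdivlMr//; split; lra.
  by rewrite ltr_pdivrMr// ler_pdivlMr// => /andP[? ?]; apply/andP; split; lra.
rewrite !lebesgue_measure_itv/= !lte_fin ltr_pM2r ?invr_gt0// ltrD2r.
case: ifPn => _; last by rewrite mule0.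
by rewrite -!EFinD -EFinM; congr EFin; field; rewrite gt_eqF.
Qed.

Lemma ge0_integral_affine_pos (f : measurableTypeR R -> \bar R) : measurable_fun setT f ->
  (forall x, 0 <= f x)%E ->
  (a%:E * \int[leb]_x f (a * x + b)%R = \int[leb]_x f x)%E.
Proof.
move=> mf f0; pose k : {nonneg R} := NngNum (ltW a0).
have := @ge0_integral_pushforward _ _ _ _ R phi mphi leb setT f measurableT mf.
move=> /(_ (fun y _ => f0 y)); rewrite preimage_setT => <-.
transitivity (\int[mscale k m]_x f x)%E; first by rewrite ge0_integral_mscale.
by apply: eq_measure_integral => A mA _; exact: lebesgue_affine.
Qed.
End affine.

Lemma ge0_integral_affine (a b : R) (f : measurableTypeR R -> \bar R) : a != 0 ->
  measurable_fun setT f -> (forall x, 0 <= f x)%E ->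
  (`|a|%:E * \int[leb]_x f (a * x + b)%R = \int[leb]_x f x)%E.
Proof.
move=> a0 mf f0; case: (ltgtP 0 a) a0 => // [a_gt0|a_lt0] _.
  by rewrite gtr0_norm// ge0_integral_affine_pos.
rewrite ltr0_norm//; have aN : 0 < - a by rewrite oppr_gt0.
pose phi : measurableTypeR R -> measurableTypeR R := fun x => - x.
have mN : measurable_fun setT phi.
  by apply: continuous_measurable_fun => x; exact: opp_continuous.
have mfN := measurableT_comp mf mN.
have <- : (\int[leb]_x (f \o phi) x = \int[leb]_x f x)%E.
  have := @ge0_integral_pushforward _ _ _ _ R phi mN leb setT f measurableT mf.
  move=> /(_ (fun y _ => f0 y)); rewrite preimage_setT => <-.
  by apply: eq_measure_integral => A mA _; exact: lebesgue_measureN.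
rewrite -(@ge0_integral_affine_pos (- a) (- b) aN _ mfN); last by move=> x; exact: f0.
by congr (_ * _)%E; apply: eq_integral => x _; rewrite /= /phi; congr f; ring.
Qed.

Lemma measurable_fun_comp2 (f : RR -> \bar R) (u v : RR -> R) :
  measurable_fun setT f -> continuous (u : R * R -> R) -> continuous (v : R * R -> R) ->
  measurable_fun setT (fun x => f (u x, v x)).
Proof.
move=> mf cu cv; apply: (measurableT_comp mf).
by apply: measurable_fun_pair; exact: continuous_measurable2.
Qed.

Lemma continuous_affine2 (a b c : R) : continuous (fun x : R * R => a * x.1 + b * x.2 + c).
Proof.
move=> x; apply: cvgD; last exact: cvg_cst.
by apply: cvgD; (apply: cvgM; first exact: cvg_cst); [exact: cvg_fst|exact: cvg_snd].
Qed.

(** A rotation factors into two maps that each change one coordinate only, so that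
by Tonelli's theorem affine substitutions on the line suffice; the
factorization degenerates when the cosine vanishes, and then the two variables
are simply exchanged. *)
Lemma ge0_integral_similarity (f : RR -> \bar R) (c s l p q : R) :
  c ^+ 2 + s ^+ 2 = 1 -> 0 < l ->
  measurable_fun setT f -> (forall x, 0 <= f x)%E ->
  ((l ^+ 2)%:E * \int[mu2]_x f (p + l * (c * x.1 - s * x.2), q + l * (s * x.1 + c * x.2))%R
  = \int[mu2]_x f x)%E.
Proof.
move=> cs1 l0 mf f0.
set F := fun x : RR => f (p + l * (c * x.1 - s * x.2), q + l * (s * x.1 + c * x.2)).
have mF : measurable_fun setT F.
  apply: (@measurable_fun_comp2 f (fun x => p + l * (c * x.1 - s * x.2))
    (fun x => q + l * (s * x.1 + c * x.2))) => //.
    rewrite (_ : (fun x : R * R => _) = (fun x => (l * c) * x.1 + (- l * s) * x.2 + p)).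
      exact: continuous_affine2.
    by apply/funext => x; ring.
  rewrite (_ : (fun x : R * R => _) = (fun x => (l * s) * x.1 + (l * c) * x.2 + q)).
    exact: continuous_affine2.
  by apply/funext => x; ring.
have F0 x : (0 <= F x)%E by exact: f0.
rewrite /mu2 (fubini_tonelli2 _ mF F0) /fubini_G (fubini_tonelli1 _ mf f0) /fubini_F.
have mfx x : measurable_fun setT (fun y => f (x, y)).
  by apply: measurableT_comp mf _; exact: measurable_pair1.
have [c0|c0] := eqVneq c 0.
  have s1 : `|s| = 1.
    by apply/eqP; rewrite -sqrp_eq1// real_normK ?num_real// -cs1 c0 expr0n add0r.
  have s0 : s != 0 by rewrite -normr_eq0 s1 oner_eq0.
  have ls : l * s != 0 by rewrite mulf_neq0// gt_eqF.
  have H y : (l%:E * \int[leb]_x F (x, y) = \int[leb]_w f ((- (l * s)) * y + p, w)%R)%E.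
    rewrite -(@ge0_integral_affine (l * s) q _ ls (mfx _) (fun _ => f0 _)).
    rewrite normrM s1 mulr1 gtr0_norm//; congr (_ * _)%E.
    apply: eq_integral => x _; rewrite /F /=; congr (f (_, _)); rewrite c0; ring.
  have mG : measurable_fun setT (fun x => \int[leb]_w f (x, w))%E.
    exact: (measurable_fun_fubini_tonelli_F _ mf f0).
  have Nls : - (l * s) != 0 by rewrite oppr_eq0.
  have El : `|- (l * s)| = l by rewrite normrN normrM s1 mulr1 gtr0_norm.
  have := @ge0_integral_affine (- (l * s)) p _ Nls mG (fun x => integral_ge0 _ (fun y _ => f0 _)).
  rewrite El => <-; rewrite expr2 EFinM -muleA; congr (_ * _)%E.
  rewrite -ge0_integralZl//=; last 3 first.
  - exact: (measurable_fun_fubini_tonelli_G _ mF F0).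
  - by move=> y _; exact: integral_ge0.
  - by rewrite lee_fin ltW.
  by apply: eq_integral => y _; rewrite H.
have lc : l * c != 0 by rewrite mulf_neq0// gt_eqF.
have lc' : l / c != 0 by rewrite mulf_neq0 ?invr_eq0// gt_eqF.
pose G (z : RR) := f (z.1, (l / c) * z.2 + (s / c * z.1 + (q - s / c * p))).
have mG : measurable_fun setT G.
  apply: (@measurable_fun_comp2 f (fun x => x.1)
    (fun x => (l / c) * x.2 + (s / c * x.1 + (q - s / c * p)))) => //.
    by move=> x; exact: cvg_fst.
  rewrite (_ : (fun x : R * R => _) = (fun x => (s / c) * x.1 + (l / c) * x.2 + (q - s / c * p))).
    exact: continuous_affine2.
  by apply/funext => x; ring.
have G0 x : (0 <= G x)%E by exact: f0.
have mGy y : measurable_fun setT (fun x => G (x, y)).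
  by apply: measurableT_comp mG _; exact: measurable_pair2.
have H1 y : (`|l * c|%:E * \int[leb]_x F (x, y) = \int[leb]_u G (u, y))%E.
  rewrite -(@ge0_integral_affine (l * c) (p - l * s * y) _ lc (mGy y) (fun _ => G0 _)).
  congr (_ * _)%E; apply: eq_integral => x _; rewrite /F /G /=; congr (f (_, _)); first by ring.
  apply/eqP; rewrite -subr_eq0; apply/eqP.
  rewrite [LHS](_ : _ = l * y / c * (c ^+ 2 + s ^+ 2 - 1)); last by field.
  by rewrite cs1 subrr mulr0.
have -> : l ^+ 2 = `|l / c| * `|l * c|.
  rewrite -normrM (_ : l / c * (l * c) = l ^+ 2); last by field.
  by rewrite ger0_norm// sqr_ge0.
rewrite EFinM -muleA -ge0_integralZl//=; last 2 first.
  - exact: (measurable_fun_fubini_tonelli_G _ mF F0).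
  - by move=> y _; exact: integral_ge0.
under eq_integral do rewrite H1.
rewrite -(fubini_tonelli _ mG G0) -ge0_integralZl//=; last 2 first.
  - exact: (measurable_fun_fubini_tonelli_F _ mG G0).
  - by move=> y _; exact: integral_ge0.
apply: eq_integral => x _.
by rewrite -(@ge0_integral_affine (l / c) (s / c * x + (q - s / c * p)) _ lc' (mfx x)).
Qed.

End PlaneMeasure.

(** * Continuous functions on the square *)

Section WithinContinuous.
Context {R : realType}.
Variable A : set (R * R).
Notation wc f := {within A, continuous f}.

Lemma within_contD (f g : R * R -> R) : wc f -> wc g -> wc (fun p => f p + g p).
Proof. by move=> cf cg x; apply: cvgD; [exact: cf|exact: cg]. Qed.

Lemma within_contM (f g : R * R -> R) : wc f -> wc g -> wc (fun p => f p * g p).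
Proof. by move=> cf cg x; apply: cvgM; [exact: cf|exact: cg]. Qed.

Lemma within_cont_cst (c : R) : wc (fun=> c).
Proof. by move=> x; exact: cvg_cst. Qed.

Lemma within_cont_comp (h : R -> R) (f : R * R -> R) : continuous h -> wc f -> wc (fun p => h (f p)).
Proof. by move=> ch cf; apply: (@within_continuous_comp _ _ _ A f h) => // x _; exact: ch. Qed.
End WithinContinuous.

Section Square.
Context {R : realType}.
Notation RR := (measurableTypeR R * measurableTypeR R)%type.
Notation leb := (@lebesgue_measure R).

(** A square containing the support of the kernel.  It replaces the disc as domain
of integration because its slices are constant, which makes Fubini's theorem
and integration by parts in the first variable immediate. *)
Definition Sq : set (R * R) := `[-1, 1]%classic `*` `[-1, 1]%classic.

Lemma SqE (x y : R) : Sq (x, y) <-> `|x| <= 1 /\ `|y| <= 1.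
Proof.
by rewrite /Sq /setX/= !in_itv/= -!ler_norml.
Qed.

Lemma Sq_compact : compact Sq.
Proof. by apply: compact_setX; exact: segment_compact. Qed.

Lemma Sq_measurable : measurable (Sq : set RR).
Proof. by apply: measurableX; exact: measurable_itv. Qed.

Lemma Sq_finite : (mu2 (Sq : set RR) < +oo)%E.
Proof.
rewrite /mu2 product_measure1E//.
have m2 : lebesgue_measure (`[-1, 1]%classic : set R) = (1 - -1)%:E.
  by rewrite lebesgue_measure_itv/= lte_fin ifT//; lra.
set m := lebesgue_measure _ in m2; rewrite -[X in (X < _)%E]/(m * m)%E m2.
by rewrite -EFinM ltry.
Qed.

Notation cSq f := {within Sq, continuous f}.

Lemma cSq_bounded (f : R * R -> R) : cSq f -> exists M : R, forall p, Sq p -> `|f p| <= M.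
Proof.
move=> cf; have /compact_bounded[M [_ mrt]] := continuous_compact cf Sq_compact.
exists (`|M| + 1) => p Sp; apply: mrt; first by rewrite ltr_pwDr// ler_norm.
by exists p.
Qed.

Lemma cSq_integrable (f : R * R -> R) : cSq f -> mu2.-integrable (Sq : set RR) (EFin \o f).
Proof.
move=> cf; apply: measurable_bounded_integrable.
- exact: Sq_measurable.
- exact: Sq_finite.
- exact: (within_continuous_measurable2 Sq_measurable cf).
- have [M HM] := cSq_bounded cf.
  exists M; split; first exact: num_real.
  by move=> x Mx p Sp; apply: le_trans (HM _ Sp) (ltW Mx).
Qed.

Lemma cSq_fst : cSq (fun p : R * R => p.1).
Proof. by apply: continuous_subspaceT => x; exact: cvg_fst. Qed.

Lemma cSq_snd : cSq (fun p : R * R => p.2).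
Proof. by apply: continuous_subspaceT => x; exact: cvg_snd. Qed.

Lemma cSq_slice (f : R * R -> R) (y : R) : `|y| <= 1 -> cSq f ->
  {within `[-1, 1], continuous (fun x => f (x, y))}.
Proof.
move=> y1 /subspace_continuousP cf; apply/subspace_continuousP => x x1.
have Sxy : Sq (x, y) by split => //=; rewrite in_itv/= -ler_norml.
apply: cvg_trans (cf _ Sxy) => A /= [[B1 B2] [/= nB1 nB2] BA].
apply: filterS nB1 => u Bu u1; apply: BA => /=.
  by split => //; exact: nbhs_singleton.
by split => //=; rewrite in_itv/= -ler_norml.
Qed.

Lemma cSq_slice2 (f : R * R -> R) (x : R) : `|x| <= 1 -> cSq f ->
  {within `[-1, 1], continuous (fun y => f (x, y))}.
Proof.
move=> x1 /subspace_continuousP cf; apply/subspace_continuousP => y y1.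
have Sxy : Sq (x, y) by split => //=; rewrite in_itv/= -ler_norml.
apply: cvg_trans (cf _ Sxy) => A /= [[B1 B2] [/= nB1 nB2] BA].
apply: filterS nB2 => u Bu u1; apply: BA => /=.
  by split => //; exact: nbhs_singleton.
by split => //=; rewrite in_itv/= -ler_norml.
Qed.

Lemma Sq_fubini_G (f : R * R -> R) : cSq f ->
  fubini_G leb (EFin \o (f \_ Sq)) =
  EFin \o ((fun y => \int[leb]_(x in `[-1, 1]) f (x, y)) \_ `[-1, 1]%classic).
Proof.
move=> cf; apply/funext => y; rewrite /fubini_G /= patchE.
case: ifPn => [|]; rewrite ?inE ?notin_setE => y1; last first.
  transitivity (\int[leb]_x (cst 0%E x))%E; last by rewrite integral0.
  by apply: eq_integral => x _ /=; rewrite patchE memNset// => -[/= ? ?].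
have yn : `|y| <= 1 by move: y1; rewrite /= in_itv/= -ler_norml.
transitivity (\int[leb]_x (((fun x => f (x, y)) \_ `[-1, 1]%classic) x)%:E)%E.
  apply: eq_integral => x _ /=; rewrite !patchE; congr EFin.
  have [x1|x1] := boolP (x \in `[-1, 1]%classic); last first.
    by rewrite memNset// => -[/= ? ?]; rewrite notin_setE in x1.
  by rewrite mem_set//; split => //=; rewrite inE in x1.
have fxi : leb.-integrable `[-1, 1] (EFin \o (fun x => f (x, y))).
  by apply: continuous_compact_integrable; [exact: segment_compact|exact: cSq_slice].
rewrite /= fineK; last exact: (integrable_fin_num _ fxi).
rewrite [RHS]integral_mkcond; apply: eq_integral => x _.
by rewrite -[X in _ = X _]/((EFin \o (fun x => f (x, y))) \_ `[-1, 1]%classic) restrict_EFin.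
Qed.

Lemma Sq_fubini_F (f : R * R -> R) : cSq f ->
  fubini_F leb (EFin \o (f \_ Sq)) =
  EFin \o ((fun x => \int[leb]_(y in `[-1, 1]) f (x, y)) \_ `[-1, 1]%classic).
Proof.
move=> cf; apply/funext => x; rewrite /fubini_F /= patchE.
case: ifPn => [|]; rewrite ?inE ?notin_setE => x1; last first.
  transitivity (\int[leb]_y (cst 0%E y))%E; last by rewrite integral0.
  by apply: eq_integral => y _ /=; rewrite patchE memNset// => -[/= ? ?].
have xn : `|x| <= 1 by move: x1; rewrite /= in_itv/= -ler_norml.
transitivity (\int[leb]_y (((fun y => f (x, y)) \_ `[-1, 1]%classic) y)%:E)%E.
  apply: eq_integral => y _ /=; rewrite !patchE; congr EFin.
  have [y1|y1] := boolP (y \in `[-1, 1]%classic); last first.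
    by rewrite memNset// => -[/= ? ?]; rewrite notin_setE in y1.
  by rewrite mem_set//; split => //=; rewrite inE in y1.
have fxi : leb.-integrable `[-1, 1] (EFin \o (fun y => f (x, y))).
  by apply: continuous_compact_integrable; [exact: segment_compact|exact: cSq_slice2].
rewrite /= fineK; last exact: (integrable_fin_num _ fxi).
rewrite [RHS]integral_mkcond; apply: eq_integral => y _.
by rewrite -[X in _ = X _]/((EFin \o (fun y => f (x, y))) \_ `[-1, 1]%classic) restrict_EFin.
Qed.

Lemma Sq_patch_integrable (f : R * R -> R) : cSq f ->
  (leb \x leb)%E.-integrable setT (EFin \o (f \_ Sq)).
Proof.
move=> cf; rewrite -restrict_EFin.
exact: (proj1 (integrable_mkcond _ Sq_measurable) (cSq_integrable cf)).
Qed.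

Lemma Sq_fubini21 (f : R * R -> R) : cSq f ->
  \int[mu2]_(p in (Sq : set RR)) f p =
  \int[leb]_(y in `[-1, 1]) \int[leb]_(x in `[-1, 1]) f (x, y).
Proof.
move=> cf; rewrite [LHS]Rintegral_mkcond [in LHS]/Rintegral.
rewrite -(integral21_prod_meas1 (Sq_patch_integrable cf)) [RHS]Rintegral_mkcond.
congr fine; apply: eq_integral => y _.
exact: (congr1 (fun F => F y) (Sq_fubini_G cf)).
Qed.

Lemma Sq_fubini12 (f : R * R -> R) : cSq f ->
  \int[mu2]_(p in (Sq : set RR)) f p =
  \int[leb]_(x in `[-1, 1]) \int[leb]_(y in `[-1, 1]) f (x, y).
Proof.
move=> cf; rewrite [LHS]Rintegral_mkcond [in LHS]/Rintegral.
rewrite -(integral12_prod_meas1 (Sq_patch_integrable cf)) [RHS]Rintegral_mkcond.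
congr fine; apply: eq_integral => x _.
exact: (congr1 (fun F => F x) (Sq_fubini_F cf)).
Qed.

Lemma Sq_inner_integrable (f : R * R -> R) : cSq f ->
  leb.-integrable `[-1, 1] (EFin \o (fun x => \int[leb]_(y in `[-1, 1]) f (x, y))).
Proof.
move=> cf; have := integrable_fubini_F (Sq_patch_integrable cf).
rewrite -[X in _.-integrable _ X]/(fubini_F leb (EFin \o (f \_ Sq))) (Sq_fubini_F cf) -restrict_EFin => H.
by apply: (proj2 (integrable_mkcond _ _) H); exact: measurable_itv.
Qed.

End Square.
Notation cSq f := {within Sq, continuous f}.

(** * Averages against the interaction kernel *)

Section KernelAverage.
Context {R : realType}.
Notation RR := (measurableTypeR R * measurableTypeR R)%type.
Notation leb := (@lebesgue_measure R).
Variables (J : R * R -> R) (hJ : interaction_kernel J).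

Definition Eav (f : R * R -> R) : R := \int[mu2]_(p in (Sq : set RR)) (J p * f p).
Definition dJ : R * R -> R := 'D_(1, 0) J.
Definition Eav1 (f : R * R -> R) : R := \int[mu2]_(p in (Sq : set RR)) (dJ p * f p).

Lemma J_cont : continuous J.
Proof. by move=> x; have [/(_ x I)] := kernel_C1 hJ. Qed.

Lemma dJ_cont : continuous dJ.
Proof. by move=> x; have [_ [_ [/(_ x I)]]] := kernel_C1 hJ. Qed.

Lemma cSqJ : cSq J. Proof. exact: continuous_subspaceT J_cont. Qed.
Lemma cSqdJ : cSq dJ. Proof. exact: continuous_subspaceT dJ_cont. Qed.

Lemma J_slice (x y : R) : is_derive x 1 (fun t => J (t, y)) (dJ (x, y)).
Proof.
have [_ [/(_ (x, y) I)[dJx _] _ _]] := kernel_C1 hJ.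
have E : (fun h : R => h^-1 *: ((fun t => J (t, y)) (h *: 1 + x) - J (x, y))) =
         (fun h : R => h^-1 *: (J (h *: (1, 0) + (x, y)) - J (x, y))).
  apply/funext => h; congr (_ *: (J _ - _)).
  by apply/eqP; rewrite xpair_eqE /= scaler0 add0r !eqxx.
split; first by rewrite /derivable E.
by rewrite /derive E.
Qed.

Lemma J_out (x y : R) : 1 <= x ^+ 2 + y ^+ 2 -> J (x, y) = 0.
Proof.
have out a b : 1 < a ^+ 2 + b ^+ 2 -> J (a, b) = 0.
  move=> ab; apply/eqP/negP => /negP Jab.
  have : [set xi | enorm xi <= 1] (a, b).
    by rewrite -(kernel_supp hJ); apply: subset_closure.
  rewrite /= /enorm /dotp/= -[X in _ <= X]sqrtr1 ler_sqrt// => h.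
  by move: ab; rewrite !expr2 ltNge h.
move=> xy; apply/eqP/negP => /negP Jxy.
have cJ : {for (1 : R), continuous (fun t : R => J (t * x, t * y))}.
  apply: (@continuous_comp _ _ _ (fun t : R => (t * x, t * y)) J); last exact: J_cont.
  exact: (@scalel_continuous R (R^o * R^o)%type (x, y)).
have /nbhs_ballP[e /= e0 He] : \forall t \near (1 : R), J (t * x, t * y) != 0.
  have cJ' : J (t * x, t * y) @[t --> (1 : R)] --> J (x, y).
    by rewrite -[X in _ --> J (X, _)]mul1r -[X in _ --> J (_, X)]mul1r; exact: cJ.
  exact: (cvgr_neq0 _ cJ' Jxy).
have := He (1 + e / 2); rewrite /ball/= => /(_ _)/negP; apply.
  by rewrite opprD addrA subrr add0r normrN gtr0_norm ?divr_gt0//; lra.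
apply/eqP; apply: out; rewrite !exprMn -mulrDr.
have : 1 < (1 + e / 2) ^+ 2 by rewrite expr_gt1//; lra.
move=> ?; nra.
Qed.

Lemma J_offSq p : ~ Sq p -> J p = 0.
Proof.
case: p => x y /SqE nS; apply: J_out.
have [x1|x1] := leP `|x| 1; have [y1|y1] := leP `|y| 1.
- by exfalso; apply: nS.
- have : 1 <= `|y| ^+ 2 by rewrite expr_ge1// ltW.
  by rewrite real_normK ?num_real//; have := sqr_ge0 x; lra.
- have : 1 <= `|x| ^+ 2 by rewrite expr_ge1// ltW.
  by rewrite real_normK ?num_real//; have := sqr_ge0 y; lra.
- have : 1 <= `|x| ^+ 2 by rewrite expr_ge1// ltW.
  by rewrite real_normK ?num_real//; have := sqr_ge0 y; lra.
Qed.

Lemma J_radial (x y x' y' : R) : x ^+ 2 + y ^+ 2 = x' ^+ 2 + y' ^+ 2 -> J (x, y) = J (x', y').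
Proof. by move=> h; apply: (kernel_radial hJ); rewrite /enorm /dotp/= -!expr2 h. Qed.

Let J0 p : 0 <= J p := kernel_ge0 hJ p.

Lemma Eav_int (f : R * R -> R) : cSq f ->
  mu2.-integrable (Sq : set RR) (EFin \o (fun p => J p * f p)).
Proof. by move=> cf; apply: cSq_integrable; apply: within_contM => //; exact: cSqJ. Qed.

Lemma Eav1_int (f : R * R -> R) : cSq f ->
  mu2.-integrable (Sq : set RR) (EFin \o (fun p => dJ p * f p)).
Proof. by move=> cf; apply: cSq_integrable; apply: within_contM => //; exact: cSqdJ. Qed.

Lemma eq_Eav (f g : R * R -> R) : (forall p, Sq p -> f p = g p) -> Eav f = Eav g.
Proof. by move=> fg; apply: eq_Rintegral => p; rewrite inE => Sp; rewrite fg. Qed.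

Lemma EavD (f g : R * R -> R) : cSq f -> cSq g ->
  Eav (fun p => f p + g p) = Eav f + Eav g.
Proof.
move=> cf cg; rewrite /Eav -RintegralD//; [|exact: Sq_measurable|exact: Eav_int|exact: Eav_int].
by apply: eq_Rintegral => p _; rewrite mulrDr.
Qed.

Lemma EavZ (c : R) (f : R * R -> R) : cSq f -> Eav (fun p => c * f p) = c * Eav f.
Proof.
move=> cf; rewrite /Eav -RintegralZl//; [|exact: Sq_measurable|exact: Eav_int].
by apply: eq_Rintegral => p _; rewrite mulrCA.
Qed.

Lemma EavB (f g : R * R -> R) : cSq f -> cSq g ->
  Eav (fun p => f p - g p) = Eav f - Eav g.
Proof.
move=> cf cg; rewrite -mulN1r -EavZ// -EavD//; last first.
  by apply: within_contM => //; exact: within_cont_cst.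
by apply: eq_Eav => p _; rewrite mulN1r.
Qed.

Lemma le_Eav (f g : R * R -> R) : cSq f -> cSq g -> (forall p, Sq p -> f p <= g p) ->
  Eav f <= Eav g.
Proof.
move=> cf cg fg; apply: le_Rintegral; [exact: Sq_measurable|exact: Eav_int|exact: Eav_int|].
by move=> p Sp; rewrite ler_wpM2l// fg.
Qed.

Lemma Eav_patch (f : R * R -> R) : Eav f = \int[mu2]_p (J p * f p).
Proof.
rewrite /Eav Rintegral_mkcond; apply: eq_Rintegral => p _; rewrite patchE.
by case: ifPn => //; rewrite notin_setE => /J_offSq ->; rewrite mul0r.
Qed.

Lemma Eav1E : Eav (fun=> 1) = 1.
Proof.
rewrite Eav_patch /Rintegral; under eq_integral do rewrite mulr1.
by rewrite (kernel_mass hJ).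
Qed.

Lemma Eav_cst c : Eav (fun=> c) = c.
Proof.
rewrite -[RHS]mulr1 -Eav1E -EavZ; last exact: within_cont_cst.
by apply: eq_Eav => p _; rewrite mulr1.
Qed.

Lemma Eav_norm_le (f : R * R -> R) M : cSq f -> (forall p, Sq p -> `|f p| <= M) ->
  `|Eav f| <= M.
Proof.
move=> cf fM; rewrite ler_norml -{2}(Eav_cst M) -(Eav_cst (- M)).
apply/andP; split; apply: le_Eav => //; try exact: within_cont_cst.
  by move=> p /fM; rewrite ler_norml => /andP[].
by move=> p /fM; rewrite ler_norml => /andP[].
Qed.

Lemma Eav_dist (f g : R * R -> R) M : cSq f -> cSq g ->
  (forall p, Sq p -> `|f p - g p| <= M) -> `|Eav f - Eav g| <= M.
Proof.
move=> cf cg fg; rewrite -EavB//; apply: Eav_norm_le => // x.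
by apply: cvgB; [exact: cf|exact: cg].
Qed.

(** Bounds errors after an integration by parts, where the derivative of the
kernel replaces the kernel as weight. *)
Lemma Eav1_bound : exists2 M1, 0 < M1 & forall (f : R * R -> R) (M : R), cSq f ->
  (forall p, Sq p -> `|f p| <= M) -> `|Eav1 f| <= M1 * M.
Proof.
have [B HB] := cSq_bounded cSqdJ.
have fS : mu2 (Sq : set RR) \is a fin_num by rewrite ge0_fin_numE; [exact: Sq_finite|exact: measure_ge0].
have m0 : 0 <= fine (mu2 (Sq : set RR)) by apply: fine_ge0; exact: measure_ge0.
exists ((`|B| + 1) * (fine (mu2 (Sq : set RR)) + 1)); first by rewrite mulr_gt0// ltr_pwDr.
move=> f M cf fM.
have M0 : 0 <= M.
  by apply: le_trans (fM (0, 0) _); [exact: normr_ge0|apply/SqE; rewrite !normr0].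
apply: (le_trans (le_normr_Rintegral Sq_measurable (Eav1_int cf))).
have icst := cSq_integrable (@within_cont_cst R Sq ((`|B| + 1) * M)).
apply: (@le_trans _ _ (\int[mu2]_(p in (Sq : set RR)) ((`|B| + 1) * M))).
  apply: le_Rintegral; [exact: Sq_measurable| | exact: icst |].
    have := integrable_norm (Eav1_int cf).
    by [].
  move=> p Sp; rewrite normrM ler_pM// ?fM//; apply: le_trans (HB _ Sp) _.
  by rewrite (le_trans (ler_norm B))// lerDl.
rewrite Rintegral_cst; last exact: Sq_measurable.
rewrite -mulrA [X in _ <= X]mulrAC -mulrA ler_wpM2l ?addr_ge0// ler_wpM2l//.
by rewrite lerDl.
Qed.

Lemma is_derive_LRcontinuous (f df : R -> R) (a b : R) : a < b ->
  (forall x, a <= x <= b -> is_derive x 1 f (df x)) ->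
  derivable_oo_LRcontinuous f a b /\ {in `]a, b[, derive1 f =1 df}.
Proof.
move=> ab dfE; have cf x : a <= x <= b -> {for x, continuous f}.
  by move=> /dfE [dx _]; apply/differentiable_continuous/derivable1_diffP.
split; first split.
- by move=> x; rewrite in_itv/= => /andP[? ?]; have [] := dfE x; rewrite ?ltW//; apply/andP; split; exact: ltW.
- by apply: cvg_at_right_filter; apply: cf; rewrite lexx ltW.
- by apply: cvg_at_left_filter; apply: cf; rewrite lexx ltW.
move=> x; rewrite in_itv/= => /andP[ax xb].
have [|_ <-] := dfE x; first by rewrite !ltW.
by rewrite derive1E.
Qed.

(** The boundary terms vanish because [J] does on the boundary of the square. *)
Lemma Eav_by_parts (G G1 : R * R -> R) : cSq G -> cSq G1 ->
  (forall x y : R, `|x| <= 1 -> `|y| <= 1 -> is_derive x 1 (fun t => G (t, y)) (G1 (x, y))) ->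
  Eav G1 = - Eav1 G.
Proof.
move=> cG cG1 dG; apply/eqP; rewrite -subr_eq0 opprK; apply/eqP.
rewrite /Eav /Eav1 -RintegralD; [|exact: Sq_measurable|exact: Eav_int|exact: Eav1_int].
rewrite Sq_fubini21; last first.
  by apply: within_contD; apply: within_contM => //; [exact: cSqJ|exact: cSqdJ].
rewrite [RHS](_ : 0 = \int[leb]_(y in `[-1, 1]) (cst 0 y)); last first.
  by rewrite Rintegral_cst ?mul0r//; exact: measurable_itv.
apply: eq_Rintegral => y; rewrite inE/= in_itv/= -ler_norml => y1.
have n11 : (-1 < 1 :> R) by lra.
have int1 (f g : R * R -> R) : cSq f -> cSq g ->
    leb.-integrable `[-1, 1] (EFin \o (fun x => f (x, y) * g (x, y))).
  move=> cf cg; apply: continuous_compact_integrable; first exact: segment_compact.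
  exact: (cSq_slice y1 (within_contM cf cg)).
rewrite RintegralD; [|exact: measurable_itv|exact: int1 cSqJ cG1|exact: int1 cSqdJ cG].
have [LJ dJE] := @is_derive_LRcontinuous (fun x => J (x, y)) (fun x => dJ (x, y)) _ _ n11
  (fun x _ => J_slice x y).
have [LG dGE] : derivable_oo_LRcontinuous (fun x => G (x, y)) (-1) 1 /\
    {in `]-1, 1[, derive1 (fun x => G (x, y)) =1 (fun x => G1 (x, y))}.
  by apply: is_derive_LRcontinuous => // x; rewrite -ler_norml => x1; exact: dG.
rewrite (Rintegration_by_parts n11 (cSq_slice y1 cSqdJ) LJ dJE (cSq_slice y1 cG1) LG dGE).
rewrite !J_out ?expr1n ?sqrrN ?expr1n ?lerDl ?sqr_ge0//.
by rewrite !mul0r subrr sub0r addNr.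
Qed.

Lemma Rintegral_rot (f : RR -> R) (c s : R) : c ^+ 2 + s ^+ 2 = 1 -> measurable_fun setT f ->
  \int[mu2]_x f (c * x.1 - s * x.2, s * x.1 + c * x.2) = \int[mu2]_x f x.
Proof.
move=> cs mf; rewrite /Rintegral; congr fine.
have mfE : measurable_fun setT (EFin \o f) by apply/measurable_EFinP.
have H (g : RR -> \bar R) : measurable_fun setT g -> (forall x, 0 <= g x)%E ->
    (\int[mu2]_x g (c * x.1 - s * x.2, s * x.1 + c * x.2)%R = \int[mu2]_x g x)%E.
  move=> mg g0; rewrite -(@ge0_integral_similarity R g c s 1 0 0 cs ltr01 mg g0).
  by rewrite expr1n mul1e; apply: eq_integral => x _; rewrite !mul1r !add0r.
rewrite integralE [RHS]integralE; congr (_ - _)%E.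
  rewrite -(H (funepos (EFin \o f)) (measurable_funepos mfE) (funepos_ge0 _)).
  by apply: eq_integral => x _; rewrite !funeposE.
rewrite -(H (funeneg (EFin \o f)) (measurable_funeneg mfE) (funeneg_ge0 _)).
  by apply: eq_integral => x _; rewrite !funenegE.
Qed.

(** The kernel is radial. *)
Lemma Eav_rot (f : R * R -> R) (c s : R) : c ^+ 2 + s ^+ 2 = 1 -> continuous f ->
  Eav (fun x => f (c * x.1 - s * x.2, s * x.1 + c * x.2)) = Eav f.
Proof.
move=> cs cf; rewrite !Eav_patch -(@Rintegral_rot (fun p => J p * f p) c s) //; last first.
  by apply: continuous_measurable2 => x; apply: cvgM; [exact: J_cont|exact: cf].
apply: eq_Rintegral => -[x y] _ /=; congr (_ * _); apply: J_radial.
rewrite [RHS](_ : _ = (c ^+ 2 + s ^+ 2) * (x ^+ 2 + y ^+ 2)); last by ring.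
by rewrite cs mul1r.
Qed.

(** Convolution with [Jbar], written as a planar average so that the isotropy of
[J] remains available; see [convol_Jstar]. *)
Definition Jstar (f : R -> R) (z : R) : R := Eav (fun p => f (z + p.1)).

Lemma cSq_shift (f : R -> R) z : continuous f -> cSq (fun p : R * R => f (z + p.1)).
Proof.
move=> cf; apply: (within_cont_comp (h := f) (f := fun p => z + p.1)) => //.
by apply: within_contD; [exact: within_cont_cst|exact: cSq_fst].
Qed.

Lemma Rintegral_shift_flip (e b : R) (f : measurableTypeR R -> R) : `|e| = 1 ->
  measurable_fun setT f -> \int[leb]_x f (e * x + b) = \int[leb]_x f x.
Proof.
move=> e1 mf; rewrite /Rintegral; congr fine.
have e0 : e != 0 by rewrite -normr_eq0 e1 oner_eq0.
have mfE : measurable_fun setT (EFin \o f) by apply/measurable_EFinP.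
have H (g : measurableTypeR R -> \bar R) : measurable_fun setT g -> (forall x, 0 <= g x)%E ->
    (\int[leb]_x g (e * x + b)%R = \int[leb]_x g x)%E.
  by move=> mg g0; rewrite -(@ge0_integral_affine R e b g e0 mg g0) e1 mul1e.
rewrite integralE [RHS]integralE; congr (_ - _)%E.
  rewrite -(H (funepos (EFin \o f)) (measurable_funepos mfE) (funepos_ge0 _)).
  by apply: eq_integral => x _; rewrite !funeposE.
rewrite -(H (funeneg (EFin \o f)) (measurable_funeneg mfE) (funeneg_ge0 _)).
  by apply: eq_integral => x _; rewrite !funenegE.
Qed.

Lemma Jbar_segment (x : R) : Jbar J x = \int[leb]_(y in `[-1, 1]) J (x, y).
Proof.
rewrite [RHS]Rintegral_mkcond; apply: eq_Rintegral => y _; rewrite patchE.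
case: ifPn => //; rewrite notin_setE => y1; apply: J_offSq => -[_]; exact: y1.
Qed.

Lemma Jbar_out (x : R) : 1 <= `|x| -> Jbar J x = 0.
Proof.
move=> x1; rewrite /Jbar (_ : (fun y => J (x, y)) = cst 0); last first.
  apply/funext => y; apply: J_out.
  have : 1 <= `|x| ^+ 2 by rewrite expr_ge1.
  by rewrite real_normK ?num_real//; have := sqr_ge0 y; lra.
by rewrite Rintegral_cst ?mul0r//.
Qed.

Lemma Jbar_even x : Jbar J (- x) = Jbar J x.
Proof. by apply: eq_Rintegral => y _; apply: J_radial; rewrite sqrrN. Qed.

Lemma Jstar_Jbar (f : R -> R) z : continuous f ->
  Jstar f z = \int[leb]_(x in `[-1, 1]) (Jbar J x * f (z + x)).
Proof.
move=> cf; rewrite /Jstar /Eav Sq_fubini12; last first.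
  by apply: within_contM; [exact: cSqJ|exact: cSq_shift].
apply: eq_Rintegral => x; rewrite inE/= in_itv/= -ler_norml => x1.
rewrite RintegralZr ?Jbar_segment//=.
by apply: continuous_compact_integrable; [exact: segment_compact|exact: cSq_slice2 x1 cSqJ].
Qed.

Lemma Jbar_integrable : leb.-integrable `[-1, 1] (EFin \o Jbar J).
Proof.
have := Sq_inner_integrable cSqJ.
by apply: eq_integrable => // x _ /=; rewrite -Jbar_segment.
Qed.

Lemma KJbar_integrable (f : R -> R) z : continuous f ->
  leb.-integrable `[-1, 1] (EFin \o (fun x => Jbar J x * f (z + x))).
Proof.
move=> cf; have := Sq_inner_integrable (within_contM cSqJ (@cSq_shift f z cf)).
apply: eq_integrable => // x; rewrite inE/= in_itv/= -ler_norml => x1.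
congr EFin; rewrite RintegralZr ?Jbar_segment//=.
by apply: continuous_compact_integrable; [exact: segment_compact|exact: cSq_slice2 x1 cSqJ].
Qed.

Lemma convol_Jstar (f : R -> R) z : continuous f -> convol (Jbar J) f z = Jstar f z.
Proof.
move=> cf; have mJ : measurable_fun setT (fun y : measurableTypeR R => Jbar J y).
  rewrite (_ : (fun y => _) = (Jbar J) \_ `[-1, 1]%classic).
    apply/(measurable_restrictT _ _).1; first exact: measurable_itv.
    by have /integrableP[/measurable_EFinP] := Jbar_integrable.
  apply/funext => y; rewrite patchE; case: ifPn => //; rewrite notin_setE /= in_itv/= -ler_norml.
  by move=> /negP; rewrite -ltNge => /ltW /Jbar_out.
have mf : measurable_fun setT (fun y : measurableTypeR R => Jbar J (z - y) * f y).
  apply: measurable_funM; last exact: continuous_measurable_fun.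
  apply: (measurableT_comp mJ); apply: continuous_measurable_fun => y.
  by apply: cvgB; [exact: cvg_cst|exact: cvg_id].
rewrite /convol -(@Rintegral_shift_flip 1 z _ (normr1 _) mf) Jstar_Jbar// [RHS]Rintegral_mkcond.
apply: eq_Rintegral => x _; rewrite patchE mul1r opprD addrCA subrr addr0 Jbar_even addrC.
case: ifPn => //; rewrite notin_setE /= in_itv/= -ler_norml => /negP; rewrite -ltNge => /ltW x1.
by rewrite Jbar_out// mul0r.
Qed.

Lemma exists_J0_gt0 : exists2 y0 : R, `|y0| < 1 & 0 < J (0, y0).
Proof.
have [xi Jxi] : exists xi, J xi != 0.
  apply: contrapT => /forallNP H; have := kernel_mass hJ.
  rewrite (eq_integral (cst 0%E)) ?integral0; last first.
    by move=> p _; congr EFin; apply/eqP/negP => /negP /H.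
  by move=> /eqP; rewrite eqe eq_sym oner_eq0.
case: xi Jxi => x y Jxy; set n := Num.sqrt (x ^+ 2 + y ^+ 2).
have nE : n ^+ 2 = x ^+ 2 + y ^+ 2 by rewrite sqr_sqrtr// addr_ge0 ?sqr_ge0.
have n0 : 0 <= n by exact: sqrtr_ge0.
have J0n : J (0, n) != 0 by rewrite -(@J_radial x y)// expr0n add0r nE.
exists n; last by rewrite lt_neqAle eq_sym J0n J0.
rewrite ltNge; apply/negP; rewrite ger0_norm// => n1; move: J0n; rewrite J_out ?eqxx//.
by rewrite expr0n add0r expr_ge1.
Qed.

(** [J] is radial and not identically zero, so it is positive at some point
[(0, y0)] and hence [Jbar] is bounded below near [0]. *)
Lemma Jstar_minorization : exists d c0 : R, [/\ 0 < d, d <= 1, 0 < c0 &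
  forall (f : R -> R) (z a b : R), continuous f -> (forall x, 0 <= f x) ->
    a <= b -> `|a - z| <= d -> `|b - z| <= d ->
    c0 * \int[leb]_(x in `[a, b]) f x <= Jstar f z].
Proof.
have [y0 y01 Jy0] := exists_J0_gt0.
set e := J (0, y0) / 2; have e0 : 0 < e by rewrite divr_gt0.
have /nbhs_ballP[d1 /= d10 Hd1] : \forall p \near (0, y0), e < J p.
  have ltJ : e < J (0, y0) by rewrite /e; lra.
  exact: (cvgr_gt (J (0, y0)) (@J_cont (0, y0)) _ ltJ).
pose d := Num.min (d1 / 2) ((1 - `|y0|) / 2).
have d0 : 0 < d by rewrite lt_min !divr_gt0// subr_gt0.
have dd1 : d <= d1 / 2 by rewrite ge_min lexx.
have dy0 : d <= (1 - `|y0|) / 2 by rewrite ge_min lexx orbT.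
have dl1 : d <= 1 by have := normr_ge0 y0; lra.
have JD (x y : R) : `|x| <= d -> `|y - y0| <= d -> e <= J (x, y).
  move=> xd yd; apply/ltW/Hd1; split => /=; rewrite /ball/=.
    by rewrite sub0r normrN; lra.
  by rewrite distrC; lra.
have Jb x : `|x| <= d -> e * (2 * d) <= Jbar J x.
  move=> xd; have x1 : `|x| <= 1 by lra.
  have Ji : leb.-integrable `[-1, 1] (EFin \o (fun y => J (x, y))).
    by apply: continuous_compact_integrable; [exact: segment_compact|exact: cSq_slice2 x1 cSqJ].
  have sub : `[y0 - d, y0 + d]%classic `<=` (`[-1, 1]%classic : set R).
    move=> y /=; rewrite !in_itv/= => /andP[? ?].
    by have := ler_norm y0; have := ler_norm (- y0); rewrite normrN => ? ?; apply/andP; split; lra.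
  rewrite Jbar_segment; apply: (@le_trans _ _ (\int[leb]_(y in `[(y0 - d), (y0 + d)]) J (x, y))).
    have -> : e * (2 * d) = \int[leb]_(y in `[(y0 - d), (y0 + d)]) e.
      have m2 : leb (`[(y0 - d), (y0 + d)]%classic : set R) = (2 * d)%:E.
        rewrite lebesgue_measure_itv/= lte_fin ifT; last by lra.
        by rewrite -EFinD; congr EFin; ring.
      rewrite Rintegral_cst; last exact: measurable_itv.
      by congr (_ * _); rewrite -[LHS]/(fine (2 * d)%:E); congr fine; rewrite -m2.
    apply: le_Rintegral; first exact: measurable_itv.
    - by apply: continuous_compact_integrable; [exact: segment_compact|move=> ?; exact: cvg_cst].
    - by apply: integrableS Ji; [exact: measurable_itv|exact: measurable_itv|].
    - by move=> y /=; rewrite in_itv/= => /andP[? ?]; apply: JD => //; rewrite ler_norml; apply/andP; split; lra.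
  rewrite [leRHS]Rintegral_mkcond [leLHS]Rintegral_mkcond; apply: le_Rintegral => //.
  - rewrite -restrict_EFin; apply/(integrable_mkcond _ _).1; first exact: measurable_itv.
    by apply: integrableS Ji; [exact: measurable_itv|exact: measurable_itv|].
  - by rewrite -restrict_EFin; apply/(integrable_mkcond _ _).1; first exact: measurable_itv.
  - move=> y _; rewrite !patchE; case: ifPn => [|_]; last by case: ifPn.
    by rewrite inE => /sub ?; rewrite mem_set.
exists d, (e * (2 * d)); split=> //; first by rewrite !mulr_gt0.
move=> f z a b cf f0 ab az bz; rewrite Jstar_Jbar//.
have cfz : continuous (fun x => f (z + x)).
  by move=> x; apply: continuous_comp; [apply: cvgD; [exact: cvg_cst|exact: cvg_id]|exact: cf].
have ifab : leb.-integrable `[a, b] (EFin \o f).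
  by apply: continuous_compact_integrable; [exact: segment_compact|exact: continuous_subspaceT].
have -> : \int[leb]_(x in `[a, b]) f x = \int[leb]_(x in `[(a - z), (b - z)]) f (z + x).
  rewrite Rintegral_mkcond -(@Rintegral_shift_flip 1 z _ (normr1 _)); last first.
    apply/(measurable_restrictT _ _).1; first exact: measurable_itv.
    by have /integrableP[/measurable_EFinP] := ifab.
  rewrite [RHS]Rintegral_mkcond; apply: eq_Rintegral => x _; rewrite !patchE mul1r addrC.
  congr (if _ then _ else _); apply/idP/idP; rewrite !inE/= !in_itv/= => /andP[? ?]; apply/andP; split; lra.
have ifz : leb.-integrable `[(a - z), (b - z)] (EFin \o (fun x => f (z + x))).
  by apply: continuous_compact_integrable; [exact: segment_compact|exact: continuous_subspaceT].
have ifcz : leb.-integrable `[(a - z), (b - z)] (EFin \o (fun x => e * (2 * d) * f (z + x))).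
  apply: continuous_compact_integrable; first exact: segment_compact.
  by apply: continuous_subspaceT => x; apply: cvgM; [exact: cvg_cst|exact: cfz].
rewrite -RintegralZl; [|exact: measurable_itv|exact: ifz].
rewrite [leRHS]Rintegral_mkcond [leLHS]Rintegral_mkcond; apply: le_Rintegral => //.
- by rewrite -restrict_EFin; apply/(integrable_mkcond _ _).1; first exact: measurable_itv.
- rewrite -restrict_EFin; apply/(integrable_mkcond _ _).1; first exact: measurable_itv.
  exact: KJbar_integrable.
- have Jb0 t : 0 <= Jbar J t by apply: Rintegral_ge0 => u _; exact: J0.
  move=> x _; rewrite !patchE; case: ifPn => [|_]; last by case: ifPn => // _; rewrite mulr_ge0.
  rewrite inE/= in_itv/= => /andP[xa xb].
  have xd : `|x| <= d by move: az bz; rewrite !ler_norml => /andP[? ?] /andP[? ?]; apply/andP; split; lra.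
  rewrite mem_set/=; last by rewrite in_itv/= -ler_norml; lra.
  by rewrite ler_wpM2r// Jb.
Qed.

End KernelAverage.
Arguments cSq_shift {R f} z _ _.

(** * Taylor estimates and the radial identity *)

(** Derivation rules for functions on the line, stated on eta-expanded functions so
that [refine] can assemble them into a derivative in a given form. *)
Section Taylor.
Context {R : realType}.

Section Derive.
Variables (f g : R -> R) (x a b : R).
Hypotheses (fa : is_derive x 1 f a) (gb : is_derive x 1 g b).

Lemma isdD : is_derive x 1 (fun t => f t + g t) (a + b).
Proof. exact: is_deriveD. Qed.

Lemma isdB : is_derive x 1 (fun t => f t - g t) (a - b).
Proof. exact: is_deriveB. Qed.

Lemma isdM : is_derive x 1 (fun t => f t * g t) (a * g x + f x * b).
Proof.
have -> : a * g x + f x * b = f x *: b + g x *: a by rewrite /GRing.scale/=; ring.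
exact: is_deriveM.
Qed.

Lemma isdZ (c : R) : is_derive x 1 (fun t => c * f t) (c * a).
Proof. exact: is_deriveZ. Qed.

Lemma isdN : is_derive x 1 (fun t => - f t) (- a).
Proof. exact: is_deriveN. Qed.
End Derive.

Lemma isd_id (x : R) : is_derive x 1 (fun t : R => t) 1.
Proof. exact: is_derive_id. Qed.

Lemma isd_cst (x c : R) : is_derive x 1 (fun t : R => c) 0.
Proof. exact: is_derive_cst. Qed.

Lemma isd_eq (f : R -> R) (x a b : R) : is_derive x 1 f a -> a = b -> is_derive x 1 f b.
Proof. by move=> + <-. Qed.

Lemma isd_comp (f g : R -> R) (x a b : R) : is_derive (g x) 1 f a -> is_derive x 1 g b ->
  is_derive x 1 (fun t => f (g t)) (a * b).
Proof. exact: is_derive1_comp. Qed.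

Lemma Lipschitz_of_derive (f df : R -> R) (B x y : R) :
  (forall t : R, is_derive t 1 f (df t)) -> (forall t, `|t - x| <= `|y - x| -> `|df t| <= B) ->
  `|f y - f x| <= B * `|y - x|.
Proof.
move=> fE dfB.
have cf (a b : R) : {within `[a, b], continuous f}.
  apply: continuous_subspaceT => t; apply/differentiable_continuous/derivable1_diffP.
  by have [] := fE t.
have [xy|yx] := leP x y.
  have [c] := MVT_segment xy (fun t _ => fE t) (cf x y).
  rewrite in_itv/= => /andP[xc cy] ->; rewrite normrM ler_wpM2r//.
  by apply: dfB; rewrite !ger0_norm ?subr_ge0// lerD2r.
have [c] := MVT_segment (ltW yx) (fun t _ => fE t) (cf y x).
rewrite in_itv/= => /andP[yc cx] E; rewrite distrC E normrM (distrC y) ler_wpM2r//.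
by apply: dfB; rewrite distrC (distrC y) !ger0_norm ?subr_ge0// ?(ltW yx)// lerD2l lerN2.
Qed.

Lemma Taylor2 (f f1 f2 : R -> R) (B x y : R) :
  (forall t : R, is_derive t 1 f (f1 t)) -> (forall t : R, is_derive t 1 f1 (f2 t)) ->
  (forall t, `|t - x| <= `|y - x| -> `|f2 t| <= B) ->
  `|f y - f x - f1 x * (y - x)| <= B * `|y - x| ^+ 2.
Proof.
move=> fE f1E f2B.
pose g t := f t - f1 x * t; pose dg t := f1 t - f1 x.
have gE (t : R) : is_derive t 1 g (dg t).
  refine (isd_eq (isdB (fE t) (isdZ (isd_id t) (f1 x))) _).
  by rewrite mulr1.
have := @Lipschitz_of_derive g dg (B * `|y - x|) x y gE.
rewrite /g (_ : f y - f1 x * y - (f x - f1 x * x) = f y - f x - f1 x * (y - x)); last by ring.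
rewrite -mulrA -expr2; apply => t tx; apply: le_trans (Lipschitz_of_derive f1E _) _.
  by move=> u ut; apply: f2B; exact: le_trans tx.
by rewrite ler_wpM2l// (le_trans _ (f2B x _))// subrr normr0.
Qed.

Lemma Taylor3 (f f1 f2 f3 : R -> R) (B x y : R) :
  (forall t : R, is_derive t 1 f (f1 t)) -> (forall t : R, is_derive t 1 f1 (f2 t)) ->
  (forall t : R, is_derive t 1 f2 (f3 t)) ->
  (forall t, `|t - x| <= `|y - x| -> `|f3 t| <= B) ->
  `|f y - f x - f1 x * (y - x) - f2 x / 2 * (y - x) ^+ 2| <= B * `|y - x| ^+ 3.
Proof.
move=> fE f1E f2E f3B.
pose g t := f t - f2 x / 2 * (t - x) ^+ 2; pose dg t := f1 t - f2 x * (t - x).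
pose d2g t := f2 t - f2 x.
have gE (t : R) : is_derive t 1 g (dg t).
  have h : is_derive t 1 (fun u : R => u - x) 1.
    by refine (isd_eq (isdB (isd_id t) (isd_cst t x)) _); rewrite subr0.
  refine (isd_eq (isdB (fE t) (isdZ (isdM h h) (f2 x / 2))) _).
  by rewrite /dg mul1r mulr1; field.
have dgE (t : R) : is_derive t 1 dg (d2g t).
  refine (isd_eq (isdB (f1E t) (isdZ (isdB (isd_id t) (isd_cst t x)) (f2 x))) _).
  by rewrite subr0 mulr1.
have := @Taylor2 g dg d2g (B * `|y - x|) x y gE dgE.
rewrite /g /dg subrr expr0n/= !mulr0 !subr0.
rewrite (_ : f y - f2 x / 2 * (y - x) ^+ 2 - f x - f1 x * (y - x) =
  f y - f x - f1 x * (y - x) - f2 x / 2 * (y - x) ^+ 2); last by ring.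
have E3 : B * `|y - x| * `|y - x| ^+ 2 = B * `|y - x| ^+ 3 by ring.
rewrite E3; apply => t tx; apply: le_trans (Lipschitz_of_derive f2E _) _.
  by move=> u ut; apply: f3B; exact: le_trans tx.
by rewrite ler_wpM2l// (le_trans _ (f3B x _))// subrr normr0.
Qed.

(** Differentiability of the normal coordinate along a segment is obtained from a
quadratic error bound rather than from differential calculus in the plane. *)
Lemma is_derive_quadratic (f : R -> R) (z a B : R) (e : R) : 0 < e ->
  (forall h, `|h| <= e -> `|f (z + h) - f z - h * a| <= B * h ^+ 2) ->
  is_derive z 1 f a.
Proof.
move=> e0 H.
have cv : (fun h : R => h^-1 *: (f (h *: (1 : R) + z) - f z)) h @[h --> 0^'] --> a.
  apply/cvgrPdist_le => /= eps eps0.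
  pose r := Num.min e (eps / (`|B| + 1)).
  have r0 : 0 < r by rewrite lt_min e0/= divr_gt0// ltr_pwDr.
  near=> h.
  have hn0 : h != 0 by near: h; exact: nbhs_dnbhs_neq.
  have hr : `|h| <= r by near: h; apply: dnbhs0_le.
  have he : `|h| <= e by apply: le_trans hr _; rewrite ge_min lexx.
  have heps : `|h| <= eps / (`|B| + 1) by apply: le_trans hr _; rewrite ge_min lexx orbT.
  rewrite /GRing.scale/= mulr1 [h + z]addrC.
  have -> : a - h^-1 * (f (z + h) - f z) = - h^-1 * (f (z + h) - f z - h * a) by field.
  rewrite normrM normrN normfV ler_pdivrMl ?normr_gt0//.
  apply: le_trans (H _ he) _.
  rewrite -real_normK ?num_real// expr2 mulrCA ler_wpM2l//.
  apply: (@le_trans _ _ ((`|B| + 1) * `|h|)).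
    by rewrite ler_wpM2r// (le_trans (ler_norm _))// lerDl.
  by rewrite mulrC -ler_pdivlMr// ltr_pwDr.
split; first by apply/cvg_ex; exists a; exact: cv.
exact: cvg_lim cv.
Unshelve. all: end_near. Qed.

Lemma is_derive_continuous (f df : R -> R) :
  (forall t : R, is_derive t 1 f (df t)) -> continuous f.
Proof.
move=> fE t; apply/differentiable_continuous/derivable1_diffP.
by have [] := fE t.
Qed.

Lemma continuous_segment_bounded (f : R -> R) (a : R) : continuous f ->
  exists B : R, forall t, `|t| <= a -> `|f t| <= B.
Proof.
move=> cf; have /compact_bounded[M [_ mrt]] :=
  continuous_compact (continuous_subspaceT (A := `[- a, a]%classic) cf) (@segment_compact R (- a) a).
exists (`|M| + 1) => t ta; apply: mrt; first by rewrite ltr_pwDr// ler_norm.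
by exists t => //=; rewrite in_itv/= -ler_norml.
Qed.

End Taylor.

Section KernelCalculus.
Context {R : realType}.
Variables (J : R * R -> R) (hJ : interaction_kernel J).
Notation E := (Eav J).
Notation K := (Jstar J).

Lemma sqrt_1m_bounds (t : R) : `|t| <= 1 ->
  let c := Num.sqrt (1 - t ^+ 2) in [/\ c ^+ 2 + t ^+ 2 = 1, 0 <= c, c <= 1 & 1 - c <= t ^+ 2].
Proof.
move=> t1 c; have t2 : t ^+ 2 <= 1 by rewrite -real_normK ?num_real// expr_le1.
have c2 : c ^+ 2 = 1 - t ^+ 2 by rewrite sqr_sqrtr// subr_ge0.
have c0 : 0 <= c by exact: sqrtr_ge0.
have c1 : c <= 1.
  by rewrite -(@ler_pXn2r _ 2)// ?nnegrE// c2 expr1n; have := sqr_ge0 t; lra.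
by split => //; [rewrite c2; ring|nra].
Qed.

(** The average of [y F(z + x)] is invariant under rotation of [(x, y)]; this is
the vanishing of its derivative at angle [0]. *)
Lemma Eav_radial (F F1 F2 : R -> R) (z : R) :
  (forall t : R, is_derive t 1 F (F1 t)) -> (forall t : R, is_derive t 1 F1 (F2 t)) ->
  continuous F2 ->
  E (fun p => p.1 * F (z + p.1)) = E (fun p => p.2 ^+ 2 * F1 (z + p.1)).
Proof.
move=> FE F1E cF2.
have cF := is_derive_continuous FE; have cF1 := is_derive_continuous F1E.
have [B0 HB0] := continuous_segment_bounded (`|z| + 3) cF.
have [B1 HB1] := continuous_segment_bounded (`|z| + 3) cF1.
have [B2 HB2] := continuous_segment_bounded (`|z| + 3) cF2.
have cA : cSq (fun p : R * R => p.1 * F (z + p.1)).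
  by apply: within_contM; [exact: cSq_fst|exact: cSq_shift].
have cB : cSq (fun p : R * R => p.2 ^+ 2 * F1 (z + p.1)).
  by apply: within_contM; [apply: within_contM; exact: cSq_snd|exact: cSq_shift].
apply/eqP; rewrite -subr_eq0; apply/eqP; rewrite -EavB//.
set A := fun p => _; set a := E A.
have cAB : cSq A by move=> x; apply: cvgB; [exact: cA|exact: cB].
pose f (p : R * R) := p.2 * F (z + p.1).
have cf : continuous f.
  move=> p; apply: cvgM; first exact: cvg_snd.
  apply: continuous_comp; last exact: cF.
  by apply: cvgD; [exact: cvg_cst|exact: cvg_fst].
pose C := B0 + 8 * B1 + 18 * B2.
have key t : 0 < t -> t <= 1 -> `|t * a| <= C * t ^+ 2.
  move=> t0 t1; have tn : `|t| <= 1 by rewrite gtr0_norm.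
  have [ct c0 c1 c1t] := sqrt_1m_bounds tn; set c := Num.sqrt _ in ct c0 c1 c1t.
  have cfr : continuous (fun x : R * R => f (c * x.1 - t * x.2, t * x.1 + c * x.2)).
    move=> p; apply: (@continuous_comp _ _ _ (fun x : R * R => (c * x.1 - t * x.2, t * x.1 + c * x.2)) f); last exact: cf.
    apply: (@cvg_pair _ _ _ _ (nbhs _) (nbhs _)).
      apply: cvgB; (apply: cvgM; first exact: cvg_cst); [exact: cvg_fst|exact: cvg_snd].
    apply: cvgD; (apply: cvgM; first exact: cvg_cst); [exact: cvg_fst|exact: cvg_snd].
  have cSf := continuous_subspaceT (A := Sq) cf.
  have cSfr := continuous_subspaceT (A := Sq) cfr.
  have ctA : cSq (fun p => t * A p) by apply: within_contM => //; exact: within_cont_cst.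
  have eqE : E (fun x : R * R => f (c * x.1 - t * x.2, t * x.1 + c * x.2) - f x) = 0.
    by rewrite EavB// Eav_rot// subrr.
  have -> : `|t * a| = `|E (fun x : R * R => f (c * x.1 - t * x.2, t * x.1 + c * x.2) - f x) - E (fun p => t * A p)|.
    by rewrite eqE sub0r normrN EavZ.
  apply: Eav_dist => //.
    by move=> x; apply: cvgB; [exact: cSfr|exact: cSf].
  move=> [x y] /SqE[x1 y1]; rewrite /f /A /=.
  set h := (c - 1) * x - t * y.
  have hE : z + (c * x - t * y) = (z + x) + h by rewrite /h; ring.
  rewrite hE.
  have h2 : `|h| <= 2 * t.
    rewrite /h (le_trans (ler_normB _ _))// !normrM (gtr0_norm t0) ler0_norm ?subr_le0// opprB.
    have : (1 - c) * `|x| <= t ^+ 2 * 1 by rewrite ler_pM// subr_ge0.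
    have : t * `|y| <= t * 1 by rewrite ler_wpM2l// ltW.
    have : t ^+ 2 <= t by rewrite expr2 ler_piMl// ltW.
    lra.
  have T := @Taylor2 _ F F1 F2 B2 (z + x) (z + x + h) FE F1E.
  have {}T : `|F (z + x + h) - F (z + x) - F1 (z + x) * h| <= B2 * (4 * t ^+ 2).
    have zx : `|z + x| <= `|z| + 1 by rewrite (le_trans (ler_normD _ _))// lerD2l.
    have B20 : 0 <= B2 by apply: le_trans (HB2 0 _); rewrite ?normr0 ?addr_ge0.
    move: T; rewrite [z + x + h - (z + x)]addrAC subrr add0r => T.
    apply: le_trans (T _) _.
      move=> u uh; apply: HB2.
      have -> : u = (u - (z + x)) + (z + x) by ring.
      rewrite (le_trans (ler_normD _ _))// (le_trans (lerD uh zx))//; lra.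
    rewrite ler_wpM2l// -[4](_ : 2 ^+ 2 = 4); last by ring.
    by rewrite -exprMn ler_pXn2r// nnegrE// mulr_ge0// ltW.
  set e := F (z + x + h) - F (z + x) - F1 (z + x) * h in T.
  have -> : F (z + x + h) = F (z + x) + F1 (z + x) * h + e by rewrite /e; ring.
  have FB : `|F (z + x)| <= B0.
    by apply: HB0; rewrite (le_trans (ler_normD _ _))//; lra.
  have F1B : `|F1 (z + x)| <= B1.
    by apply: HB1; rewrite (le_trans (ler_normD _ _))//; lra.
  set u := F (z + x) in FB *; set v := F1 (z + x) in F1B *.
  rewrite (_ : _ - _ = (c - 1) * y * u + (t * x * h + c * (c - 1) * x * y + (1 - c) * t * y ^+ 2) * v
     + (t * x + c * y) * e); last by rewrite /h; ring.
  have nc : `|c - 1| <= t ^+ 2 by rewrite ler0_norm ?subr_le0// opprB.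
  have nc' : `|c| <= 1 by rewrite ger0_norm.
  have nc1 : `|1 - c| <= t ^+ 2 by rewrite distrC.
  have t2 : t ^+ 2 <= t by rewrite expr2 ler_piMl// ltW.
  have t20 : 0 <= t ^+ 2 by exact: sqr_ge0.
  have b1 : `|(c - 1) * y * u| <= t ^+ 2 * 1 * B0.
    by rewrite !normrM !ler_pM ?mulr_ge0.
  have b2 : `|t * x * h| <= t * 1 * (2 * t) by rewrite !normrM (gtr0_norm t0) !ler_pM ?mulr_ge0// ltW.
  have b3 : `|c * (c - 1) * x * y| <= 1 * t ^+ 2 * 1 * 1.
    by rewrite !normrM !ler_pM ?mulr_ge0.
  have b4 : `|(1 - c) * t * y ^+ 2| <= t ^+ 2 * 1 * 1 ^+ 2.
    have y2 : `|y ^+ 2| <= 1 by rewrite normrX expr_le1.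
    rewrite expr1n normrM ler_pM// normrM ler_pM//.
  have b5 : `|t * x * h + c * (c - 1) * x * y + (1 - c) * t * y ^+ 2| <= 8 * t ^+ 2.
    rewrite (le_trans (ler_normD _ _))// (le_trans (lerD (ler_normD _ _) (lexx _)))//.
    by move: b2 b3 b4; rewrite expr1n !mulr1 !mul1r mulrCA -expr2; lra.
  have b6 : `|t * x + c * y| <= 2.
    rewrite (le_trans (ler_normD _ _))// !normrM.
    have : `|t| * `|x| <= 1 * 1 by rewrite ler_pM.
    have : `|c| * `|y| <= 1 * 1 by rewrite ler_pM.
    lra.
  have b7 : `|(t * x * h + c * (c - 1) * x * y + (1 - c) * t * y ^+ 2) * v| <= 8 * t ^+ 2 * B1.
    by rewrite normrM ler_pM.
  have b8 : `|(t * x + c * y) * e| <= 2 * (B2 * (4 * t ^+ 2)).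
    by rewrite normrM ler_pM.
  rewrite (le_trans (ler_normD _ _))// (le_trans (lerD (ler_normD _ _) (lexx _)))//.
  have B20 : 0 <= B2 by apply: le_trans (HB2 0 _); rewrite ?normr0 ?addr_ge0.
  have : 0 <= B2 * t ^+ 2 by rewrite mulr_ge0.
  rewrite /C; move: b1 b7 b8; lra.
apply/eqP/negP => /negP a0; have a0' : 0 < `|a| by rewrite normr_gt0.
pose t := Num.min 1 (`|a| / (2 * (`|C| + 1))).
have C0 : 0 < 2 * (`|C| + 1) by rewrite mulr_gt0// ltr_pwDr.
have t0 : 0 < t by rewrite lt_min ltr01/= divr_gt0.
have := key t t0; rewrite ge_min lexx => /(_ isT).
rewrite normrM gtr0_norm// expr2 mulrCA ler_pM2l// => aC.
have : t <= `|a| / (2 * (`|C| + 1)) by rewrite ge_min lexx orbT.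
rewrite ler_pdivlMr// => h.
have : C * t <= `|C| * t by rewrite ler_wpM2r// ?ler_norm// ltW.
move: h; nra.
Qed.

End KernelCalculus.

(** * The derivative of the instanton *)

Section Tanh.
Context {R : realType}.
Implicit Types x : R.

Let c x := expR x + expR (- x).
Let c0 x : 0 < c x. Proof. by rewrite addr_gt0// expR_gt0. Qed.

Lemma isd_expR x : is_derive x 1 expR (expR x).
Proof. exact: is_derive_expR. Qed.

Lemma isd_expRN x : is_derive x 1 (fun t : R => expR (- t)) (- expR (- x)).
Proof.
by refine (isd_eq (isd_comp (isd_expR _) (isdN (isd_id x))) _); rewrite mulrN1.
Qed.

Lemma isdV (f : R -> R) x (a : R) : f x != 0 -> is_derive x 1 f a ->
  is_derive x 1 (fun t => (f t)^-1) (- a / f x ^+ 2).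
Proof.
move=> fx0 fa; have := @is_deriveV R f x a 1 fx0 fa.
by rewrite /GRing.scale/= => H; refine (isd_eq H _); rewrite mulNr mulrC mulNr.
Qed.

Lemma is_derive_tanh x : is_derive x 1 tanh (1 - tanh x ^+ 2).
Proof.
have cx : expR x + expR (- x) != 0 by rewrite gt_eqF// c0.
refine (isd_eq (isdM (isdB (isd_expR x) (isd_expRN x))
  (isdV (f := fun t => expR t + expR (- t)) cx (isdD (isd_expR x) (isd_expRN x)))) _).
by rewrite /tanh; field.
Qed.

Lemma tanh_lt1 x : tanh x < 1.
Proof.
by rewrite /tanh ltr_pdivrMr ?c0// mul1r; have := expR_gt0 (- x); lra.
Qed.

Lemma tanh0 : tanh (0 : R) = 0.
Proof. by rewrite /tanh oppr0 subrr mul0r. Qed.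

Lemma tanh_gt0 x : 0 < x -> 0 < tanh x.
Proof.
by move=> x0; rewrite /tanh divr_gt0 ?c0// subr_gt0 ltr_expR; lra.
Qed.

(** By strict concavity of [tanh] on the half-line the graph crosses the diagonal
from above at a positive fixed point, where the slope of [m |-> tanh (beta m)]
is [sigma beta mb]. *)
Lemma sigma_lt1 (beta mb : R) : 1 < beta -> 0 < mb -> mb = tanh (beta * mb) ->
  sigma beta mb < 1.
Proof.
move=> b1 mb0 mbE; have b0 : 0 < beta by lra.
pose x := beta * mb; have x0 : 0 < x by rewrite mulr_gt0.
pose f (t : R) := tanh t - t * (1 - tanh t ^+ 2).
pose df (t : R) := 2 * t * tanh t * (1 - tanh t ^+ 2).
have fE (t : R) : is_derive t 1 f (df t).
  have T := is_derive_tanh t.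
  refine (isd_eq (isdB T (isdM (isd_id t) (isdB (isd_cst t 1) (isdM T T)))) _).
  by rewrite /df; ring.
have [y] := @MVT _ f df 0 x x0 (fun t _ => fE t) (continuous_subspaceT (is_derive_continuous fE)).
rewrite in_itv/= => /andP[y0 yx]; rewrite {1 2}/f tanh0 mul0r !subr0 => fx.
have : 0 < f x.
  rewrite {1}/f fx mulr_gt0// /df.
  have ty := tanh_gt0 y0; have t1 := tanh_lt1 y.
  have : tanh y ^+ 2 < 1 by rewrite expr_lt1// ltW.
  by rewrite -subr_gt0 => t2; rewrite mulr_gt0// mulr_gt0// mulr_gt0.
rewrite /f -mbE subr_gt0 /sigma /x => h.
by rewrite -(ltr_pM2r mb0) mul1r mulrAC.
Qed.
End Tanh.

(** Differentiating [u = sigma(m) k0] expresses each derivative of [u] through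
lower ones and one more derivative of the smoothed function, which integration
by parts bounds by the previous order. *)
Lemma bootstrap_bounds {R : realType} (beta mb M1 : R) (m u u1 u2 k0 k1 k2 : R -> R) :
  0 < beta -> 0 < mb -> mb <= 1 -> 0 < M1 ->
  (forall t : R, is_derive t 1 m (u t)) -> (forall t : R, is_derive t 1 u (u1 t)) ->
  (forall t : R, is_derive t 1 u1 (u2 t)) ->
  (forall t : R, is_derive t 1 k0 (k1 t)) -> (forall t : R, is_derive t 1 k1 (k2 t)) ->
  (forall t, u t = beta * (1 - m t ^+ 2) * k0 t) -> (forall t, `|m t| <= mb) ->
  (forall t, `|k0 t| <= M1 * mb) ->
  (forall B, (forall t, `|u t| <= B) -> forall t, `|k1 t| <= M1 * B) ->
  (forall B, (forall t, `|u1 t| <= B) -> forall t, `|k2 t| <= M1 * B) ->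
  exists2 M : R, 0 < M & forall z, [/\ u z <= M, `|u1 z| <= M & `|u2 z| <= M].
Proof.
move=> b0 mb0 mb1 M10 mE uE u1E k0E k1E ueq mB K1 HK2 HK3.
have b0' : `|beta| = beta by rewrite gtr0_norm.
have mbn z : `|m z| <= 1 by rewrite (le_trans (mB z)).
pose sg z := beta * (1 - m z ^+ 2).
have sgn z : `|sg z| <= beta.
  have m2 : m z ^+ 2 <= 1 by rewrite -(real_normK (num_real (m z))) expr_le1.
  rewrite normrM b0' ger0_norm ?subr_ge0// -[leRHS]mulr1 ler_pM2l// gerBl.
  exact: sqr_ge0.
pose B0 := beta * (M1 * mb).
have B00 : 0 < B0 by rewrite !mulr_gt0.
have uB z : `|u z| <= B0 by rewrite ueq normrM ler_pM// sgn.
have K2 := HK2 _ uB.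
have sgE (t : R) : is_derive t 1 sg (- (2 * beta * m t * u t)).
  refine (isd_eq (isdZ (isdB (isd_cst t 1) (isdM (mE t) (mE t))) beta) _).
  by ring.
have u1eq z : u1 z = - (2 * beta * m z * u z) * k0 z + sg z * k1 z.
  have H : is_derive z 1 u (- (2 * beta * m z * u z) * k0 z + sg z * k1 z).
    rewrite {1}(_ : u = fun t => sg t * k0 t); last by apply/funext => t; exact: ueq.
    exact: (isdM (sgE z) (k0E z)).
  by have [_ <-] := H; have [_ <-] := uE z.
pose B1 := 2 * beta * 1 * B0 * (M1 * mb) + beta * (M1 * B0).
have B10 : 0 <= B1 by rewrite addr_ge0// !mulr_ge0// ltW.
have u1B z : `|u1 z| <= B1.
  rewrite u1eq (le_trans (ler_normD _ _))// lerD//.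
    have A3 : `|2 * beta * m z * u z| <= 2 * beta * 1 * B0.
      by rewrite !normrM b0' ger0_norm// !ler_pM ?mulr_ge0// ltW.
    by rewrite normrM normrN ler_pM.
  by rewrite normrM ler_pM.
have K3 := HK3 _ u1B.
have u2eq z : u2 z = - (2 * beta * (u z * u z + m z * u1 z)) * k0 z
    - (2 * beta * m z * u z) * k1 z *+ 2 + sg z * k2 z.
  have H : is_derive z 1 u1 (- (2 * beta * (u z * u z + m z * u1 z)) * k0 z
    - (2 * beta * m z * u z) * k1 z *+ 2 + sg z * k2 z).
    rewrite {1}(_ : u1 = fun t => - (2 * beta) * (m t * u t) * k0 t + sg t * k1 t); last first.
      by apply/funext => t; rewrite u1eq; ring.
    refine (isd_eq (isdD (isdM (isdZ (isdM (mE z) (uE z)) (- (2 * beta))) (k0E z))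
      (isdM (sgE z) (k1E z))) _).
    by ring.
  by have [_ <-] := H; have [_ <-] := u1E z.
pose B2 := (2 * beta * (B0 * B0 + 1 * B1)) * (M1 * mb) + (2 * beta * 1 * B0) * (M1 * B0) *+ 2 + beta * (M1 * B1).
have B20 : 0 <= B2.
  by rewrite !addr_ge0 ?mulrn_wge0 ?mulr_ge0 ?addr_ge0 ?mulr_ge0// ltW.
have u2B z : `|u2 z| <= B2.
  have A1 : `|u z * u z + m z * u1 z| <= B0 * B0 + 1 * B1.
    by rewrite (le_trans (ler_normD _ _))// !normrM lerD// ler_pM.
  have A2 : `|- (2 * beta * (u z * u z + m z * u1 z))| <= 2 * beta * (B0 * B0 + 1 * B1).
    by rewrite normrN !normrM b0' ger0_norm// ler_wpM2l// mulr_ge0// ltW.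
  have A3 : `|2 * beta * m z * u z| <= 2 * beta * 1 * B0.
    by rewrite !normrM b0' ger0_norm// !ler_pM ?mulr_ge0// ltW.
  have A4 : `|- (2 * beta * (u z * u z + m z * u1 z)) * k0 z| <=
      2 * beta * (B0 * B0 + 1 * B1) * (M1 * mb) by rewrite normrM ler_pM.
  have A5 : `|2 * beta * m z * u z * k1 z *+ 2| <= 2 * beta * 1 * B0 * (M1 * B0) *+ 2.
    by rewrite normrMn ler_wMn2r// normrM ler_pM.
  have A6 : `|sg z * k2 z| <= beta * (M1 * B1) by rewrite normrM ler_pM.
  rewrite u2eq (le_trans (ler_normD _ _))// lerD//.
  by rewrite (le_trans (ler_normB _ _))// lerD.
exists (B0 + B1 + B2); first by lra.
move=> z; split.
- by have := uB z; have := ler_norm (u z); lra.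
- by have := u1B z; lra.
- by have := u2B z; lra.
Qed.

Section Instanton.
Context {R : realType}.
Variables (beta : R) (hbeta : 1 < beta).
Variables (mb : R) (hmb : 0 < mb) (hmb_eq : mb = tanh (beta * mb)).
Variables (J : R * R -> R) (hJ : interaction_kernel J).
Variables (mbar : R -> R) (hmbar : instanton beta J mb mbar).
Notation K := (Jstar J).

Lemma Jstar_derive (F F1 F2 : R -> R) (z : R) :
  (forall t : R, is_derive t 1 F (F1 t)) -> (forall t : R, is_derive t 1 F1 (F2 t)) ->
  continuous F2 -> is_derive z 1 (K F) (K F1 z).
Proof.
move=> FE F1E cF2; have cF := is_derive_continuous FE; have cF1 := is_derive_continuous F1E.
have [B HB] := continuous_segment_bounded (`|z| + 2) cF2.
apply: (@is_derive_quadratic _ _ _ _ B 1) => // h h1.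
have ch : cSq (fun p : R * R => h * F1 (z + p.1)).
  by apply: within_contM; [exact: within_cont_cst|exact: (cSq_shift _ cF1)].
have cB : cSq (fun p : R * R => F (z + p.1) + h * F1 (z + p.1)).
  by apply: within_contD => //; exact: (cSq_shift _ cF).
have -> : K F (z + h) - K F z - h * K F1 z =
    K F (z + h) - Eav J (fun p => F (z + p.1) + h * F1 (z + p.1)).
  rewrite (EavD hJ (cSq_shift z cF) ch) (EavZ hJ h (cSq_shift z cF1)) /Jstar.
  by ring.
apply: Eav_dist => //; first exact: (cSq_shift _ cF).
move=> [x y] /SqE[x1 _] /=.
have -> : F (z + h + x) - (F (z + x) + h * F1 (z + x)) =
  F (z + h + x) - F (z + x) - F1 (z + x) * (z + h + x - (z + x)) by ring.
apply: le_trans (Taylor2 (B := B) FE F1E _) _.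
  move=> t; have -> : z + h + x - (z + x) = h by ring.
  move=> th; apply: HB; have -> : t = (t - (z + x)) + (z + x) by ring.
  have := ler_normD (t - (z + x)) (z + x); have := ler_normD z x; lra.
have -> : z + h + x - (z + x) = h by ring.
by rewrite real_normK ?num_real.
Qed.

(** The derivative can be moved to the kernel, so that a bound on [F] controls the
average of [F']. *)
Lemma Jstar_derive_bounded : exists2 M1, 0 < M1 & forall (F F1 : R -> R) (B : R),
  (forall t : R, is_derive t 1 F (F1 t)) -> continuous F1 -> (forall t, `|F t| <= B) ->
  forall z, `|K F1 z| <= M1 * B.
Proof.
have [M1 M10 HM1] := Eav1_bound hJ; exists M1 => // F F1 B FE cF1 FB z.
have cF := is_derive_continuous FE.
have dG (x y : R) : `|x| <= 1 -> `|y| <= 1 ->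
    is_derive x 1 (fun t => F (z + (t, y).1)) (F1 (z + (x, y).1)).
  move=> _ _ /=; refine (isd_eq (isd_comp (FE _) (isdD (isd_cst x z) (isd_id x))) _).
  by rewrite add0r mulr1.
rewrite /Jstar (Eav_by_parts hJ (cSq_shift z cF) (cSq_shift z cF1) dG) normrN.
by apply: HM1 => //; exact: (cSq_shift _ cF).
Qed.

Definition mu : R -> R := derive1n 1 mbar.
Definition mu' : R -> R := derive1n 2 mbar.
Definition mu'' : R -> R := derive1n 3 mbar.
Definition sg (z : R) : R := sigma beta (mbar z).

Let nthE (k : nat) (t : R) : is_derive t 1 (derive1n k mbar) (derive1n k.+1 mbar t).
Proof.
have [/(_ k (ltnSn k) t) H _] := instanton_smooth hmbar k.+1.
have := derivableP H; rewrite -derive1E; exact.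
Qed.

Lemma is_derive_mbar (t : R) : is_derive t 1 mbar (mu t). Proof. exact: (nthE 0). Qed.
Lemma is_derive_mu (t : R) : is_derive t 1 mu (mu' t). Proof. exact: (nthE 1). Qed.
Lemma is_derive_mu' (t : R) : is_derive t 1 mu' (mu'' t). Proof. exact: (nthE 2). Qed.
Lemma mbar_cont : continuous mbar. Proof. exact: (is_derive_continuous is_derive_mbar). Qed.
Lemma mu_cont : continuous mu. Proof. exact: (is_derive_continuous is_derive_mu). Qed.
Lemma mu'_cont : continuous mu'. Proof. exact: (is_derive_continuous is_derive_mu'). Qed.
Lemma mu''_cont : continuous mu''. Proof. exact: (is_derive_continuous (nthE 3)). Qed.

(** The derivative of the instanton equation, since [tanh' = 1 - tanh^2]. *)
Lemma mu_eq z : mu z = sg z * K mu z.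
Proof.
have H : is_derive z 1 mbar ((1 - mbar z ^+ 2) * (beta * K mu z)).
  have mE : mbar = (fun t => tanh (beta * K mbar t)).
    by apply/funext => t; rewrite [LHS](instanton_eq hmbar) convol_Jstar//; exact: mbar_cont.
  rewrite {1}mE [in X in is_derive _ _ _ X]mE.
  exact: (isd_comp (is_derive_tanh _) (isdZ (Jstar_derive z is_derive_mbar is_derive_mu mu'_cont) beta)).
have [_ <-] := is_derive_mbar z; have [_ ->] := H.
by rewrite /sg /sigma; ring.
Qed.

Lemma mbar_le z : mbar z <= mb.
Proof.
rewrite leNgt; apply/negP => h.
have H1 : \forall w \near +oo, mbar w < mbar z by exact: (cvgr_lt mb (instanton_pinfty hmbar) _ h).
have H2 : \forall w \near +oo, z < w by exact: nbhs_pinfty_gt (num_real z).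
have [w [w1 w2]] := filter_ex (filterI H1 H2).
by have := instanton_incr hmbar w2; lra.
Qed.

Lemma mbar_norm z : `|mbar z| <= mb.
Proof.
rewrite ler_norml mbar_le andbT; have := mbar_le (- z).
by rewrite (instanton_odd hmbar); lra.
Qed.

Lemma mb_lt1 : mb < 1. Proof. by rewrite hmb_eq tanh_lt1. Qed.

Let b0 : 0 < beta. Proof. exact: lt_trans ltr01 hbeta. Qed.

Lemma mbar_sq_le z : mbar z ^+ 2 <= mb ^+ 2.
Proof.
by rewrite -(real_normK (num_real (mbar z))) ler_pXn2r// ?nnegrE// ?mbar_norm// ltW.
Qed.

Definition sgmin : R := sigma beta mb.

Lemma sgmin_gt0 : 0 < sgmin.
Proof. by rewrite /sgmin /sigma mulr_gt0// subr_gt0 expr_lt1 ?mb_lt1// ltW. Qed.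

Lemma sg_ge z : sgmin <= sg z.
Proof. by rewrite /sg /sgmin /sigma ler_pM2l// lerD2l lerN2 mbar_sq_le. Qed.

Lemma sg_gt0 z : 0 < sg z. Proof. exact: lt_le_trans sgmin_gt0 (sg_ge z). Qed.

Lemma sg_le z : sg z <= beta.
Proof. by rewrite /sg /sigma -[leRHS]mulr1 ler_pM2l// gerBl sqr_ge0. Qed.

Lemma sg_even z : sg (- z) = sg z.
Proof. by rewrite /sg /sigma (instanton_odd hmbar) sqrrN. Qed.

Lemma sg_cont : continuous sg.
Proof.
move=> z; apply: cvgM; first exact: cvg_cst.
by apply: cvgB; [exact: cvg_cst|apply: cvgM; exact: mbar_cont].
Qed.

Lemma mu_even z : mu (- z) = mu z.
Proof.
have H : is_derive z 1 mbar (mu (- z)).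
  rewrite (_ : mbar = fun t => - mbar (- t)); last first.
    by apply/funext => t; rewrite (instanton_odd hmbar) opprK.
  refine (isd_eq (isdN (isd_comp (is_derive_mbar (- z)) (isdN (isd_id z)))) _).
  by rewrite mulrN1 opprK.
by have [_ <-] := H; have [_ <-] := is_derive_mbar z.
Qed.

(** Strict monotonicity makes the average of [mu] over any interval positive, and
[mu] is such an average up to the factor [sigma]. *)
Lemma mu_gt0 z : 0 < mu z.
Proof.
have mu0 t : 0 <= mu t.
  have := @incr_derive1_ge0 R mbar setT t; rewrite interiorT => H.
  apply: (H _ _ I) => [x _|x y _ _]; last exact: (instanton_incr hmbar).
  by have [] := is_derive_mbar x.
have [d [c0 [d0 d1 c00 Hm]]] := Jstar_minorization hJ.
rewrite mu_eq mulr_gt0 ?sg_gt0//.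
have zd : z - d < z + d by lra.
have := Hm mu z (z - d) (z + d) mu_cont mu0 (ltW zd).
have -> : z - d - z = - d by ring.
have -> : z + d - z = d by ring.
rewrite normrN gtr0_norm// lexx => /(_ isT isT).
apply: lt_le_trans; rewrite mulr_gt0//.
have [LM dM] := is_derive_LRcontinuous zd (fun x _ => is_derive_mbar x).
rewrite /Rintegral (continuous_FTC2 zd (continuous_subspaceT mu_cont) LM dM) /= subr_gt0.
exact: (instanton_incr hmbar).
Qed.

Lemma Jstar_mu_gt0 z : 0 < K mu z.
Proof. by have := mu_gt0 z; rewrite mu_eq pmulr_rgt0// sg_gt0. Qed.

Lemma mu_bounds : exists2 M : R, 0 < M &
  forall z, [/\ mu z <= M, `|mu' z| <= M & `|mu'' z| <= M].
Proof.
have [M1 M10 HM1] := Jstar_derive_bounded.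
have KE1 (t : R) := Jstar_derive t is_derive_mu is_derive_mu' mu''_cont.
have KE2 (t : R) := Jstar_derive t is_derive_mu' (nthE 3) (is_derive_continuous (nthE 4)).
have K1 := HM1 mbar mu mb is_derive_mbar mu_cont mbar_norm.
have K2 B HB := HM1 mu mu' B is_derive_mu mu'_cont HB.
have K3 B HB := HM1 mu' mu'' B is_derive_mu' mu''_cont HB.
exact (bootstrap_bounds b0 hmb (ltW mb_lt1) M10 is_derive_mbar is_derive_mu is_derive_mu' KE1 KE2 mu_eq mbar_norm K1 K2 K3).
Qed.

(** At infinity [mbar] approaches the stable phases, where [sigma < 1]. *)
Lemma sg_tail : exists Z0 q : R, [/\ 0 < Z0, 0 < q, q < 1 & forall z, Z0 <= `|z| -> sg z <= q].
Proof.
have s1 : sgmin < 1 := sigma_lt1 hbeta hmb hmb_eq.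
have cvs : sg z @[z --> +oo] --> sgmin.
  apply: cvgM; first exact: cvg_cst.
  by apply: cvgB; [exact: cvg_cst|apply: cvgM; exact: (instanton_pinfty hmbar)].
pose q := (1 + sgmin) / 2.
have sq : sgmin < q by rewrite /q; lra.
have [A [_ HA]] := cvgr_lt sgmin cvs q sq.
exists (`|A| + 1), q; split; rewrite ?ltr_pwDr//; try by rewrite /q; have := sgmin_gt0; lra.
move=> z zA; have : sg `|z| < q by apply: HA; have := ler_norm A; lra.
by have [z0|z0] := leP 0 z; [rewrite ger0_norm|rewrite ltr0_norm// sg_even] => // /ltW.
Qed.

(** Beyond [Z0] one application of [mu = sigma K mu] gains a factor [q < 1] at the
price of one unit of distance, so the decay is geometric; a quadratic
rate is what the cut of the weight uses. *)
Lemma mu_decay : exists2 C : R, 0 < C & forall z, mu z * z ^+ 2 <= C.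
Proof.
have [M M0 HM] := mu_bounds; have [Z0 [q [Z00 q0 q1 Hq]]] := sg_tail.
have muM z : mu z <= M by have [] := HM z.
(* geometric decay, one unit of distance at a time *)
have geo (n : nat) : forall z, Z0 + n%:R <= `|z| -> mu z <= q ^+ n * M.
  elim: n => [|n IH] z zn; first by rewrite expr0 mul1r.
  have nn : n.+1%:R = n%:R + 1 :> R by rewrite -natr1.
  have n0 : 0 <= n%:R :> R by [].
  have KM : K mu z <= q ^+ n * M.
    rewrite -[leRHS](Eav_cst hJ); apply: le_Eav => //; [exact: cSq_shift mu_cont|exact: within_cont_cst|].
    move=> [x y] /SqE[x1 _] /=; apply: IH.
    by have := lerB_normD z x; lra.
  rewrite mu_eq exprS -mulrA ler_pM//; [exact/ltW/sg_gt0|exact/ltW/Jstar_mu_gt0|].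
  by apply: Hq; lra.
pose c := 1 - q; have c0 : 0 < c by rewrite subr_gt0.
have qn (n : nat) : q ^+ n <= ((1 + c * n%:R / 2) ^+ 2)^-1.
  have qc : q <= expR (- c) by have := expR_ge1Dx (- c); rewrite /c; lra.
  have cn0 : 0 <= c * n%:R / 2 by rewrite divr_ge0// mulr_ge0// ltW.
  apply: (@le_trans _ _ (expR (- c) ^+ n)); first by rewrite lerXn2r ?nnegrE ?expR_ge0// ltW.
  rewrite -expRM_natr mulNr expRN lef_pV2 ?posrE ?expR_gt0//; last by rewrite exprn_gt0//; lra.
  have -> : expR (c * n%:R) = expR (c * n%:R / 2) ^+ 2 by rewrite -expRM_natr divfK.
  move: cn0; set y := c * n%:R / 2 => cn0.
  have ey : 1 + y <= expR y by exact: expR_ge1Dx.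
  have y1 : 0 <= 1 + y by lra.
  by apply: lerXn2r; rewrite ?nnegrE ?expR_ge0.
pose A := Z0 + 1 + 2 / c.
have A0 : 0 < A by rewrite !addr_gt0// divr_gt0.
exists (A ^+ 2 * M); first by rewrite mulr_gt0// exprn_gt0.
move=> z; rewrite -(real_normK (num_real z)).
have [zZ|zZ] := leP `|z| Z0.
  have ZA : Z0 <= A by rewrite /A; have : 0 < 2 / c by [rewrite divr_gt0]; lra.
  rewrite mulrC ler_pM ?exprn_ge0 ?(ltW (mu_gt0 z))//.
  by rewrite ler_pXn2r// ?nnegrE ?(ltW A0)// (le_trans zZ).
pose n := Num.truncn (`|z| - Z0).
have := truncn_itv (_ : 0 <= `|z| - Z0); rewrite subr_ge0 ltW// => /(_ isT) /andP[].
rewrite -/n => n1 n2.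
have zA : `|z| <= A * (1 + c * n%:R / 2).
  have nn : n.+1%:R = n%:R + 1 :> R by rewrite -natr1.
  have -> : A * (1 + c * n%:R / 2) = A + n%:R + (Z0 + 1) * (c * n%:R / 2).
    by rewrite /A; field; rewrite gt_eqF.
  have : 0 <= (Z0 + 1) * (c * n%:R / 2) by rewrite mulr_ge0// ?divr_ge0// ?mulr_ge0//; lra.
  have : 0 < 2 / c by rewrite divr_gt0.
  rewrite /A; lra.
have D0 : 0 < 1 + c * n%:R / 2.
  have : 0 <= c * n%:R / 2 by rewrite divr_ge0// mulr_ge0// ltW.
  lra.
have mun : mu z <= ((1 + c * n%:R / 2) ^+ 2)^-1 * M.
  apply: le_trans (geo n z _) _; first by lra.
  by rewrite ler_wpM2r// ltW.
apply: (@le_trans _ _ (((1 + c * n%:R / 2) ^+ 2)^-1 * M * (A * (1 + c * n%:R / 2)) ^+ 2)).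
  rewrite ler_pM// ?exprn_ge0//; first exact/ltW/mu_gt0.
  by rewrite ler_pXn2r// nnegrE// mulr_ge0// ltW.
rewrite exprMn; set D := 1 + _ in D0 *.
rewrite (_ : _ * _ = A ^+ 2 * M)//; field.
by rewrite gt_eqF.
Qed.

End Instanton.

(** * Contraction of odd functions *)

(** The operator [K] is abstract here and enters through positivity, normalization
and the local minorization, as in Harris's theorem for Markov chains. *)
Section Harris.
Context {R : realType}.
Notation leb := (@lebesgue_measure R).
Variables (K : (R -> R) -> R -> R) (mu sg : R -> R).
Variables (M smin beta Z q d c0 : R).
Hypotheses (Kle : forall (f g : R -> R) z, continuous f -> continuous g ->
  (forall x, f x <= g x) -> K f z <= K g z).
Hypotheses (KD : forall (f g : R -> R) z, continuous f -> continuous g ->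
  K (fun x => f x + g x) z = K f z + K g z).
Hypotheses (KZ : forall c (f : R -> R) z, continuous f -> K (fun x => c * f x) z = c * K f z).
Hypotheses (Kcst : forall c z, K (fun=> c) z = c).
Hypotheses (d0 : 0 < d) (d1 : d <= 1) (c00 : 0 < c0).
Hypotheses (Kminor : forall (f : R -> R) (z a b : R), continuous f -> (forall x, 0 <= f x) ->
    a <= b -> `|a - z| <= d -> `|b - z| <= d ->
    c0 * \int[leb]_(x in `[a, b]) f x <= K f z).
Hypotheses (mu_c : continuous mu) (mu0 : forall z, 0 < mu z) (muM : forall z, mu z <= M).
Hypotheses (smin0 : 0 < smin) (sg_min : forall z, smin <= sg z)
  (sg_max : forall z, sg z <= beta).
Hypotheses (Z0 : 0 < Z) (q0 : 0 < q) (q1 : q < 1) (sg_q : forall z, Z <= `|z| -> sg z <= q).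
Hypotheses (muE : forall z, mu z = sg z * K mu z).

Let sg0 z : 0 < sg z. Proof. exact: lt_le_trans smin0 (sg_min z). Qed.

Lemma Rintegral_odd_eq0 (f : R -> R) (a : R) : continuous f -> (forall x, f (- x) = - f x) ->
  \int[leb]_(x in `[- a, a]) f x = 0.
Proof.
move=> cf of'; set I := \int[leb]_(x in _) _.
have fi : leb.-integrable `[- a, a] (EFin \o f).
  by apply: continuous_compact_integrable; [exact: segment_compact|exact: continuous_subspaceT].
have : I = - I.
  rewrite {1}/I Rintegral_mkcond -(@Rintegral_shift_flip R (-1) 0); last 2 first.
  - by rewrite normrN normr1.
  - apply/(measurable_restrictT _ _).1; first exact: measurable_itv.
    by have /integrableP[/measurable_EFinP] := fi.
  have -> : - I = \int[leb]_(x in `[- a, a]) (-1 * f x).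
    by rewrite RintegralZl ?mulN1r//; exact: measurable_itv.
  rewrite [RHS]Rintegral_mkcond; apply: eq_Rintegral => x _; rewrite !patchE addr0 !mulN1r.
  rewrite of' (_ : (- x \in `[- a, a]%classic) = (x \in `[- a, a]%classic))//.
  by apply/idP/idP; rewrite !inE/= !in_itv/= => /andP[? ?]; apply/andP; split; lra.
by lra.
Qed.

Lemma Rintegral_itv_ge (f : R -> R) (a b m : R) : continuous f -> a <= b ->
  (forall x, a <= x <= b -> m <= f x) -> (b - a) * m <= \int[leb]_(x in `[a, b]) f x.
Proof.
move=> cf ab mf.
have E : leb (`[a, b]%classic : set R) = (b - a)%:E.
  rewrite lebesgue_measure_itv/= lte_fin; move: ab; rewrite le_eqVlt => /predU1P[->|->//].
  by rewrite ltxx subrr.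
have <- : \int[leb]_(x in `[a, b]) m = (b - a) * m.
  rewrite Rintegral_cst; last exact: measurable_itv.
  by rewrite mulrC; congr (_ * _); rewrite -[RHS]/(fine (b - a)%:E) -E.
apply: le_Rintegral; first exact: measurable_itv.
- by apply: continuous_compact_integrable; [exact: segment_compact|move=> ?; exact: cvg_cst].
- by apply: continuous_compact_integrable; [exact: segment_compact|exact: continuous_subspaceT].
- by move=> x /=; rewrite in_itv/= => /mf.
Qed.

Let KN (f : R -> R) z : continuous f -> K (fun x => - f x) z = - K f z.
Proof.
move=> cf; rewrite -mulN1r -KZ//; congr (K _ z).
by apply/funext => x; rewrite mulN1r.
Qed.

Let cD (f g : R -> R) : continuous f -> continuous g -> continuous (fun x => f x + g x).
Proof. by move=> cf cg x; apply: cvgD; [exact: cf|exact: cg]. Qed.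
Let cM (f g : R -> R) : continuous f -> continuous g -> continuous (fun x => f x * g x).
Proof. by move=> cf cg x; apply: cvgM; [exact: cf|exact: cg]. Qed.
Let cC (c : R) : continuous (fun _ : R => c).
Proof. by move=> x; exact: cvg_cst. Qed.
Let cN (f : R -> R) : continuous f -> continuous (fun x => - f x).
Proof. by move=> cf x; apply: cvgN; exact: cf. Qed.

Lemma K_abs_le (psi Psi : R -> R) z : continuous psi -> continuous Psi ->
  (forall x, `|psi x| <= Psi x) -> `|K psi z| <= K Psi z.
Proof.
move=> cp cP pP; rewrite ler_norml; apply/andP; split.
  rewrite -KN//; apply: Kle => //; first exact: cN.
  by move=> x; have := pP x; rewrite ler_norml => /andP[].
by apply: Kle => // x; have := pP x; rewrite ler_norml => /andP[].
Qed.

Lemma K_lower (f : R -> R) (z a b m : R) : continuous f -> (forall x, 0 <= f x) ->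
  a <= b -> `|a - z| <= d -> `|b - z| <= d -> (forall x, a <= x <= b -> m <= f x) ->
  c0 * ((b - a) * m) <= K f z.
Proof.
move=> cf f0 ab az bz mf; apply: le_trans (Kminor cf f0 ab az bz).
by rewrite ler_pM2l//; exact: Rintegral_itv_ge.
Qed.

(** The positive and negative parts of an odd function cancel near the origin, and
the minorization makes the cancellation visible in [K psi]. *)
Lemma K_odd_gain (psi Psi : R -> R) z (m : R) : continuous psi -> continuous Psi ->
  (forall x, psi (- x) = - psi x) ->
  (forall x, `|psi x| <= Psi x) -> `|z| <= d / 2 ->
  (forall x, `|x| <= d / 2 -> m <= Psi x) -> `|K psi z| <= K Psi z - c0 * (d * m).
Proof.
move=> cp cP op pP zd mP; have d0' := d0.
have up (psi' : R -> R) : continuous psi' -> (forall x, psi' (- x) = - psi' x) ->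
    (forall x, `|psi' x| <= Psi x) -> K psi' z <= K Psi z - c0 * (d * m).
  move=> cp' op' pP'.
  have cB : continuous (fun x => Psi x + - psi' x) by apply: cD => //; exact: cN.
  have B0 x : 0 <= Psi x + - psi' x.
    by rewrite subr_ge0; have := pP' x; rewrite ler_norml => /andP[].
  have zd' : - (d / 2) <= z <= d / 2 by rewrite -ler_norml.
  have /andP[z1 z2] := zd'.
  have := @Kminor (fun x => Psi x + - psi' x) z (- (d / 2)) (d / 2) cB B0.
  have -> : - (d / 2) <= d / 2 by lra.
  have -> : `|- (d / 2) - z| <= d by rewrite ler_norml; apply/andP; split; lra.
  have -> : `|d / 2 - z| <= d by rewrite ler_norml; apply/andP; split; lra.
  move=> /(_ isT isT isT); rewrite KD ?KN//; last exact: cN.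
  have ci (f : R -> R) : continuous f -> leb.-integrable `[- (d / 2), d / 2] (EFin \o f).
    by move=> cf; apply: continuous_compact_integrable; [exact: segment_compact|exact: continuous_subspaceT].
  have -> : \int[leb]_(x in `[- (d / 2), d / 2]) (Psi x + - psi' x) =
      \int[leb]_(x in `[- (d / 2), d / 2]) Psi x.
    rewrite RintegralB; [|exact: measurable_itv|exact: ci cP|exact: ci cp'].
    by rewrite (@Rintegral_odd_eq0 psi' (d / 2) cp' op') subr0.
  have := @Rintegral_itv_ge Psi (- (d / 2)) (d / 2) m cP.
  have -> : - (d / 2) <= d / 2 by lra.
  move=> /(_ isT) H; have {}H : d * m <= \int[leb]_(x in `[- (d / 2), d / 2]) Psi x.
    have dd : d = d / 2 - - (d / 2) by lra.
    by rewrite {1}dd; apply: H => x; rewrite -ler_norml; exact: mP.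
  have : c0 * (d * m) <= c0 * \int[leb]_(x in `[- (d / 2), d / 2]) Psi x by rewrite ler_pM2l.
  by lra.
rewrite ler_norml; apply/andP; split; last exact: up.
rewrite lerNl -KN//; apply: up; first exact: cN.
- by move=> x; rewrite op opprK.
- by move=> x; rewrite normrN.
Qed.

Let K0 (f : R -> R) z : continuous f -> (forall x, 0 <= f x) -> 0 <= K f z.
Proof. by move=> cf f0; rewrite -[leLHS](Kcst 0 z); apply: Kle. Qed.

Let Kmu0 z : 0 < K mu z.
Proof. by have := mu0 z; rewrite muE pmulr_rgt0. Qed.

Let rmu z := Num.sqrt (mu z).
Let rmu0 z : 0 < rmu z. Proof. by rewrite sqrtr_gt0. Qed.
Let rmu2 z : rmu z * rmu z = mu z. Proof. by rewrite -expr2 sqr_sqrtr// ltW. Qed.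
Let rmu_c : continuous rmu.
Proof. by move=> x; apply: continuous_comp; [exact: mu_c|exact: sqrt_continuous]. Qed.

(** Jensen's inequality for the square root, in the form
[2 k sqrt(mu) <= mu + k^2] with [k^2 = K mu]. *)
Lemma K_sqrt z : sg z * K rmu z <= Num.sqrt (sg z) * rmu z.
Proof.
set k := Num.sqrt (K mu z); have k0 : 0 < k by rewrite sqrtr_gt0.
have k2 : k * k = K mu z by rewrite -expr2 sqr_sqrtr// ltW.
have H : K rmu z <= k.
  have cg : continuous (fun x => (2 * k)^-1 * mu x + k / 2).
    by apply: cD; [apply: cM|].
  have -> : k = K (fun x => (2 * k)^-1 * mu x + k / 2) z.
    rewrite KD//; last by apply: cM.
    by rewrite KZ// Kcst -k2; field; rewrite gt_eqF.
  apply: Kle => // x; rewrite -subr_ge0.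
  rewrite -rmu2 (_ : _ - _ = (2 * k)^-1 * (rmu x - k) ^+ 2); last by field; rewrite gt_eqF.
  by rewrite mulr_ge0 ?sqr_ge0// invr_ge0 mulr_ge0// ltW.
apply: le_trans (_ : sg z * k <= _); first by rewrite ler_pM2l.
have ss : Num.sqrt (sg z) * Num.sqrt (sg z) = sg z by rewrite -expr2 sqr_sqrtr// ltW.
have -> : rmu z = Num.sqrt (sg z) * k by rewrite /rmu {1}muE sqrtrM// ltW.
by rewrite mulrA ss.
Qed.

(** Moving by [d / 4] towards the origin multiplies [exp(- th |z|)] by
[exp(th d / 4)], which beats every other constant when [th] is large. *)
Lemma barrier_jump (th m0 : R) (f : R -> R) : continuous f -> 0 < th -> 0 < m0 ->
  (forall z, `|z| <= Z + 1 -> m0 <= mu z) -> (forall z, f z = mu z * expR (- (th * `|z|))) ->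
  expR (- (th * (d / 4))) <= smin * c0 * (d / 4) * m0 / (2 * M) ->
  forall z, d / 2 <= `|z| -> `|z| <= Z + 1 -> 2 * f z <= sg z * K f z.
Proof.
have d0' := d0; have d1' := d1.
move=> fc th0 m00 Hm0 fE th1 z zd zZ; rewrite fE.
have M0 : 0 < M by apply: lt_le_trans (muM 0).
have f0 x : 0 < f x by rewrite fE mulr_gt0// expR_gt0.
have d2 : 0 < d / 2 by rewrite divr_gt0.
pose p0 := smin * c0 * (d / 4) * m0; have p00 : 0 < p0 by rewrite /p0 !mulr_gt0.
pose w := p0 / (2 * M); have w0 : 0 < w by rewrite divr_gt0// mulr_gt0.
have : c0 * (d / 4 * (m0 * expR (- (th * (`|z| - d / 4))))) <= K f z.
  have low x : 0 <= `|x| -> `|x| <= `|z| - d / 4 -> m0 * expR (- (th * (`|z| - d / 4))) <= f x.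
    move=> x0 xz; rewrite fE ler_pM ?expR_ge0//; first exact: ltW.
      by apply: Hm0; lra.
    by rewrite ler_expR lerN2 ler_pM2l.
  have [z0|z0] := leP 0 z.
    rewrite ger0_norm// in zd zZ low *.
    have := @K_lower f z (z - d / 2) (z - d / 4) (m0 * expR (- (th * (z - d / 4)))) fc (fun x => ltW (f0 x)).
    have -> : z - d / 4 - (z - d / 2) = d / 4 by lra.
    apply; [lra| | |].
    - by rewrite ler_norml; apply/andP; split; lra.
    - by rewrite ler_norml; apply/andP; split; lra.
    - move=> x /andP[x1 x2]; apply: low => //.
      by rewrite ger0_norm//; lra.
  rewrite ltr0_norm// in zd zZ low *.
  have := @K_lower f z (z + d / 4) (z + d / 2) (m0 * expR (- (th * (- z - d / 4)))) fc (fun x => ltW (f0 x)).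
  have -> : z + d / 2 - (z + d / 4) = d / 4 by lra.
  apply; [lra| | |].
  - by rewrite ler_norml; apply/andP; split; lra.
  - by rewrite ler_norml; apply/andP; split; lra.
  - move=> x /andP[x1 x2]; apply: low => //.
    by rewrite ler0_norm//; lra.
have -> : - (th * (`|z| - d / 4)) = - (th * `|z|) + th * (d / 4) by ring.
rewrite expRD => Kf.
have e4 : w^-1 <= expR (th * (d / 4)).
  by rewrite -[leRHS]invrK -expRN lef_pV2 ?posrE ?expR_gt0.
have E0 : 0 < expR (- (th * `|z|)) by exact: expR_gt0.
have : smin * K f z <= sg z * K f z by rewrite ler_wpM2r// K0// => x; exact: ltW.
apply: le_trans.
apply: le_trans (_ : smin * (c0 * (d / 4 * (m0 * (expR (- (th * `|z|)) * w^-1)))) <= _); last first.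
  by rewrite ler_pM2l//; apply: le_trans Kf; rewrite !ler_pM2l// divr_gt0.
have -> : smin * (c0 * (d / 4 * (m0 * (expR (- (th * `|z|)) * w^-1)))) = 2 * (M * expR (- (th * `|z|))).
  rewrite /w (_ : smin * _ = p0 * (expR (- (th * `|z|)) * (p0 / (2 * M))^-1)); last by rewrite /p0; ring.
  by field; rewrite !gt_eqF.
by rewrite ler_pM2l// ler_pM2r.
Qed.

(** The weight is [Psi = mu (1 - a exp(- th |z|)) + b sqrt mu].  Since [mu] is fixed
by [sigma K], a contraction factor must come from elsewhere: near the origin
from oddness; at intermediate distances from the term with [a], which [sigma K]
at least doubles; in the tails from [b sqrt mu], since
[sigma K sqrt mu <= sqrt(sigma) sqrt mu] and [sigma < 1] there.  The constants
[a], [th], [b] are chosen in this order. *)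
Lemma odd_contraction : exists Psi : R -> R, exists e b : R,
  [/\ 0 < e, e <= 1, 0 < b, continuous Psi &
   [/\ forall z, mu z / 2 <= Psi z, forall z, Psi z <= (Num.sqrt M + b) * rmu z &
   forall (psi : R -> R) (c : R), 0 <= c -> continuous psi -> (forall x, psi (- x) = - psi x) ->
   (forall x, `|psi x| <= c * Psi x) -> forall z, `|sg z * K psi z| <= (1 - e) * (c * Psi z)]].
Proof.
have d0' := d0; have d1' := d1; have Z0' := Z0.
have M0 : 0 < M by apply: lt_le_trans (muM 0).
have beta0 : 0 < beta by apply: lt_le_trans (sg_max 0).
pose M' := Num.sqrt M; have M'0 : 0 < M' by rewrite sqrtr_gt0.
have M'2 : M' * M' = M by rewrite -expr2 sqr_sqrtr// ltW.
pose B := Num.sqrt beta; have B0 : 0 < B by rewrite sqrtr_gt0.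
pose Q := Num.sqrt q; have Q0 : 0 < Q by rewrite sqrtr_gt0.
have Q1 : Q < 1 by rewrite -sqrtr1 ltr_sqrt.
have rM z : rmu z <= M' by rewrite ler_sqrt// ltW.
have sB z : Num.sqrt (sg z) <= B by rewrite ler_sqrt// ltW.
have [m0 m00 Hm0] : exists2 m0, 0 < m0 & forall z, `|z| <= Z + 1 -> m0 <= mu z.
  have ne : `[- (Z + 1), Z + 1]%classic !=set0.
    by exists 0; rewrite /= in_itv/=; apply/andP; split; lra.
  have [c cI Hc] := compact_EVT_min ne (@segment_compact R _ _) (continuous_subspaceT mu_c).
  by exists (mu c) => // z zZ; apply: Hc; rewrite inE/= in_itv/= -ler_norml.
have m0M : m0 <= M by apply: le_trans (Hm0 0 _) (muM 0); rewrite normr0; lra.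
have d2 : 0 < d / 2 by rewrite divr_gt0.
pose p0 := smin * c0 * (d / 4) * m0; have p00 : 0 < p0 by rewrite /p0 !mulr_gt0.
pose p1 := smin * c0 * d * (m0 / 2); have p10 : 0 < p1 by rewrite /p1 !mulr_gt0// divr_gt0.
pose a := Num.min (2^-1) (p1 / (4 * M)).
have a0 : 0 < a by rewrite lt_min invr_gt0 ltr0n/= divr_gt0// mulr_gt0.
have a2 : a <= 2^-1 by rewrite ge_min lexx.
have aM : a * M <= p1 / 4.
  apply: le_trans (_ : p1 / (4 * M) * M <= _).
    by rewrite ler_pM2r// ge_min lexx orbT.
  by rewrite le_eqVlt; apply/orP; left; apply/eqP; field; rewrite gt_eqF.
pose w1 := p0 / (2 * M); have w10 : 0 < w1 by rewrite divr_gt0// mulr_gt0.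
pose w2 := m0 * (1 - Q) / (4 * B * M); have w20 : 0 < w2.
  by rewrite divr_gt0 ?mulr_gt0// subr_gt0.
have [th th0 [th1 th2]] : exists2 th : R, 0 < th & expR (- (th * (d / 4))) <= w1 /\ expR (- th) <= w2.
  have ex (x w : R) : 0 < x -> 0 < w -> w^-1 <= x -> expR (- x) <= w.
    move=> x0 w0 wx; rewrite expRN -[leRHS]invrK lef_pV2 ?posrE ?expR_gt0 ?invr_gt0//.
    by have := expR_ge1Dx x; lra.
  have d4 : 0 < d / 4 by rewrite divr_gt0.
  exists (w1^-1 / (d / 4) + w2^-1); first by rewrite addr_gt0 ?divr_gt0// invr_gt0.
  have i1 : 0 < w1^-1 by rewrite invr_gt0.
  have i2 : 0 < w2^-1 by rewrite invr_gt0.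
  have i3 : 0 < w1^-1 / (d / 4) by rewrite divr_gt0.
  split; apply: ex => //; rewrite ?mulr_gt0 ?addr_gt0//; last by lra.
  rewrite mulrDl divfK ?gt_eqF//; have : 0 < w2^-1 * (d / 4) by rewrite mulr_gt0.
  by lra.
pose eZ := expR (- (th * Z)); have eZ0 : 0 < eZ by exact: expR_gt0.
have eZ1 : eZ <= 1 by rewrite -expR0 ler_expR lerNl oppr0 mulr_ge0// ltW.
pose b := a * m0 * eZ / (2 * B * M'); have b0 : 0 < b.
  by rewrite divr_gt0 ?mulr_gt0.
have bBM : b * B * M' = a * m0 * eZ / 2.
  by rewrite /b; field; rewrite !gt_eqF.
pose f z := mu z * expR (- (th * `|z|)).
have f0 z : 0 < f z by rewrite mulr_gt0// expR_gt0.
have fc : continuous f.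
  apply: cM => // x; apply: (@continuous_comp _ _ _ (fun x : R => - (th * `|x|)) expR); last exact: continuous_expR.
  by apply: cvgN; apply: cvgM; [exact: cvg_cst|exact: norm_continuous].
have fmu z : f z <= mu z.
  rewrite /f ler_piMr//; first exact: ltW.
  by rewrite -expR0 ler_expR lerNl oppr0 mulr_ge0// ltW.
pose Psi z := mu z + - a * f z + b * rmu z.
have cPsi : continuous Psi by apply: cD; [apply: cD => //; apply: cM|apply: cM].
have Psi_lo z : mu z * (1 - a) + b * rmu z <= Psi z.
  rewrite /Psi lerD2r mulrBr mulr1 lerD2l mulNr lerN2 mulrC.
  by rewrite ler_pM2r.
have Psi_hi z : Psi z <= mu z + b * rmu z.
  by rewrite /Psi lerD2r gerDl mulNr oppr_le0 mulr_ge0// ltW.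
have Psi_r z : Psi z <= (M' + b) * rmu z.
  apply: le_trans (Psi_hi z) _; rewrite mulrDl lerD2r -rmu2 ler_pM2r//.
have Psi_M z : Psi z <= M + b * M'.
  by apply: le_trans (Psi_hi z) _; rewrite lerD// ler_pM2l.
have Psi_half z : mu z / 2 <= Psi z.
  apply: le_trans (Psi_lo z).
  have : 0 < b * rmu z by rewrite mulr_gt0.
  have : mu z * a <= mu z / 2 by rewrite ler_pM2l.
  by lra.
have Psi0 z : 0 < Psi z by apply: lt_le_trans (Psi_half z); rewrite divr_gt0.
have KPsi z : sg z * K Psi z <= mu z - a * (sg z * K f z) + b * (Num.sqrt (sg z) * rmu z).
  have c1 : continuous (fun x => - a * f x) by apply: cM.
  have c2 : continuous (fun x => b * rmu x) by apply: cM.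
  rewrite /Psi (KD (f := fun z => mu z + - a * f z) z _ c2); last by apply: cD.
  rewrite (KD z mu_c c1) !KZ// !mulrDr -muE !mulNr mulrN [sg z * (a * _)]mulrCA lerD2l.
  by rewrite mulrCA ler_pM2l// K_sqrt.
(* the term with [a] gains at intermediate distances *)
have Kf2 := barrier_jump fc th0 m00 Hm0 (fun=> erefl) th1.
pose g1 := a * m0 * eZ / 2; have g10 : 0 < g1 by rewrite divr_gt0// !mulr_gt0.
pose D := M + b * M'; have D0 : 0 < D by rewrite addr_gt0// mulr_gt0.
pose g2 := b * (1 - Q); have g20 : 0 < g2 by rewrite mulr_gt0// subr_gt0.
have g1p1 : g1 <= p1 / 8.
  have : a * m0 * eZ <= a * M * 1 by apply: ler_pM => //; [rewrite mulr_ge0// ltW|exact: ltW|rewrite ler_pM2l].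
  by rewrite /g1; lra.
(* [g1] is the gain at bounded distance, [g2 sqrt mu] the gain in the tails *)
pose e := Num.min 1 (Num.min (g1 / D) (g2 / 2 / (M' + b))).
have Mb0 : 0 < M' + b by rewrite addr_gt0.
have e0 : 0 < e by rewrite /e !lt_min ltr01/=; apply/andP; split; apply: divr_gt0 => //; exact: divr_gt0.
have e1 : e <= 1 by rewrite ge_min lexx.
have eD : e * D <= g1.
  by rewrite -ler_pdivlMr// /e !ge_min lexx !orbT.
have eM : e * (M' + b) <= g2 / 2.
  by rewrite -ler_pdivlMr// /e !ge_min lexx !orbT.
have ePsi z : e * Psi z <= g1 by apply: le_trans eD; rewrite ler_pM2l.
have ePsir z : e * Psi z <= g2 / 2 * rmu z.
  by apply: le_trans (_ : e * (M' + b) * rmu z <= _); [rewrite -mulrA ler_pM2l|rewrite ler_pM2r].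
have sKf0 z : 0 <= a * (sg z * K f z).
  apply: mulr_ge0; first exact: ltW.
  by apply: mulr_ge0; [exact: ltW|apply: K0 => // x; exact: ltW].
have bsr z : b * (Num.sqrt (sg z) * rmu z) <= g1.
  rewrite /g1 -bBM -mulrA ler_pM2l// ler_pM// ?sqrtr_ge0//.
exists Psi, e, b; split => //; split => // psi c c_ge0 cpsi opsi psiP z.
have ccP : continuous (fun x => c * Psi x) by apply: cM.
rewrite normrM gtr0_norm//.
have [zd|zd] := leP `|z| (d / 2).
  (* near the origin: cancellation of odd functions *)
  have mP x : `|x| <= d / 2 -> c * (m0 / 2) <= c * Psi x.
    move=> xd; rewrite ler_wpM2l//; apply: le_trans (Psi_half x).
    rewrite ler_pM2r ?invr_gt0//; apply: Hm0.
    by apply: le_trans xd _; lra.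
  have := K_odd_gain cpsi ccP opsi psiP zd mP; rewrite KZ// => H.
  apply: le_trans (_ : sg z * (c * K Psi z - c0 * (d * (c * (m0 / 2)))) <= _); first by rewrite ler_pM2l.
  have -> : sg z * (c * K Psi z - c0 * (d * (c * (m0 / 2)))) =
    c * (sg z * K Psi z - sg z * (c0 * (d * (m0 / 2)))) by ring.
  have -> : (1 - e) * (c * Psi z) = c * ((1 - e) * Psi z) by ring.
  rewrite ler_wpM2l//.
  have : p1 <= sg z * (c0 * (d * (m0 / 2))).
    by rewrite /p1 -!mulrA ler_wpM2r// ?mulr_ge0// ?ltW// divr_ge0// ltW.
  have := KPsi z; have := sKf0 z; have := bsr z; have := ePsi z; have := Psi_lo z.
  have : 0 < b * rmu z by rewrite mulr_gt0.
  have : mu z * a <= M * a by rewrite ler_pM2r.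
  rewrite mulrBl mul1r; move: aM; rewrite [a * M]mulrC => *; lra.
have HK : `|K psi z| <= c * K Psi z by rewrite -KZ//; exact: K_abs_le.
apply: le_trans (_ : sg z * (c * K Psi z) <= _); first by rewrite ler_pM2l.
rewrite mulrCA [leRHS]mulrCA ler_wpM2l// mulrBl mul1r.
have [zZ|zZ] := leP `|z| Z.
  (* intermediate distances *)
  have zZ1 : `|z| <= Z + 1 by lra.
  have fl : m0 * eZ <= f z.
    rewrite /f ler_pM ?expR_ge0 ?Hm0//; first exact: ltW.
    by rewrite ler_expR lerN2 ler_pM2l.
  have af : 2 * g1 <= a * f z by rewrite /g1; have := ler_wpM2l (ltW a0) fl; lra.
  have := ler_wpM2l (ltW a0) (Kf2 z (ltW zd) zZ1).
  have := KPsi z; have := bsr z; have := ePsi z; have : 0 < b * rmu z by rewrite mulr_gt0.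
  rewrite /Psi mulNr; lra.
(* tails; up to [Z + 1] the barrier still gains, beyond it is negligible *)
have sQ : Num.sqrt (sg z) <= Q by rewrite ler_sqrt ?sg_q// ltW.
have bQ : b * (Num.sqrt (sg z) * rmu z) <= b * rmu z - g2 * rmu z.
  rewrite /g2 (_ : b * rmu z - _ = b * (Q * rmu z)); last by ring.
  by rewrite ler_pM2l// ler_pM2r.
have g2r : 0 < g2 * rmu z by rewrite mulr_gt0.
have [zZ1|zZ1] := leP `|z| (Z + 1).
  have := ler_wpM2l (ltW a0) (Kf2 z (ltW zd) zZ1).
  have := KPsi z; have := ePsir z.
  have : 0 < a * f z by rewrite mulr_gt0.
  move: bQ g2r; rewrite /Psi mulNr; lra.
have af : a * f z <= g2 / 2 * rmu z.
  have fz : f z <= M' * rmu z * (eZ * w2).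
    rewrite /f -rmu2; apply: ler_pM; [by rewrite mulr_ge0// ltW|exact: expR_ge0|by rewrite ler_pM2r|].
    apply: le_trans (_ : eZ * expR (- th) <= _); last by rewrite ler_pM2l.
    rewrite -expRD ler_expR -opprD lerN2 -[X in _ + X]mulr1 -mulrDr ler_pM2l//.
    exact: ltW.
  apply: le_trans (ler_wpM2l (ltW a0) fz) _.
  rewrite (_ : a * _ = g2 / 2 * rmu z)// /g2 /b /w2 -M'2.
  by field; rewrite !gt_eqF.
have := KPsi z; have := ePsir z; have := sKf0 z.
move: bQ g2r; rewrite /Psi mulNr; lra.
Qed.

End Harris.

(** * An approximate Poisson equation on the line *)

Section LocalCalculus.
Context {R : realType}.

Lemma Lipschitz_of_derive_on (f df : R -> R) (a b B x y : R) :
  (forall t : R, a <= t <= b -> is_derive t 1 f (df t)) ->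
  (forall t, a <= t <= b -> `|df t| <= B) -> a <= x <= b -> a <= y <= b ->
  `|f y - f x| <= B * `|y - x|.
Proof.
move=> fE dfB.
have main u v : u <= v -> a <= u <= b -> a <= v <= b -> `|f v - f u| <= B * `|v - u|.
  move=> uv /andP[au _] /andP[_ vb].
  have sub t : u <= t <= v -> a <= t <= b by move=> /andP[? ?]; apply/andP; split; lra.
  have cf : {within `[u, v], continuous f}.
    apply: continuous_in_subspaceT => t; rewrite inE/= in_itv/= => /sub /fE [dt _].
    exact/differentiable_continuous/derivable1_diffP.
  have [|c] := @MVT_segment R f df u v uv _ cf.
    by move=> t; rewrite in_itv/= => /andP[? ?]; apply: fE; apply: sub; rewrite !ltW.
  rewrite in_itv/= => /sub ci ->; rewrite normrM ler_wpM2r//.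
  exact: dfB.
have [xy|yx] := leP x y => xI yI; first exact: main.
by rewrite distrC (distrC y); apply: main => //; exact: ltW.
Qed.

(** An antiderivative on a bounded interval is enough, because averages only see
an interval of length [2]. *)
Lemma antiderivative_on (f : R -> R) (N : R) : continuous f ->
  exists Th : R -> R, forall t : R, `|t| < N -> is_derive t 1 Th (f t).
Proof.
move=> cf; exists (fun x => \int[@lebesgue_measure R]_(t in `[- N, x]) f t) => t.
rewrite ltr_norml => /andP[tN Nt].
have fi : (@lebesgue_measure R).-integrable `[- N, N] (EFin \o f).
  by apply: continuous_compact_integrable; [exact: segment_compact|exact: continuous_subspaceT].
have [dF Ff] := continuous_FTC1_closed Nt fi tN (cf t).
split; first exact: dF.
by rewrite -derive1E.
Qed.
End LocalCalculus.

Section KernelRegularity.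
Context {R : realType}.
Variables (J : R * R -> R) (hJ : interaction_kernel J).
Notation K := (Jstar J).

Lemma Eav1B (f g : R * R -> R) : cSq f -> cSq g ->
  Eav1 J (fun p => f p - g p) = Eav1 J f - Eav1 J g.
Proof.
move=> cf cg; rewrite /Eav1 -RintegralB; [|exact: Sq_measurable|exact: Eav1_int|exact: Eav1_int].
by apply: eq_Rintegral => p _; rewrite mulrBr.
Qed.

Lemma Jstar_continuous (f : R -> R) : continuous f -> continuous (K f).
Proof.
move=> cf z; have [M1 M10 HM1] := Eav1_bound hJ.
pose N := `|z| + 3; have [Th ThE] := antiderivative_on N cf.
have [B HB] := continuous_segment_bounded N cf.
have near0 (h x : R) : `|h| <= 1 -> `|x| <= 1 -> `|z + h + x| < N.
  by move=> h1 x1; have := ler_normD (z + h) x; have := ler_normD z h; rewrite /N; lra.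
have cTh h : `|h| <= 1 -> cSq (fun p : R * R => Th (z + h + p.1)).
  move=> h1; apply: continuous_in_subspaceT => -[x y]; rewrite inE => /SqE[x1 _].
  apply: (@continuous_comp _ _ _ (fun p : R * R => z + h + p.1) Th).
    by apply: cvgD; [exact: cvg_cst|exact: cvg_fst].
  by have [dt _] := ThE _ (near0 h x h1 x1); exact/differentiable_continuous/derivable1_diffP.
have KE h : `|h| <= 1 -> K f (z + h) = - Eav1 J (fun p => Th (z + h + p.1)).
  move=> h1; rewrite /Jstar; apply: (Eav_by_parts hJ (cTh h h1) (cSq_shift _ cf)).
  move=> x y x1 y1 /=.
  refine (isd_eq (isd_comp (ThE _ (near0 h x h1 x1)) (isdD (isd_cst x (z + h)) (isd_id x))) _).
  by rewrite add0r mulr1.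
have lip h : `|h| <= 1 -> `|K f (z + h) - K f z| <= M1 * B * `|h|.
  move=> h1; have n01 : `|0 : R| <= 1 by rewrite normr0.
  rewrite -{2}(addr0 z) !KE// opprK addrC -Eav1B; [|exact: cTh|exact: cTh].
  rewrite -mulrA; apply: HM1.
    by move=> p; apply: cvgB; [exact: cTh|exact: cTh].
  move=> [x y] /SqE[x1 _] /=.
  have := @Lipschitz_of_derive_on _ Th f (z - 2) (z + 2) B (z + h + x) (z + 0 + x).
  have -> : z + 0 + x - (z + h + x) = - h by ring.
  have tz t : z - 2 <= t <= z + 2 -> `|t| < N.
    move=> /andP[? ?]; have : `|t - z| <= 2 by rewrite ler_norml; apply/andP; split; lra.
    have := ler_normD (t - z) z; rewrite subrK /N; lra.
  rewrite normrN; apply.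
  - by move=> t /tz /ThE.
  - by move=> t /tz /ltW /HB.
  - by move: h1 x1; rewrite !ler_norml => /andP[? ?] /andP[? ?]; apply/andP; split; lra.
  - by move: x1; rewrite !ler_norml => /andP[? ?]; apply/andP; split; lra.
apply/cvgrPdist_le => /= eps eps0.
pose C := M1 * `|B| + 1; have C0 : 0 < C by rewrite ltr_pwDr// mulr_ge0// ltW.
near=> w.
have w1 : `|w - z| <= 1 by rewrite distrC; near: w; exact: cvgr_dist_le.
have we : `|w - z| <= eps / C.
  by rewrite distrC; near: w; apply: cvgr_dist_le => //; rewrite divr_gt0.
have zw : z + (w - z) = w by ring.
have := lip _ w1; rewrite zw distrC => h; apply: le_trans h _.
apply: (@le_trans _ _ (C * `|w - z|)).
  rewrite ler_wpM2r// /C (@le_trans _ _ (M1 * `|B|))// ?lerDl//.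
  by rewrite ler_pM2l// ler_norm.
by rewrite mulrC -ler_pdivlMr.
Unshelve. all: end_near. Qed.

Lemma Jstar_odd (f : R -> R) : continuous f -> (forall x, f (- x) = - f x) ->
  forall z, K f (- z) = - K f z.
Proof.
move=> cf of' z; pose g (p : R * R) := f (- z + p.1).
have cg : continuous g.
  move=> p; apply: (@continuous_comp _ _ _ (fun p : R * R => - z + p.1) f); last exact: cf.
  by apply: cvgD; [exact: cvg_cst|exact: cvg_fst].
have cs : (-1) ^+ 2 + 0 ^+ 2 = 1 :> R by rewrite expr0n addr0 sqrrN expr1n.
have -> : - K f z = Eav J (fun p => -1 * f (z + p.1)).
  by rewrite (EavZ hJ) ?mulN1r//; exact: cSq_shift.
rewrite -[LHS]/(Eav J g) -(Eav_rot hJ cs cg).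
apply: eq_Eav => // -[x y] _; rewrite /g /= mul0r subr0 !mulN1r -of'.
by congr f; ring.
Qed.

End KernelRegularity.

Section Poisson.
Context {R : realType}.
Variables (K : (R -> R) -> R -> R) (mu sg Psi : R -> R) (e C1 P1 : R).
Hypotheses (KD : forall (f g : R -> R) z, continuous f -> continuous g ->
  K (fun x => f x + g x) z = K f z + K g z).
Hypotheses (KZ : forall c (f : R -> R) z, continuous f -> K (fun x => c * f x) z = c * K f z).
Hypotheses (Kc : forall (f : R -> R), continuous f -> continuous (K f)).
Hypotheses (Ko : forall (f : R -> R), continuous f -> (forall x, f (- x) = - f x) ->
  forall z, K f (- z) = - K f z).
Hypotheses (sg_c : continuous sg) (sg_even : forall z, sg (- z) = sg z).
Hypotheses (e0 : 0 < e) (e1 : e <= 1).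
Hypotheses (mu0 : forall z, 0 < mu z) (muPsi : forall z, mu z / 2 <= Psi z)
  (Psi1 : forall z, Psi z <= C1 * Num.sqrt (mu z)) (PsiB : forall z, Psi z <= P1).
Hypothesis (contr : forall (psi : R -> R) (c : R), 0 <= c -> continuous psi ->
   (forall x, psi (- x) = - psi x) ->
   (forall x, `|psi x| <= c * Psi x) -> forall z, `|sg z * K psi z| <= (1 - e) * (c * Psi z)).

(** Partial sums of the Neumann series.  They stay continuous and odd, which a
limit would require an extra argument for, and leave an arbitrarily small
residual. *)
Lemma approx_poisson (F : R -> R) (A eta : R) : 0 <= A -> continuous F ->
  (forall x, F (- x) = - F x) -> (forall z, `|F z| <= A * mu z) -> 0 < eta ->
  exists psi : R -> R, [/\ continuous psi, forall z, `|psi z| <= (2 / e * C1) * A * Num.sqrt (mu z) &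
    forall z, `|psi z - sg z * K psi z - F z| <= eta].
Proof.
move=> A0 cF oF FA eta0.
pose T (f : R -> R) z := sg z * K f z.
have cT f : continuous f -> continuous (T f).
  by move=> cf z; apply: cvgM; [exact: sg_c|exact: Kc].
have oT f : continuous f -> (forall x, f (- x) = - f x) -> forall x, T f (- x) = - T f x.
  by move=> cf of' x; rewrite /T sg_even Ko// mulrN.
pose psi n := iter n (fun f => (fun z => F z + T f z)) (fun=> 0).
have cpsi n : continuous (psi n).
  elim: n => [|n IH] z; first exact: cvg_cst.
  by apply: cvgD; [exact: cF|exact: cT].
have opsi n x : psi n (- x) = - psi n x.
  elim: n x => [|n IH] x; first by rewrite oppr0.
  by rewrite /= oF oT// opprD.
have Psi0 z : 0 <= Psi z by apply: le_trans (muPsi z); rewrite divr_ge0// ltW.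
have FP z : `|F z| <= 2 * A * Psi z.
  apply: le_trans (FA z) _; rewrite mulrAC mulrC ler_wpM2r//.
  by have := muPsi z; lra.
have psiP n z : `|psi n z| <= 2 * A / e * Psi z.
  have c0 : 0 <= 2 * A / e by rewrite divr_ge0 ?mulr_ge0// ltW.
  elim: n z => [|n IH] z; first by rewrite normr0 mulr_ge0.
  rewrite /= (le_trans (ler_normD _ _))//.
  apply: le_trans (lerD (FP z) (contr c0 (cpsi n) (opsi n) IH z)) _.
  rewrite le_eqVlt; apply/orP; left; apply/eqP; field; rewrite gt_eqF//.
have diff n z : `|psi n.+1 z - psi n z| <= (1 - e) ^+ n * (2 * A) * Psi z.
  have c0 m : 0 <= (1 - e) ^+ m * (2 * A) by rewrite mulr_ge0 ?mulr_ge0// exprn_ge0// subr_ge0.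
  elim: n z => [|n IH] z.
    have T0 : T (fun=> 0) z = 0.
      rewrite /T (_ : (fun _ : R => 0) = fun x => 0 * (fun _ : R => 0) x).
        by rewrite KZ ?mul0r ?mulr0// => x; exact: cvg_cst.
      by apply/funext => x; rewrite mul0r.
    by rewrite /= T0 addr0 subr0 expr0 mul1r.
  pose D x := psi n.+1 x + -1 * psi n x.
  have cD : continuous D.
    by move=> x; apply: cvgD; [exact: cpsi|apply: cvgM; [exact: cvg_cst|exact: cpsi]].
  have oD x : D (- x) = - D x by rewrite /D !opsi; ring.
  have DB x : `|D x| <= (1 - e) ^+ n * (2 * A) * Psi x by rewrite /D mulN1r.
  have -> : psi n.+2 z - psi n.+1 z = T D z.
    rewrite /T KD//; last by move=> x; apply: cvgM; [exact: cvg_cst|exact: cpsi].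
    by rewrite KZ//= /T; ring.
  apply: le_trans (contr (c0 n) cD oD DB z) _.
  by rewrite exprS !mulrA.
have P10 : 0 <= P1 by apply: le_trans (Psi0 0) (PsiB 0).
have [n nP] : exists n : nat, (1 - e) ^+ n * (2 * A * P1 + 1) <= eta.
  have c0 : 0 < 2 * A * P1 + 1 by rewrite ltr_pwDr// mulr_ge0 ?mulr_ge0.
  have e1' : `|1 - e| < 1 by rewrite ger0_norm ?subr_ge0// gtrBl.
  have ez : 0 < eta / (2 * A * P1 + 1) by rewrite divr_gt0.
  have [n _ H] : \forall n \near \oo, (1 - e) ^+ n <= eta / (2 * A * P1 + 1).
    exact: (cvgr_le 0 (cvg_expr e1') _ ez).
  by exists n; rewrite -ler_pdivlMr//; exact: (H n (leqnn n)).
exists (psi n); split => //.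
  move=> z; apply: le_trans (psiP n z) _.
  apply: (@le_trans _ _ (2 * A / e * (C1 * Num.sqrt (mu z)))).
    by rewrite ler_wpM2l// divr_ge0 ?mulr_ge0// ltW.
  rewrite le_eqVlt; apply/orP; left; apply/eqP; field; rewrite gt_eqF//.
move=> z; have -> : psi n z - sg z * K (psi n) z - F z = - (psi n.+1 z - psi n z).
  by rewrite /= /T; ring.
rewrite normrN; apply: le_trans (diff n z) _; apply: le_trans nP; rewrite -mulrA.
rewrite ler_wpM2l ?exprn_ge0 ?subr_ge0//.
apply: (@le_trans _ _ (2 * A * P1)); last by rewrite lerDl.
by rewrite ler_wpM2l// mulr_ge0.
Qed.
End Poisson.

Section InstantonPoisson.
Context {R : realType}.
Variables (beta : R) (hbeta : 1 < beta).
Variables (mb : R) (hmb : 0 < mb) (hmb_eq : mb = tanh (beta * mb)).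
Variables (J : R * R -> R) (hJ : interaction_kernel J).
Variables (mbar : R -> R) (hmbar : instanton beta J mb mbar).
Notation K := (Jstar J).
Notation mu := (mu mbar).
Notation sg := (sg beta mbar).

Lemma instanton_poisson : exists2 C : R, 0 < C & forall (F : R -> R) (A eta : R), 0 <= A ->
  continuous F -> (forall x, F (- x) = - F x) -> (forall z, `|F z| <= A * mu z) -> 0 < eta ->
  exists psi : R -> R, [/\ continuous psi, forall z, `|psi z| <= C * A * Num.sqrt (mu z) &
    forall z, `|psi z - sg z * K psi z - F z| <= eta].
Proof.
have [M M0 HM] := mu_bounds hbeta hmb hmb_eq hJ hmbar.
have muM z : mu z <= M by have [] := HM z.
have [Z0 [q [Z00 q0 q1 Hq]]] := sg_tail hbeta hmb hmb_eq hmbar.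
have [d [c0 [d0 d1 c00 Hm]]] := Jstar_minorization hJ.
have muc : continuous mu := mu_cont hmbar.
have mu0 z : 0 < mu z := mu_gt0 hbeta hmb hmb_eq hJ hmbar z.
have Kle (f g : R -> R) z : continuous f -> continuous g -> (forall x, f x <= g x) -> K f z <= K g z.
  by move=> cf cg fg; apply: (le_Eav hJ) => //; exact: cSq_shift.
have KD (f g : R -> R) z : continuous f -> continuous g -> K (fun x => f x + g x) z = K f z + K g z.
  by move=> cf cg; apply: (EavD hJ); exact: cSq_shift.
have KZ c (f : R -> R) z : continuous f -> K (fun x => c * f x) z = c * K f z.
  by move=> cf; apply: (EavZ hJ); exact: cSq_shift.
have Kcst c z : K (fun=> c) z = c by exact: (Eav_cst hJ).
have sgm : 0 < sgmin beta mb by exact: sgmin_gt0.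
have sgge z : sgmin beta mb <= sg z by apply: (sg_ge hbeta hmb hmbar).
have sgle z : sg z <= beta by apply: sg_le.
have sge z : sg (- z) = sg z by apply: (sg_even hmbar).
have sgc : continuous sg by apply: (sg_cont hmbar).
have mueq z : mu z = sg z * K mu z by apply: (mu_eq hJ hmbar).
have [Psi [e [b [e0 e1 b0 cPsi [P1 P2 P3]]]]] := odd_contraction Kle KD KZ Kcst d0 d1 c00 Hm
  muc mu0 muM sgm sgge sgle Z00 q0 q1 Hq mueq.
have C0 : 0 < Num.sqrt M + b by rewrite addr_gt0// sqrtr_gt0.
exists (2 / e * (Num.sqrt M + b)); first by rewrite mulr_gt0// divr_gt0.
have PB z : Psi z <= (Num.sqrt M + b) * Num.sqrt M.
  by apply: le_trans (P2 z) _; rewrite ler_pM2l// ler_sqrt// ltW.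
move=> F A eta.
exact: (approx_poisson KD KZ (@Jstar_continuous _ _ hJ) (@Jstar_odd _ _ hJ) sgc sge e0 e1 mu0 P1 P2 PB P3).
Qed.
End InstantonPoisson.

(** * The Schur test *)

Lemma measurable_fun_inv_pos d (T : measurableType d) (R : realType) (D : set T) (f : T -> R) :
  measurable D -> measurable_fun D f -> (forall p, D p -> 0 < f p) ->
  measurable_fun D (fun p => (f p)^-1).
Proof.
move=> mD mf f0; pose I : set (measurableTypeR R) := `]0, +oo[%classic.
have mI : measurable_fun I (fun x : measurableTypeR R => (x : R)^-1).
  apply: open_continuous_measurable_fun; first exact: interval_open.
  by move=> x; rewrite inE /I/= in_itv/= andbT => x0; apply: cvgV; [rewrite gt_eqF|exact: cvg_id].
apply: (@measurable_comp _ _ _ _ _ _ I _ D f) => //; first exact: measurable_itv.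
by move=> _ [x Dx <-] /=; rewrite /I/= in_itv/= andbT f0.
Qed.

Section Schur.
Local Open Scope ereal_scope.
Context d (T : measurableType d) (R : realType) (m : {sigma_finite_measure set T -> \bar R}).
Variables (k : T * T -> R) (u w c : T -> R).
Hypotheses (mk : measurable_fun setT k) (k0 : forall x, (0 <= k x)%R)
  (ksym : forall x y, k (x, y) = k (y, x)).
Hypotheses (mu_ : measurable_fun setT u) (u0 : forall x, (0 <= u x)%R).
Hypotheses (mw : measurable_fun setT w) (w0 : forall x, (0 < w x)%R).
Hypotheses (mc : measurable_fun setT (fun x => (c x * u x ^+ 2)%R)).
Hypothesis sup_w : forall x, u x != 0%R ->
  \int[m]_y (k (x, y) * w y)%:E <= (c x * w x)%:E.

Let m1 (f : T -> R) : measurable_fun setT f -> measurable_fun setT (fun p : T * T => f p.1).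
Proof. by move=> mf; apply: (measurableT_comp mf); exact: measurable_fst. Qed.
Let m2 (f : T -> R) : measurable_fun setT f -> measurable_fun setT (fun p : T * T => f p.2).
Proof. by move=> mf; apply: (measurableT_comp mf); exact: measurable_snd. Qed.

Let A (p : T * T) : R := (k p * (w p.2 / w p.1 * u p.1 ^+ 2))%R.
Let B (p : T * T) : R := (k p * (w p.1 / w p.2 * u p.2 ^+ 2))%R.

Let winv (f : T * T -> R) : measurable_fun setT f -> (forall p, (0 < f p)%R) ->
  measurable_fun setT (fun p => (f p)^-1%R).
Proof. by move=> mf f0; exact: measurable_fun_inv_pos. Qed.

Let mA : measurable_fun setT A.
Proof.
apply: measurable_funM => //; apply: measurable_funM.
  apply: measurable_funM; first exact: m2.
  by apply: (@winv (fun p => w p.1)) => //; exact: m1.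
by apply: measurable_funX; exact: m1.
Qed.

Let mB : measurable_fun setT B.
Proof.
apply: measurable_funM => //; apply: measurable_funM.
  apply: measurable_funM; first exact: m1.
  by apply: (@winv (fun p => w p.2)) => //; exact: m2.
by apply: measurable_funX; exact: m2.
Qed.

Let A0 p : (0 <= A p)%R.
Proof. by rewrite /A mulr_ge0// mulr_ge0 ?sqr_ge0// divr_ge0// ltW. Qed.
Let B0 p : (0 <= B p)%R.
Proof. by rewrite /B mulr_ge0// mulr_ge0 ?sqr_ge0// divr_ge0// ltW. Qed.

Let EA : measurable_fun setT (EFin \o A). Proof. exact/measurable_EFinP. Qed.
Let EB : measurable_fun setT (EFin \o B). Proof. exact/measurable_EFinP. Qed.
Let eA0 p : 0 <= (EFin \o A) p. Proof. by rewrite lee_fin. Qed.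
Let eB0 p : 0 <= (EFin \o B) p. Proof. by rewrite lee_fin. Qed.

Let intA_slice x : \int[m]_y (A (x, y))%:E <= (c x * u x ^+ 2)%:E.
Proof.
have [ux0|ux0] := eqVneq (u x) 0%R.
  rewrite (eq_integral (cst 0)) ?integral0 => [|y _]; first by rewrite ux0 expr0n mulr0.
  by rewrite /A /= ux0 expr0n !mulr0.
have mkw : measurable_fun setT (fun y => (k (x, y) * w y)%:E).
  apply/measurable_EFinP; apply: measurable_funM => //.
  by apply: (measurableT_comp mk); exact: measurable_pair1.
have uw0 : (0 <= u x ^+ 2 / w x)%R by rewrite divr_ge0 ?sqr_ge0// ltW.
rewrite (eq_integral (fun y => (u x ^+ 2 / w x)%:E * (k (x, y) * w y)%:E)); last first.
  by move=> y _; rewrite /A /= -EFinM; congr EFin; ring.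
rewrite ge0_integralZl//=; last by move=> y _; rewrite lee_fin mulr_ge0// ltW.
apply: le_trans (lee_wpmul2l _ (sup_w ux0)) _; first by rewrite lee_fin.
rewrite -EFinM lee_fin (_ : u x ^+ 2 / w x * (c x * w x) = c x * u x ^+ 2)%R//.
by field; rewrite gt_eqF.
Qed.

Let c0 x : (0 <= c x * u x ^+ 2)%R.
Proof.
rewrite -lee_fin; apply: le_trans (intA_slice x); apply: integral_ge0 => y _.
exact: eA0.
Qed.

Let intA : \int[m \x m]_p (A p)%:E <= \int[m]_x (c x * u x ^+ 2)%:E.
Proof.
rewrite (fubini_tonelli1 (EFin \o A) EA eA0) /fubini_F; apply: ge0_le_integral => //.
- by move=> x _; apply: integral_ge0 => y _; exact: eA0.
- exact: (measurable_fun_fubini_tonelli_F (EFin \o A) EA eA0).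
- by apply/measurable_EFinP.
- by move=> x _; exact: intA_slice.
Qed.

Let intB : \int[m \x m]_p (B p)%:E <= \int[m]_x (c x * u x ^+ 2)%:E.
Proof.
rewrite (fubini_tonelli2 (EFin \o B) EB eB0) /fubini_G; apply: ge0_le_integral => //.
- by move=> y _; apply: integral_ge0 => x _; exact: eB0.
- exact: (measurable_fun_fubini_tonelli_G (EFin \o B) EB eB0).
- by apply/measurable_EFinP.
- move=> y _; apply: le_trans (intA_slice y); rewrite le_eqVlt; apply/orP; left; apply/eqP.
  by apply: eq_integral => x _; rewrite /A /B /= ksym.
Qed.

Lemma schur_test :
  \int[m \x m]_p (k p * (u p.1 * u p.2))%:E <= \int[m]_x (c x * u x ^+ 2)%:E.
Proof.
apply: (@le_trans _ _ (\int[m \x m]_p ((2^-1)%:E * ((A p)%:E + (B p)%:E)))).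
  apply: ge0_le_integral => //.
  - by move=> p _; rewrite lee_fin mulr_ge0// mulr_ge0.
  - by apply/measurable_EFinP; apply: measurable_funM => //; apply: measurable_funM; [exact: m1|exact: m2].
  - by apply: measurable_funeM; apply: emeasurable_funD.
  - move=> p _; rewrite -EFinD -EFinM lee_fin /A /B.
    have a0 := w0 p.1; have b0 := w0 p.2; set a := w p.1 in a0 *; set b := w p.2 in b0 *.
    set x := u p.1; set y := u p.2; rewrite -mulrDr [leRHS]mulrCA ler_wpM2l//.
    have ab : (0 < (2 * a * b)^-1)%R by rewrite invr_gt0 !mulr_gt0.
    rewrite -subr_ge0 (_ : _ - _ = (2 * a * b)^-1 * (b * x - a * y) ^+ 2)%R.
      by rewrite mulr_ge0 ?sqr_ge0// ltW.
    by field; rewrite !gt_eqF.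
rewrite ge0_integralZl//=; last 2 first.
- by apply: emeasurable_funD.
- by move=> p _; apply: adde_ge0; [exact: eA0|exact: eB0].
rewrite ge0_integralD//; [|by move=> p _; exact: eA0|by move=> p _; exact: eB0].
apply: le_trans (lee_wpmul2l _ (leeD intA intB)) _; first by rewrite lee_fin.
have I0 : 0 <= \int[m]_x (c x * u x ^+ 2)%:E by apply: integral_ge0 => x _; rewrite lee_fin.
case: (\int[m]_x (c x * u x ^+ 2)%:E) I0 => [r| |] // r0.
  by rewrite -EFinD -EFinM lee_fin; lra.
by rewrite leey.
Qed.

End Schur.

Section QuadraticForm.
Context d (T : measurableType d) (R : realType) (M : {sigma_finite_measure set T -> \bar R}%E).
Variables (k : T * T -> R) (Omega : set T) (si w : T -> R) (A B D : R).
Hypotheses (mk : measurable_fun setT k) (k0 : forall x, 0 <= k x)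
  (ksym : forall x y, k (x, y) = k (y, x)) (kB : forall p, k p <= B)
  (ki : forall x, M.-integrable setT (EFin \o (fun y => k (x, y)))).
Hypotheses (mOmega : measurable Omega) (msi : measurable_fun Omega si).
Hypotheses (A0 : 0 <= A) (si_ge0 : forall x, Omega x -> 0 <= si x)
  (si_le : forall x, Omega x -> si x <= A).
Hypotheses (mw : measurable_fun setT w) (w0 : forall x, 0 < w x).
Hypothesis super : forall x, Omega x ->
  (\int[M]_y (k (x, y) * w y)%:E <= ((si x + D) * w x)%:E)%E.

Variable v : T -> R.
Let vt : T -> R := v \_ Omega.
Hypotheses (mvt : measurable_fun setT vt)
  (ivt2 : M.-integrable setT (EFin \o (fun x => vt x ^+ 2))).

Let g : T -> R := (fun x => v x ^+ 2 * si x) \_ Omega.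
Let gE x : g x = vt x ^+ 2 * (si \_ Omega) x.
Proof.
by rewrite /g /vt !patchE; case: ifPn => // _; rewrite mulr0.
Qed.

Let msiO : measurable_fun setT ((si \_ Omega) : T -> R).
Proof. exact: (proj1 (measurable_restrictT _ mOmega) msi). Qed.

Let si_bound x : 0 <= (si \_ Omega) x <= A.
Proof.
rewrite patchE; case: ifPn => [|_]; last by rewrite lexx.
by rewrite inE => Ox; rewrite si_ge0// si_le.
Qed.

Let mg : measurable_fun setT g.
Proof.
rewrite (_ : g = fun x => vt x ^+ 2 * (si \_ Omega) x); last by apply/funext => x; rewrite gE.
by apply: measurable_funM; [exact: measurable_funX|exact: msiO].
Qed.

Let ig : M.-integrable setT (EFin \o g).
Proof.
have := integrableZl measurableT A ivt2.
apply: le_integrable => //; first by apply/measurable_EFinP; exact: mg.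
move=> x _ /=; rewrite lee_fin gE normrM ger0_norm ?sqr_ge0// [leRHS]ger0_norm.
  have /andP[s0 s1] := si_bound x.
  by rewrite mulrC ger0_norm// ler_wpM2r// sqr_ge0.
by rewrite mulr_ge0 ?sqr_ge0.
Qed.

Let c x := (si \_ Omega) x + D.

Let Ic : (\int[M]_x (c x * `|vt x| ^+ 2)%:E)%E =
  (\int[M]_x g x + D * \int[M]_x (vt x ^+ 2))%:E.
Proof.
have iz := integrableZl measurableT (D) ivt2.
have igc : M.-integrable setT (EFin \o (fun x => g x + D * vt x ^+ 2)).
  by have := integrableD measurableT ig iz.
rewrite -RintegralZl// -RintegralD// /Rintegral fineK; last exact: (integrable_fin_num measurableT igc).
apply: eq_integral => x _; congr EFin.
by rewrite real_normK ?num_real// gE /c; ring.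
Qed.

Let mc : measurable_fun setT (fun x => c x * `|vt x| ^+ 2).
Proof.
apply: measurable_funM.
  by apply: measurable_funD; [exact: msiO|].
by apply: measurable_funX; apply: measurableT_comp.
Qed.

Let kuu : (\int[M \x M]_p (k p * (`|vt p.1| * `|vt p.2|))%:E <=
  \int[M]_x (c x * `|vt x| ^+ 2)%:E)%E.
Proof.
apply: (@schur_test _ _ _ M k (fun x => `|vt x|) w c) => //.
- by apply: measurableT_comp.
- move=> x; rewrite normr_eq0 => vx0; have Ox : Omega x.
    by move: vx0; rewrite /vt patchE; case: ifPn => [|_]; rewrite ?inE// eqxx.
  by rewrite /c patchE mem_set//; exact: super.
Qed.

Let f (p : T * T) : R := k p * (vt p.1 * vt p.2).

Let mf : measurable_fun setT f.
Proof.
apply: measurable_funM => //; apply: measurable_funM.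
  by apply: (measurableT_comp mvt); exact: measurable_fst.
by apply: (measurableT_comp mvt); exact: measurable_snd.
Qed.

Let norm_f p : `|f p| = k p * (`|vt p.1| * `|vt p.2|).
Proof. by rewrite /f !normrM ger0_norm. Qed.

Let if_ : (M \x M)%E.-integrable setT (EFin \o f).
Proof.
apply/integrableP; split; first exact/measurable_EFinP.
apply: (@le_lt_trans _ _ (\int[M \x M]_p (k p * (`|vt p.1| * `|vt p.2|))%:E)%E).
  by rewrite le_eqVlt; apply/orP; left; apply/eqP; apply: eq_integral => p _ /=; rewrite norm_f.
by apply: le_lt_trans kuu _; rewrite Ic ltry.
Qed.

Let Fr x : R := vt x * \int[M]_(y in Omega) (k (x, y) * v y).

Let kv_int x : M.-integrable setT (EFin \o (fun y => k (x, y) * vt y)).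
Proof.
have ivB := integrableD measurableT (ki x) (integrableZl measurableT B ivt2).
apply: le_integrable ivB => //.
  apply/measurable_EFinP; apply: measurable_funM => //.
  by apply: (measurableT_comp mk); exact: measurable_pair1.
move=> y _ /=; rewrite lee_fin normrM (ger0_norm (k0 _)).
apply: le_trans (ler_norm _).
have k0' := k0 (x, y); have kB' := kB (x, y).
have v2 : `|vt y| <= 1 + vt y ^+ 2.
  rewrite -(real_normK (num_real (vt y))).
  have := sqr_ge0 (`|vt y| - 1); have := sqr_ge0 (vt y); nra.
have : k (x, y) * `|vt y| <= k (x, y) * (1 + vt y ^+ 2) by rewrite ler_wpM2l.
have : k (x, y) * vt y ^+ 2 <= B * vt y ^+ 2 by rewrite ler_wpM2r// sqr_ge0.
lra.
Qed.

Let FE x : fubini_F M (EFin \o f) x = (Fr x)%:E.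
Proof.
rewrite /fubini_F /Fr.
have -> : \int[M]_(y in Omega) (k (x, y) * v y) =
    \int[M]_y (k (x, y) * vt y).
  rewrite Rintegral_mkcond; apply: eq_Rintegral => y _.
  by rewrite /vt !patchE; case: ifPn => // _; rewrite mulr0.
rewrite -RintegralZl; [|exact: measurableT|exact: (kv_int x)].
rewrite /Rintegral fineK.
  by apply: eq_integral => y _; rewrite /f /=; congr EFin; ring.
have := integrableZl measurableT (vt x) (kv_int x).
exact: integrable_fin_num.
Qed.

(** The function [v] is arbitrary outside [Omega]; everything is transported to
its extension by zero, and [kB], [ki] make the inner integral finite pointwise. *)
Lemma quadratic_form_bound :
  - D * \int[M]_(x in Omega) (v x ^+ 2) <=
  \int[M]_(x in Omega) ((v x * si x - \int[M]_(y in Omega) (k (x, y) * v y)) * v x).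
Proof.
have iF : M.-integrable setT (EFin \o Fr).
  have FFE : fubini_F M (EFin \o f) = EFin \o Fr by apply/funext => x; exact: FE.
  by rewrite -FFE; exact: (integrable_fubini_F if_).
have intF : \int[M]_x Fr x = fine (\int[M \x M]_p (f p)%:E)%E.
  rewrite -(integral12_prod_meas1 if_); congr fine.
  by apply: eq_integral => x _; rewrite FE.
have Fle : \int[M]_x Fr x <= \int[M]_x g x + D * \int[M]_x (vt x ^+ 2).
  rewrite intF -lee_fin fineK; last exact: (integrable_fin_num measurableT if_).
  rewrite -Ic; apply: le_trans kuu; apply: le_trans (lee_abs _) _.
  apply: le_trans (le_abse_integral _ _ _) _ => //; first exact/measurable_EFinP.
  by under eq_integral do rewrite /= norm_f.
have -> : \int[M]_(x in Omega) (v x ^+ 2) = \int[M]_x (vt x ^+ 2).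
  rewrite Rintegral_mkcond; apply: eq_Rintegral => x _.
  by rewrite /vt !patchE; case: ifPn => // _; rewrite expr0n.
have -> : \int[M]_(x in Omega) ((v x * si x - \int[M]_(y in Omega) (k (x, y) * v y)) * v x) =
    \int[M]_x (g x - Fr x).
  rewrite Rintegral_mkcond; apply: eq_Rintegral => x _.
  rewrite /g /Fr /vt !patchE; case: ifPn => // _; last by rewrite mul0r subr0.
  by ring.
rewrite RintegralB//; lra.
Qed.

End QuadraticForm.

(** * Local geometry of the curve *)

Section Euclid.
Context {R : realType}.
Implicit Types (x y z : R * R) (A : set (R * R)).

Lemma dotpDl x y z : dotp (x + y) z = dotp x z + dotp y z.
Proof. by rewrite /dotp /=; ring. Qed.
Lemma dotpZl (a : R) x y : dotp (a *: x) y = a * dotp x y.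
Proof. by rewrite /dotp /= /GRing.scale/=; ring. Qed.
Lemma dotpC x y : dotp x y = dotp y x.
Proof. by rewrite /dotp; ring. Qed.
Lemma dotpNl x y : dotp (- x) y = - dotp x y.
Proof. by rewrite /dotp /=; ring. Qed.

Lemma dotp_ge0 x : 0 <= dotp x x.
Proof. by rewrite /dotp addr_ge0// -expr2 sqr_ge0. Qed.

Lemma enorm_ge0 x : 0 <= enorm x. Proof. exact: sqrtr_ge0. Qed.

Lemma enorm_sqr x : enorm x ^+ 2 = dotp x x.
Proof. by rewrite sqr_sqrtr// dotp_ge0. Qed.

Lemma enorm_unit x : enorm x = 1 -> dotp x x = 1.
Proof. by move=> h; rewrite -enorm_sqr h expr1n. Qed.

Lemma le_enorm x (a : R) : 0 <= a -> dotp x x <= a ^+ 2 -> enorm x <= a.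
Proof. by move=> a0; rewrite -enorm_sqr ler_pXn2r// nnegrE// enorm_ge0. Qed.

Lemma CauchySchwarz x y : `|dotp x y| <= enorm x * enorm y.
Proof.
have h : 0 <= enorm x * enorm y by rewrite mulr_ge0// enorm_ge0.
rewrite -(@ler_pXn2r _ 2)// ?nnegrE// real_normK ?num_real// exprMn !enorm_sqr.
rewrite -subr_ge0 (_ : _ - _ = (x.1 * y.2 - x.2 * y.1) ^+ 2) ?sqr_ge0//.
by rewrite /dotp; ring.
Qed.

Lemma dotp_unit_le x y : enorm y = 1 -> `|dotp x y| <= enorm x.
Proof. by move=> y1; have := CauchySchwarz x y; rewrite y1 mulr1. Qed.

Lemma ler_enormD x y : enorm (x + y) <= enorm x + enorm y.
Proof.
apply: le_enorm; first by rewrite addr_ge0// enorm_ge0.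
rewrite sqrrD !enorm_sqr.
have -> : dotp (x + y) (x + y) = dotp x x + dotp x y *+ 2 + dotp y y by rewrite /dotp /=; ring.
rewrite lerD2r lerD2l ler_wMn2r//; have := CauchySchwarz x y.
exact: le_trans (ler_norm _).
Qed.

Lemma enormN x : enorm (- x) = enorm x.
Proof. by rewrite /enorm; congr Num.sqrt; rewrite /dotp /=; ring. Qed.

Lemma enormB x y : enorm (x - y) = enorm (y - x).
Proof. by rewrite -enormN opprB. Qed.

Lemma abs_le_enorm1 x : `|x.1| <= enorm x.
Proof.
rewrite -(@ler_pXn2r _ 2)// ?nnegrE ?enorm_ge0// real_normK ?num_real// enorm_sqr.
by rewrite /dotp -!expr2 lerDl sqr_ge0.
Qed.

Lemma abs_le_enorm2 x : `|x.2| <= enorm x.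
Proof.
rewrite -(@ler_pXn2r _ 2)// ?nnegrE ?enorm_ge0// real_normK ?num_real// enorm_sqr.
by rewrite /dotp -!expr2 lerDr sqr_ge0.
Qed.

Let edist_lb A x : has_lbound [set enorm (x - p) | p in A].
Proof. by exists 0 => _ [p _ <-]; exact: enorm_ge0. Qed.

Lemma edist_set_le A x p : A p -> edist_set A x <= enorm (x - p).
Proof. by move=> Ap; apply: ge_inf => //; exists p. Qed.

Lemma edist_set_ge0 A x : A !=set0 -> 0 <= edist_set A x.
Proof.
move=> [p Ap]; apply: lb_le_inf; first by exists (enorm (x - p)); exists p.
by move=> _ [q _ <-]; exact: enorm_ge0.
Qed.

Lemma edist_set_triangle A x y : A !=set0 -> edist_set A y <= edist_set A x + enorm (y - x).
Proof.
move=> [p Ap]; rewrite -lerBlDr; apply: lb_le_inf; first by exists (enorm (x - p)); exists p.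
move=> _ [q Aq <-]; rewrite lerBlDr; apply: le_trans (edist_set_le _ Aq) _.
by have -> : y - q = (x - q) + (y - x); [rewrite [RHS]addrC addrA subrK|exact: ler_enormD].
Qed.
End Euclid.

Section Periodic.
Context {R : realType}.

Lemma periodic_int (T : Type) (f : R -> T) (L : R) : (forall s, f (s + L) = f s) ->
  forall (n : int) s, f (s + n%:~R * L) = f s.
Proof.
move=> fL; have nat_case (n : nat) s : f (s + n%:R * L) = f s.
  elim: n s => [|n IH] s; first by rewrite mul0r addr0.
  by rewrite -natr1 mulrDl mul1r addrA fL IH.
case=> n s; first exact: nat_case.
have E : s = (s + (Negz n)%:~R * L) + n.+1%:R * L.
  by rewrite NegzE mulrNz mulNr subrK.
by rewrite [in RHS]E nat_case.
Qed.

Lemma reduce_mod (L s : R) : 0 < L -> exists n : int, 0 <= s + n%:~R * L < L.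
Proof.
move=> L0; exists (- Num.floor (s / L)).
have /andP[h1 h2] := floor_itv (s / L).
move: h1 h2; rewrite ler_pdivlMr// ltr_pdivrMr// intrD mulrDl mul1r => h1 h2.
by rewrite mulrNz mulNr; apply/andP; split; lra.
Qed.

Lemma periodic_bounded (f : R -> R) (L : R) : 0 < L -> (forall s, f (s + L) = f s) ->
  continuous f -> exists B : R, forall s, `|f s| <= B.
Proof.
move=> L0 fL cf; have [B HB] := continuous_segment_bounded L cf.
exists B => s; have [n /andP[h1 h2]] := reduce_mod s L0.
by rewrite -(periodic_int fL n); apply: HB; rewrite ger0_norm// ltW.
Qed.

Lemma derive1_periodic (V : normedModType R) (f : R -> V) (L : R) :
  (forall s, f (s + L) = f s) -> forall s, derive1 f (s + L) = derive1 f s.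
Proof.
move=> fL s; rewrite !derive1E /derive fL.
have -> // : (fun h : R => h^-1 *: (f (h *: (1 : R) + (s + L)) - f s)) =
  (fun h : R => h^-1 *: (f (h *: (1 : R) + s) - f s)).
by apply/funext => h; rewrite addrA fL.
Qed.

Lemma derive1n_periodic (V : normedModType R) (f : R -> V) (L : R) :
  (forall s, f (s + L) = f s) -> forall n s, derive1n n f (s + L) = derive1n n f s.
Proof.
move=> fL; elim=> [|n IH] s; first exact: fL.
exact: (derive1_periodic IH).
Qed.
End Periodic.

Section PlaneCurve.
Context {R : realType}.

Lemma is_derive_fst (f : R -> R * R) (s : R) : derivable f s 1 ->
  is_derive s 1 (fun t => (f t).1) (derive1 f s).1.
Proof.
move=> df; have cv : (fun h : R => h^-1 *: ((f (h *: (1 : R) + s)).1 - (f s).1)) h @[h --> 0^']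
    --> (derive1 f s).1.
  rewrite derive1E; apply: (@cvg_comp _ _ _ (fun h : R => h^-1 *: (f (h *: (1 : R) + s) - f s)) fst).
    exact: df.
  exact: cvg_fst.
split; first by apply/cvg_ex; exists (derive1 f s).1; exact: cv.
exact: cvg_lim cv.
Qed.

Lemma is_derive_snd (f : R -> R * R) (s : R) : derivable f s 1 ->
  is_derive s 1 (fun t => (f t).2) (derive1 f s).2.
Proof.
move=> df; have cv : (fun h : R => h^-1 *: ((f (h *: (1 : R) + s)).2 - (f s).2)) h @[h --> 0^']
    --> (derive1 f s).2.
  rewrite derive1E; apply: (@cvg_comp _ _ _ (fun h : R => h^-1 *: (f (h *: (1 : R) + s) - f s)) snd).
    exact: df.
  exact: cvg_snd.
split; first by apply/cvg_ex; exists (derive1 f s).2; exact: cv.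
exact: cvg_lim cv.
Qed.

Lemma is_derive_dotp (f g : R -> R * R) (s : R) : derivable f s 1 -> derivable g s 1 ->
  is_derive s 1 (fun t => dotp (f t) (g t)) (dotp (derive1 f s) (g s) + dotp (f s) (derive1 g s)).
Proof.
move=> df dg.
refine (isd_eq (isdD (isdM (is_derive_fst df) (is_derive_fst dg))
  (isdM (is_derive_snd df) (is_derive_snd dg))) _).
by rewrite /dotp; move: (derive1 f s) (derive1 g s) (f s) (g s) => [? ?] [? ?] [? ?] [? ?] /=; ring.
Qed.

Lemma is_derive_dotp_cst (f : R -> R * R) (s : R) (a : R * R) : derivable f s 1 ->
  is_derive s 1 (fun t => dotp (f t) a) (dotp (derive1 f s) a).
Proof.
move=> df.
refine (isd_eq (isdD (isdM (is_derive_fst df) (isd_cst s a.1))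
  (isdM (is_derive_snd df) (isd_cst s a.2))) _).
by rewrite /dotp; move: (derive1 f s) (f s) => [? ?] [? ?] /=; ring.
Qed.
End PlaneCurve.

(** The numbers [a1 .. a4] are the Taylor remainders of [frame_Taylor], and the two
expressions bounded by [e] are the components of the displacement of the normal
map.  Since [|k r'| <= 1 / 2], the tangential component controls [h] first, and
then everything else. *)
Lemma frame_algebra (R : realType) (B d0 : R) : 0 < B -> 0 < d0 -> exists2 C : R, 0 < C &
  forall r r' k h e a1 a2 a3 a4 : R, `|r| <= d0 -> `|r'| <= d0 -> `|k| <= (2 * d0)^-1 ->
  `|h| <= 1 -> B * (1 + d0) * `|h| <= 4^-1 ->
  `|a1| <= B * h ^+ 2 -> `|a2| <= B * `|h| ^+ 3 -> `|a3| <= B * h ^+ 2 -> `|a4| <= B * `|h| ^+ 3 ->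
  0 <= e -> `|(1 - k * r') * h + a1 + r' * a3| <= e ->
  `|k / 2 * h ^+ 2 + a2 + r' * (1 - k ^+ 2 / 2 * h ^+ 2 + a4) - r| <= e ->
  [/\ `|h| <= C * e, `|r' - r| <= C * e,
      `|(1 - k * r') * h + a1 + r' * a3 - (1 - k * r) * h| <= C * e ^+ 2 &
      `|k / 2 * h ^+ 2 + a2 + r' * (1 - k ^+ 2 / 2 * h ^+ 2 + a4) - r - (r' - r)
        - k / 2 * (1 - k * r) * h ^+ 2| <= C * e ^+ 3].
Proof.
move=> B0 d00; pose kk := (2 * d0)^-1; have kk0 : 0 < kk by rewrite invr_gt0 mulr_gt0.
pose b := B * (1 + d0); have b0 : 0 < b by rewrite mulr_gt0// addr_gt0.
pose C1 := 1 + 4 * (kk / 2 + d0 * kk ^+ 2 / 2 + b).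
have C10 : 1 <= C1.
  have : 0 <= d0 * kk ^+ 2 / 2 by rewrite divr_ge0// mulr_ge0 ?sqr_ge0// ltW.
  by rewrite /C1; lra.
pose C := 4 + C1 + (kk * C1 * 4 + b * 16) + (b * 64 + kk ^+ 2 / 2 * C1 * 16).
have p1 : 0 <= kk * C1 * 4 by rewrite !mulr_ge0// ?ltW//; lra.
have p2 : 0 <= kk ^+ 2 / 2 * C1 * 16.
  by rewrite mulr_ge0// mulr_ge0//; [rewrite divr_ge0// sqr_ge0|lra].
exists C; first by rewrite /C; clear -C10 p1 p2 b0; lra.
move=> r r' k h e a1 a2 a3 a4 r1 r1' kB h1 hb T1 T2 T3 T4 e0 et en.
have kr' : `|k * r'| <= 2^-1.
  rewrite normrM (_ : 2^-1 = kk * d0); first by rewrite ler_pM.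
  by rewrite /kk; field; rewrite gt_eqF.
have hh : `|h| * `|h| = h ^+ 2 by rewrite -expr2 real_normK ?num_real.
have ra3 : `|r' * a3| <= d0 * (B * h ^+ 2) by rewrite normrM ler_pM.
have ra4 : `|r' * a4| <= d0 * (B * `|h| ^+ 3) by rewrite normrM ler_pM.
have s13 : `|a1 + r' * a3| <= b * h ^+ 2.
  by rewrite (le_trans (ler_normD _ _))// (le_trans (lerD T1 ra3))// /b; lra.
have s24 : `|a2 + r' * a4| <= b * `|h| ^+ 3.
  by rewrite (le_trans (ler_normD _ _))// (le_trans (lerD T2 ra4))// /b; lra.
have h4 : `|h| <= 4 * e.
  have L1 : 2^-1 * `|h| <= `|(1 - k * r') * h|.
    rewrite normrM ler_wpM2r//; have := lerB_normD 1 (- (k * r')).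
    by rewrite normrN normr1; lra.
  have L2 : `|(1 - k * r') * h| <= e + b * h ^+ 2.
    have := lerB_normD ((1 - k * r') * h) (a1 + r' * a3); rewrite addrA; lra.
  have L3 : b * h ^+ 2 <= 4^-1 * `|h|.
    by rewrite -hh mulrA ler_wpM2r.
  lra.
have h2e : h ^+ 2 <= 16 * e ^+ 2.
  rewrite -hh (_ : 16 * e ^+ 2 = (4 * e) * (4 * e)); last by ring.
  by rewrite ler_pM.
have h3e : `|h| ^+ 3 <= 64 * e ^+ 3.
  rewrite (_ : 64 * e ^+ 3 = (4 * e) ^+ 3); last by ring.
  by rewrite ler_pXn2r// nnegrE// mulr_ge0.
have h2h : h ^+ 2 <= 4 * e.
  by apply: le_trans h4; rewrite -hh ler_piMr.
have h3h : `|h| ^+ 3 <= 4 * e.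
  by apply: le_trans h2h; rewrite exprS real_normK ?num_real// ler_piMl// sqr_ge0.
have k2 : k ^+ 2 <= kk ^+ 2 by rewrite -(real_normK (num_real k)) ler_pXn2r// nnegrE// ltW.
have h20 : 0 <= h ^+ 2 by exact: sqr_ge0.
have rr : `|r' - r| <= C1 * e.
  have -> : r' - r = (k / 2 * h ^+ 2 + a2 + r' * (1 - k ^+ 2 / 2 * h ^+ 2 + a4) - r) - k / 2 * h ^+ 2
     + r' * (k ^+ 2 / 2 * h ^+ 2) - (a2 + r' * a4) by ring.
  rewrite (le_trans (ler_normB _ _))// (le_trans (lerD (ler_normD _ _) (lexx _)))//.
  rewrite (le_trans (lerD (lerD (ler_normB _ _) (lexx _)) (lexx _)))//.
  have q1 : `|k / 2 * h ^+ 2| <= kk / 2 * (4 * e).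
    rewrite normrM (ger0_norm h20) normrM [`|2^-1|]ger0_norm//.
    apply: ler_pM => //.
    by rewrite ler_pM2r// invr_gt0.
  have q2 : `|r' * (k ^+ 2 / 2 * h ^+ 2)| <= d0 * (kk ^+ 2 / 2 * (4 * e)).
    have k20 : 0 <= k ^+ 2 / 2 by rewrite divr_ge0// sqr_ge0.
    rewrite normrM; apply: ler_pM => //; rewrite normrM (ger0_norm h20) (ger0_norm k20).
    by apply: ler_pM => //; rewrite ler_pM2r// invr_gt0.
  have q3 : b * `|h| ^+ 3 <= b * (4 * e) by rewrite ler_pM2l.
  by move: en s24; rewrite /C1; lra.
have kn : `|k| <= kk by [].
have e20 : 0 <= e ^+ 2 by exact: sqr_ge0.
have e30 : 0 <= e ^+ 3 by rewrite exprn_ge0.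
split.
- by apply: le_trans h4 _; rewrite ler_wpM2r// /C; lra.
- by apply: le_trans rr _; rewrite ler_wpM2r// /C; lra.
- have -> : (1 - k * r') * h + a1 + r' * a3 - (1 - k * r) * h = - (k * (r' - r) * h) + (a1 + r' * a3) by ring.
  rewrite (le_trans (ler_normD _ _))// normrN !normrM.
  have q1 : `|k| * `|r' - r| * `|h| <= kk * (C1 * e) * (4 * e).
    by apply: ler_pM => //; apply: ler_pM.
  have q2 : b * h ^+ 2 <= b * (16 * e ^+ 2) by rewrite ler_pM2l.
  have : (kk * C1 * 4 + b * 16) * e ^+ 2 <= C * e ^+ 2.
    by rewrite ler_wpM2r// /C; lra.
  move: q1; rewrite (_ : kk * (C1 * e) * (4 * e) = kk * C1 * 4 * e ^+ 2); last by ring.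
  by move: s13; lra.
- rewrite (_ : _ - _ - _ = (a2 + r' * a4) - (k ^+ 2 / 2 * (r' - r) * h ^+ 2)); last by field.
  rewrite (le_trans (ler_normB _ _))//.
  have k20 : 0 <= k ^+ 2 / 2 by rewrite divr_ge0// sqr_ge0.
  have q1 : `|k ^+ 2 / 2 * (r' - r) * h ^+ 2| <= kk ^+ 2 / 2 * (C1 * e) * (16 * e ^+ 2).
    rewrite normrM (ger0_norm h20) normrM (ger0_norm k20).
    apply: ler_pM => //; first by rewrite mulr_ge0.
    by apply: ler_pM => //; rewrite ler_pM2r// invr_gt0.
  have q2 : b * `|h| ^+ 3 <= b * (64 * e ^+ 3) by rewrite ler_pM2l.
  have : (b * 64 + kk ^+ 2 / 2 * C1 * 16) * e ^+ 3 <= C * e ^+ 3.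
    by rewrite ler_wpM2r// /C; lra.
  move: q1; rewrite (_ : kk ^+ 2 / 2 * (C1 * e) * (16 * e ^+ 2) = kk ^+ 2 / 2 * C1 * 16 * e ^+ 3); last by ring.
  by move: s24; lra.
Qed.

Section Frame.
Context {R : realType}.
Variables (L d0 : R) (gamma nu : R -> R * R) (kap : R -> R).
Hypotheses (hc : arclength_curve L gamma) (hn : normal_field L gamma nu kap).
Hypotheses (d00 : 0 < d0) (hk : forall s, `|kap s| * d0 <= 2^-1).

Let L0 : 0 < L := curve_length hc.
Let G j := derive1n j gamma.
Let V j := derive1n j nu.

Let dG j s : (j < 5)%N -> derivable (G j) s 1.
Proof. by move=> j5; have [H _] := curve_C5 hc; exact: H. Qed.
Let dV j s : (j < 4)%N -> derivable (V j) s 1.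
Proof. by move=> j4; have [H _] := normal_C4 hn; exact: H. Qed.
Let G_per j s : G j (s + L) = G j s.
Proof. exact: derive1n_periodic (curve_periodic hc) j s. Qed.
Let V_per j s : V j (s + L) = V j s.
Proof. exact: derive1n_periodic (normal_periodic hn) j s. Qed.

Definition tau (s : R) : R * R := derive1 gamma s.

Lemma tau_unit s : dotp (tau s) (tau s) = 1.
Proof. exact/enorm_unit/(curve_unit hc). Qed.
Lemma nu_unit s : dotp (nu s) (nu s) = 1.
Proof. exact/enorm_unit/(normal_unit hn). Qed.
Lemma nu_tau s : dotp (nu s) (tau s) = 0.
Proof. exact: (normal_orth hn). Qed.

Let V1 s : V 1 s = - kap s *: tau s := normal_curvature hn s.

Lemma dnu_tau s : dotp (V 1 s) (tau s) = - kap s.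
Proof. by rewrite V1 dotpZl tau_unit mulr1. Qed.
Lemma dnu_nu s : dotp (V 1 s) (nu s) = 0.
Proof. by rewrite V1 dotpZl dotpC nu_tau mulr0. Qed.

(** Differentiate [nu . gamma' = 0]. *)
Lemma d2gamma_nu s : dotp (G 2 s) (nu s) = kap s.
Proof.
have H := is_derive_dotp (@dV 0 s isT) (@dG 1 s isT).
have E : (fun t => dotp (V 0 t) (G 1 t)) = fun=> 0 by apply/funext => t; exact: nu_tau.
rewrite E in H; have [_ H1] := H; have [_ H2] := isd_cst s (0 : R).
have {}H1 : 0 = dotp (V 1 s) (tau s) + dotp (nu s) (G 2 s) by rewrite -[LHS]H2 H1.
by move: H1; rewrite dnu_tau dotpC => /esym/eqP; rewrite addrC subr_eq0 => /eqP.
Qed.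

(** Differentiate [nu' . nu = 0]. *)
Lemma d2nu_nu s : dotp (V 2 s) (nu s) = - kap s ^+ 2.
Proof.
have H := is_derive_dotp (@dV 1 s isT) (@dV 0 s isT).
have E : (fun t => dotp (V 1 t) (V 0 t)) = fun=> 0 by apply/funext => t; exact: dnu_nu.
rewrite E in H; have [_ H1] := H; have [_ H2] := isd_cst s (0 : R).
have {H1}/esym/eqP : 0 = dotp (V 2 s) (nu s) + dotp (V 1 s) (V 1 s) by rewrite -[LHS]H2 H1.
rewrite addr_eq0 => /eqP ->.
by rewrite !V1 dotpZl dotpC dotpZl tau_unit; ring.
Qed.

Let dotp_bounded (f : R -> R * R) : (forall s, f (s + L) = f s) -> (forall s, derivable f s 1) ->
  exists2 B : R, 0 <= B & forall s a, enorm a = 1 -> `|dotp (f s) a| <= B.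
Proof.
move=> fL df.
have [B1 HB1] := periodic_bounded L0 (fun s => congr1 fst (fL s))
  (is_derive_continuous (fun t => is_derive_fst (df t))).
have [B2 HB2] := periodic_bounded L0 (fun s => congr1 snd (fL s))
  (is_derive_continuous (fun t => is_derive_snd (df t))).
have B10 : 0 <= B1 by apply: le_trans (HB1 0).
have B20 : 0 <= B2 by apply: le_trans (HB2 0).
exists (B1 + B2); first exact: addr_ge0.
move=> s a a1; rewrite /dotp (le_trans (ler_normD _ _))// !normrM lerD//.
  by rewrite -[leRHS]mulr1 ler_pM// -a1 abs_le_enorm1.
by rewrite -[leRHS]mulr1 ler_pM// -a1 abs_le_enorm2.
Qed.

(** The expansions of the curve and of its normal in the moving frame, uniform in
the base point by periodicity. *)
Lemma frame_Taylor : exists2 B : R, 0 < B & forall s s', let h := s' - s in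
  [/\ `|dotp (gamma s' - gamma s) (tau s) - h| <= B * h ^+ 2,
      `|dotp (gamma s' - gamma s) (nu s) - kap s / 2 * h ^+ 2| <= B * `|h| ^+ 3,
      `|dotp (nu s') (tau s) + kap s * h| <= B * h ^+ 2 &
      `|dotp (nu s') (nu s) - 1 + kap s ^+ 2 / 2 * h ^+ 2| <= B * `|h| ^+ 3].
Proof.
have [B2 B20 H2] := dotp_bounded (G_per 2) (fun s => @dG 2 s isT).
have [B3 B30 H3] := dotp_bounded (G_per 3) (fun s => @dG 3 s isT).
have [b2 b20 h2] := dotp_bounded (V_per 2) (fun s => @dV 2 s isT).
have [b3 b30 h3] := dotp_bounded (V_per 3) (fun s => @dV 3 s isT).
pose B := B2 + B3 + b2 + b3 + 1.
exists B; first by rewrite /B; lra.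
move=> s s' h.
have tu : enorm (tau s) = 1 by exact: (curve_unit hc).
have nuu : enorm (nu s) = 1 by exact: (normal_unit hn).
have g0 a t := is_derive_dotp_cst a (@dG 0 t isT).
have g1 a t := is_derive_dotp_cst a (@dG 1 t isT).
have g2 a t := is_derive_dotp_cst a (@dG 2 t isT).
have v0 a t := is_derive_dotp_cst a (@dV 0 t isT).
have v1 a t := is_derive_dotp_cst a (@dV 1 t isT).
have v2 a t := is_derive_dotp_cst a (@dV 2 t isT).
have hh : `|h| ^+ 2 = h ^+ 2 by rewrite real_normK ?num_real.
have h20 : 0 <= h ^+ 2 by exact: sqr_ge0.
have h30 : 0 <= `|h| ^+ 3 by rewrite exprn_ge0.
split.
- have := Taylor2 (g0 (tau s)) (g1 (tau s)) (fun t (_ : `|t - s| <= `|s' - s|) => H2 t _ tu).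
  rewrite -/(tau s) tau_unit mul1r -/h hh dotpDl dotpNl => T; apply: le_trans T _.
  by rewrite ler_wpM2r// /B; lra.
- have T : `|dotp (gamma s') (nu s) - dotp (gamma s) (nu s) - dotp (tau s) (nu s) * h
      - dotp (G 2 s) (nu s) / 2 * h ^+ 2| <= B3 * `|h| ^+ 3.
    exact: (Taylor3 (g0 (nu s)) (g1 (nu s)) (g2 (nu s)) (fun t (_ : `|t - s| <= `|s' - s|) => H3 t _ nuu)).
  rewrite [dotp (tau s) _]dotpC nu_tau mul0r subr0 d2gamma_nu in T.
  rewrite dotpDl dotpNl; apply: le_trans T _.
  by rewrite ler_wpM2r// /B; lra.
- have := Taylor2 (v0 (tau s)) (v1 (tau s)) (fun t (_ : `|t - s| <= `|s' - s|) => h2 t _ tu).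
  rewrite -/(V 1 s) dnu_tau -/h hh -[V 0 s]/(nu s) nu_tau subr0 mulNr opprK => T; apply: le_trans T _.
  by rewrite ler_wpM2r// /B; lra.
- have T : `|dotp (nu s') (nu s) - dotp (nu s) (nu s) - dotp (V 1 s) (nu s) * h
      - dotp (V 2 s) (nu s) / 2 * h ^+ 2| <= b3 * `|h| ^+ 3.
    exact: (Taylor3 (v0 (nu s)) (v1 (nu s)) (v2 (nu s)) (fun t (_ : `|t - s| <= `|s' - s|) => h3 t _ nuu)).
  rewrite dnu_nu mul0r subr0 d2nu_nu nu_unit !mulNr opprK in T; apply: le_trans T _.
  by rewrite ler_wpM2r// /B; lra.
Qed.

Lemma kap_periodic s : kap (s + L) = kap s.
Proof.
have := dnu_tau (s + L); rewrite V_per /tau -[derive1 gamma (s + L)]/(G 1 (s + L)) G_per.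
by rewrite -[G 1 s]/(tau s) dnu_tau => /oppr_inj.
Qed.

Lemma kap_le s : `|kap s| <= (2 * d0)^-1.
Proof. by have := hk s; rewrite -ler_pdivlMr// invfM mulrC. Qed.

Lemma kap_Lipschitz : exists2 B : R, 0 < B & forall s s', `|kap s' - kap s| <= B * `|s' - s|.
Proof.
pose dk t := - (dotp (V 2 t) (G 1 t) + dotp (V 1 t) (G 2 t)).
have kE (t : R) : is_derive t 1 kap (dk t).
  rewrite (_ : kap = fun t => - dotp (V 1 t) (G 1 t)); last first.
    by apply/funext => u; rewrite -[G 1 u]/(tau u) dnu_tau opprK.
  exact: (isdN (is_derive_dotp (@dV 1 t isT) (@dG 1 t isT))).
have cdk : continuous dk.
  apply: (@is_derive_continuous _ _ (fun t => - ((dotp (V 3 t) (G 1 t) + dotp (V 2 t) (G 2 t)) +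
    (dotp (V 2 t) (G 2 t) + dotp (V 1 t) (G 3 t))))) => t.
  apply: isdN; apply: isdD.
    exact: (is_derive_dotp (@dV 2 t isT) (@dG 1 t isT)).
  exact: (is_derive_dotp (@dV 1 t isT) (@dG 2 t isT)).
have dkL s : dk (s + L) = dk s by rewrite /dk !V_per !G_per.
have [B HB] := periodic_bounded L0 dkL cdk.
have B0 : 0 <= B by apply: le_trans (HB 0).
exists (B + 1); first by lra.
move=> s s'; apply: le_trans (Lipschitz_of_derive kE (fun t _ => HB t)) _.
by rewrite ler_wpM2r//; lra.
Qed.

Lemma nu_Lipschitz : exists2 B : R, 0 < B & forall s s' a, enorm a = 1 ->
  `|dotp (nu s') a - dotp (nu s) a| <= B * `|s' - s|.
Proof.
have [B B0 HB] := dotp_bounded (V_per 1) (fun s => @dV 1 s isT).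
exists (B + 1); first by lra.
move=> s s' a a1; have v0 t := is_derive_dotp_cst a (@dV 0 t isT).
apply: le_trans (Lipschitz_of_derive v0 (fun t _ => HB t a a1)) _.
by rewrite ler_wpM2r//; lra.
Qed.

Notation N := (normal_map gamma nu).

(** Inverse function theorem for the normal map, with the second-order term of the
normal displacement; valid as long as the two parameters are close. *)
Lemma normal_map_local : exists dl C : R, [/\ 0 < dl, dl <= L / 4, 0 < C &
  forall s s' r r', `|r| <= d0 -> `|r'| <= d0 -> `|s' - s| <= dl ->
  let D := N s' r' - N s r in let h := s' - s in
  [/\ `|h| <= C * enorm D, `|r' - r| <= C * enorm D,
      `|dotp D (tau s) - (1 - kap s * r) * h| <= C * enorm D ^+ 2 &
      `|dotp D (nu s) - (r' - r) - kap s / 2 * (1 - kap s * r) * h ^+ 2| <= C * enorm D ^+ 3]].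
Proof.
have [B B0 HT] := frame_Taylor; have [C C0 HA] := frame_algebra B0 d00.
pose b := B * (1 + d0); have b0 : 0 < b by rewrite mulr_gt0//; have := d00; lra.
pose dl := Num.min (Num.min 1 (L / 4)) (4 * b)^-1.
have dl0 : 0 < dl by rewrite /dl !lt_min ltr01/= divr_gt0//= invr_gt0 mulr_gt0.
have dl1 : dl <= 1 by rewrite /dl !ge_min lexx.
have dlL : dl <= L / 4 by rewrite /dl !ge_min lexx !orbT.
have dlb : b * dl <= 4^-1.
  have : dl <= (4 * b)^-1 by rewrite /dl !ge_min lexx !orbT.
  by rewrite -(ler_pM2l b0) => /le_trans; apply; rewrite invfM mulrCA divff ?mulr1// gt_eqF.
exists dl, C; split => //.
move=> s s' r r' r1 r1' hs D h.
have [T1 T2 T3 T4] := HT s s'; rewrite -/h in T1 T2 T3 T4. rewrite -/h in hs.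
set a1 := dotp (gamma s' - gamma s) (tau s) - h in T1.
set a2 := dotp (gamma s' - gamma s) (nu s) - kap s / 2 * h ^+ 2 in T2.
set a3 := dotp (nu s') (tau s) + kap s * h in T3.
set a4 := dotp (nu s') (nu s) - 1 + kap s ^+ 2 / 2 * h ^+ 2 in T4.
have DE : D = (gamma s' - gamma s) + (r' *: nu s' + (- r) *: nu s).
  by rewrite /D /normal_map scaleNr opprD addrACA.
have Dt : dotp D (tau s) = (1 - kap s * r') * h + a1 + r' * a3.
  by rewrite DE /a1 /a3 !dotpDl !dotpZl nu_tau; ring.
have Dn : dotp D (nu s) = kap s / 2 * h ^+ 2 + a2 + r' * (1 - kap s ^+ 2 / 2 * h ^+ 2 + a4) - r.
  by rewrite DE /a2 /a4 !dotpDl !dotpZl nu_unit; ring.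
have et : `|dotp D (tau s)| <= enorm D by apply: dotp_unit_le; exact: (curve_unit hc).
have en : `|dotp D (nu s)| <= enorm D by apply: dotp_unit_le; exact: (normal_unit hn).
have kB := kap_le s.
rewrite Dt in et *; rewrite Dn in en *.
apply: (HA r r' (kap s) h (enorm D) a1 a2 a3 a4) => //; last exact: enorm_ge0.
- by apply: le_trans dl1.
- by apply: le_trans dlb; rewrite ler_pM2l.
Qed.

End Frame.

(** * Kernel averages along a bent profile *)

Section Pullback.
Context {R : realType}.
Notation cSq f := {within Sq, continuous f}.

Lemma cSq_dominated (f g : R * R -> R) (B : R) : cSq f ->
  (forall p q, Sq p -> Sq q -> `|g p - g q| <= B * `|f p - f q|) -> cSq g.
Proof.
move=> cf H; apply/subspace_continuousP => p Sp.
have cfp := (subspace_continuousP Sq f).1 cf p Sp.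
apply/cvgrPdist_le => e e0; have B0 : 0 < `|B| + 1 by rewrite ltr_wpDl.
have e1 : 0 < e / (`|B| + 1) by exact: divr_gt0.
have /cvgrPdist_le /(_ _ e1) H2 := cfp.
have {}H2 : \forall u \near nbhs p, Sq u -> `|f p - f u| <= e / (`|B| + 1) := H2.
suff : \forall u \near nbhs p, Sq u -> `|g p - g u| <= e by [].
near=> u => Su.
apply: le_trans (H _ _ Sp Su) _.
apply: (@le_trans _ _ ((`|B| + 1) * `|f p - f u|)).
  by rewrite ler_wpM2r// (le_trans (ler_norm _))// lerDl.
by rewrite -ler_pdivlMl// mulrC; move: Su; near: u; exact: H2.
Unshelve. all: by end_near. Qed.

Variables (J : R * R -> R) (hJ : interaction_kernel J).
Notation E := (Eav J).
Notation K := (Jstar J).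

(** With [Th' = Phi] the average
of [Phi(rho) d_x rho] is an integral of [Th(rho)] against the derivative of the
kernel, and [Th] is Lipschitz because [Phi] is bounded.  So the bound does not
involve the modulus of continuity of [Phi]; for correctors built from [h1],
whose derivative may be unbounded, this is essential. *)
Lemma Eav_pullback : exists2 C : R, 0 < C & forall (Phi : R -> R) (B e z : R) (rho th : R * R -> R),
  continuous Phi -> (forall t, `|Phi t| <= B) -> 0 <= e -> cSq rho -> cSq th ->
  (forall x y : R, `|x| <= 1 -> `|y| <= 1 -> is_derive x 1 (fun t => rho (t, y)) (th (x, y))) ->
  (forall x y, `|x| <= 1 -> `|y| <= 1 -> `|th (x, y) - 1| <= e) ->
  (forall x y, `|x| <= 1 -> `|y| <= 1 -> `|rho (x, y) - (z + x)| <= e) ->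
  `|E (fun p => Phi (rho p)) - K Phi z| <= C * B * e.
Proof.
have [M1 M10 HM1] := Eav1_bound hJ.
exists (M1 + 1); first by lra.
move=> Phi B e z rho th cPhi PhiB e0 crho cth drho hth hrho.
have B0 : 0 <= B by apply: le_trans (PhiB 0).
pose N := `|z| + 1 + e; have [Th dTh] := antiderivative_on (N + 1) cPhi.
have near_z (p : R * R) : Sq p -> `|z + p.1| <= N /\ `|rho p| <= N.
  case: p => x y /SqE[x1 y1] /=; have h := hrho x y x1 y1.
  have h1 : `|z + x| <= `|z| + 1 by rewrite (le_trans (ler_normD _ _))// lerD2l.
  split; first by rewrite /N; lra.
  rewrite (_ : rho (x, y) = (rho (x, y) - (z + x)) + (z + x)); last by rewrite subrK.
  by rewrite (le_trans (ler_normD _ _))// /N; lra.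
have ThL (a b : R) : `|a| <= N -> `|b| <= N -> `|Th b - Th a| <= B * `|b - a|.
  move=> a1 b1; rewrite ler_norml in a1; rewrite ler_norml in b1.
  apply: (@Lipschitz_of_derive_on _ Th Phi (- N) N) => // t tN.
  by apply: dTh; rewrite ltr_norml; move: tN => /andP[? ?]; apply/andP; split; lra.
have cz : cSq (fun p : R * R => z + p.1) by apply: within_contD; [exact: (@within_cont_cst R Sq z)|exact: cSq_fst].
have cTr : cSq (fun p => Th (rho p)).
  by apply: (cSq_dominated (B := B) crho) => p u /near_z[_ h1] /near_z[_ h2]; exact: ThL.
have cTz : cSq (fun p => Th (z + p.1)).
  by apply: (cSq_dominated (B := B) cz) => p u /near_z[h1 _] /near_z[h2 _]; exact: ThL.
have cPr : cSq (fun p => Phi (rho p)) by exact: within_cont_comp.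
have cPz : cSq (fun p => Phi (z + p.1)) by exact: within_cont_comp.
have P1 : E (fun p => Phi (rho p) * th p) = - Eav1 J (fun p => Th (rho p)).
  apply: (Eav_by_parts hJ) => //; first exact: within_contM.
  move=> x y x1 y1; apply: (isd_comp (f := Th)); last exact: drho.
  apply: dTh; have [_ h] := near_z (x, y) (proj2 (SqE x y) (conj x1 y1)).
  by apply: le_lt_trans h _; rewrite ltrDl.
have P2 : K Phi z = - Eav1 J (fun p => Th (z + p.1)).
  apply: (Eav_by_parts hJ) => // x y x1 y1 /=.
  have h : is_derive x 1 (fun t : R => z + t) 1.
    by refine (isd_eq (isdD (isd_cst x z) (isd_id x)) _); rewrite add0r.
  refine (isd_eq (isd_comp (f := Th) _ h) (mulr1 _)).
  apply: dTh; have [h1 _] := near_z (x, y) (proj2 (SqE x y) (conj x1 y1)).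
  by apply: le_lt_trans h1 _; rewrite ltrDl.
have S1 : `|E (fun p => Phi (rho p)) - E (fun p => Phi (rho p) * th p)| <= B * e.
  apply: (Eav_dist hJ) => //; first exact: within_contM.
  move=> [x y] /SqE[x1 y1]; rewrite -{1}[Phi _]mulr1 -mulrBr normrM.
  by apply: ler_pM => //; rewrite distrC; exact: hth.
have S2 : `|E (fun p => Phi (rho p) * th p) - K Phi z| <= M1 * (B * e).
  rewrite P1 P2 opprK addrC -(Eav1B hJ)//; apply: HM1.
    have -> : (fun p : R * R => Th (z + p.1) - Th (rho p)) = (fun p : R * R => Th (z + p.1) + (- 1) * Th (rho p)).
      by apply/funext => p; rewrite mulN1r.
    by apply: within_contD => //; apply: within_contM => //; exact: (@within_cont_cst R Sq (- 1)).
  move=> [x y] Sp; have [h1 h2] := near_z _ Sp; move: Sp => /SqE[x1 y1].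
  apply: le_trans (ThL _ _ h2 h1) _; rewrite ler_wpM2l// distrC; exact: hrho.
rewrite (_ : _ - K Phi z = (E (fun p => Phi (rho p)) - E (fun p => Phi (rho p) * th p)) +
  (E (fun p => Phi (rho p) * th p) - K Phi z)); last by rewrite addrA subrK.
rewrite (le_trans (ler_normD _ _))// mulrDl mul1r mulrDl addrC -mulrA lerD//.
Qed.

Lemma cSq_y2 (f : R * R -> R) : cSq f -> cSq (fun p : R * R => p.2 ^+ 2 * f p).
Proof.
move=> cf; apply: within_contM => //.
have -> : (fun p : R * R => p.2 ^+ 2) = (fun p : R * R => p.2 * p.2) by apply/funext => p; rewrite expr2.
by apply: within_contM; exact: cSq_snd.
Qed.

(** Expansion to first order in the curvature; the radial identity puts the linear
term in a form that contains no derivative of [F]. *)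
Lemma Eav_bend (F F1 F2 : R -> R) (M a e z : R) (rho : R * R -> R) :
  (forall t : R, is_derive t 1 F (F1 t)) -> (forall t : R, is_derive t 1 F1 (F2 t)) ->
  continuous F2 -> (forall t, `|F1 t| <= M) -> (forall t, `|F2 t| <= M) -> cSq rho ->
  (forall x y, `|x| <= 1 -> `|y| <= 1 -> `|rho (x, y) - (z + x - a * y ^+ 2)| <= e) ->
  `|E (fun p => F (rho p)) - (K F z - a * (K (fun t => t * F t) z - z * K F z))|
    <= M * (`|a| + e) ^+ 2 + M * e.
Proof.
move=> dF dF1 cF2 F1M F2M crho hrho.
have cF := is_derive_continuous dF; have cF1 := is_derive_continuous dF1.
have M0 : 0 <= M by apply: le_trans (F1M 0).
have cFr : cSq (fun p => F (rho p)) by exact: within_cont_comp.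
have cFz := cSq_shift z cF; have cF1z := cSq_shift z cF1.
have cxF : cSq (fun p : R * R => p.1 * F (z + p.1)) by apply: within_contM => //; exact: cSq_fst.
have HK : K (fun t => t * F t) z - z * K F z = E (fun p => p.2 ^+ 2 * F1 (z + p.1)).
  rewrite -(Eav_radial hJ _ dF dF1)// /Jstar -(EavZ hJ z cFz).
  have -> : E (fun p => (z + p.1) * F (z + p.1)) = E (fun p => z * F (z + p.1)) + E (fun p => p.1 * F (z + p.1)).
    rewrite -(EavD hJ)//; last by apply: within_contM => //; exact: (@within_cont_cst R Sq z).
    by apply: eq_Eav => p _; rewrite mulrDl.
  by rewrite addrAC subrr add0r.
have cy := cSq_y2 cF1z.
have -> : K F z - a * (K (fun t => t * F t) z - z * K F z) = E (fun p => F (z + p.1) - a * (p.2 ^+ 2 * F1 (z + p.1))).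
  rewrite HK (EavB hJ)//; last by apply: within_contM => //; exact: (@within_cont_cst R Sq a).
  by rewrite (EavZ hJ a cy).
apply: (Eav_dist hJ) => //.
  have -> : (fun p : R * R => F (z + p.1) - a * (p.2 ^+ 2 * F1 (z + p.1))) =
    (fun p => F (z + p.1) + (- a) * (p.2 ^+ 2 * F1 (z + p.1))) by apply/funext => p; rewrite mulNr.
  by apply: within_contD => //; apply: within_contM => //; exact: (@within_cont_cst R Sq (- a)).
move=> [x y] /SqE[x1 y1] /=; have h := hrho x y x1 y1.
have T := @Taylor2 _ F F1 F2 M (z + x) (rho (x, y)) dF dF1 (fun t _ => F2M t).
have y2 : `|y ^+ 2| <= 1 by rewrite normrX exprn_ile1.
have d1 : `|rho (x, y) - (z + x)| <= `|a| + e.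
  rewrite (_ : _ - _ = (rho (x, y) - (z + x - a * y ^+ 2)) - a * y ^+ 2); last by ring.
  rewrite (le_trans (ler_normB _ _))// addrC lerD// normrM -[leRHS]mulr1 ler_wpM2l//.
set dr := rho (x, y) - (z + x) in T d1 *.
rewrite (_ : _ - _ = (F (rho (x, y)) - F (z + x) - F1 (z + x) * dr) +
   F1 (z + x) * (rho (x, y) - (z + x - a * y ^+ 2))); last by rewrite /dr; ring.
rewrite (le_trans (ler_normD _ _))// lerD//.
  by apply: le_trans T _; rewrite ler_wpM2l// ler_pXn2r// nnegrE//; apply: le_trans d1.
by rewrite normrM; apply: ler_pM.
Qed.

(** For [Phi = k / 2 z F(z) + ...] the two occurrences of [K (z F)] cancel. *)
Lemma Eav_ansatz (F F1 F2 : R -> R) (M : R) :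
  (forall t : R, is_derive t 1 F (F1 t)) -> (forall t : R, is_derive t 1 F1 (F2 t)) ->
  continuous F2 -> (forall t, `|F1 t| <= M) -> (forall t, `|F2 t| <= M) ->
  forall (c B : R), 0 < c -> exists2 C : R, 0 < C &
  forall (lam k z : R) (rho th W : R * R -> R) (Phi : R -> R), 0 < lam <= 1 -> `|k| <= c ->
  continuous Phi -> (forall t, `|Phi t| <= B) -> cSq rho -> cSq th -> cSq W ->
  (forall x y : R, `|x| <= 1 -> `|y| <= 1 -> is_derive x 1 (fun t => rho (t, y)) (th (x, y))) ->
  (forall x y, `|x| <= 1 -> `|y| <= 1 -> `|th (x, y) - 1| <= c * lam) ->
  (forall x y, `|x| <= 1 -> `|y| <= 1 ->
     `|rho (x, y) - (z + x - lam * k / 2 * y ^+ 2)| <= c * lam ^+ 2) ->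
  (forall p, Sq p -> `|W p - (F (rho p) + lam * Phi (rho p))| <= c * lam ^+ 2) ->
  `|E W - (K F z * (1 + lam * k * z / 2) - lam * k / 2 * K (fun t => t * F t) z + lam * K Phi z)|
    <= C * lam ^+ 2.
Proof.
move=> dF dF1 cF2 F1M F2M c B c0.
have [CA CA0 HA] := Eav_pullback.
have M0 : 0 <= M by apply: le_trans (F1M 0).
exists (c + CA * `|B| * (2 * c) + M * (2 * c) ^+ 2 + M * c).
  by rewrite !ltr_wpDr// !mulr_ge0// ?sqr_ge0// ltW.
move=> lam k z rho th W Phi /andP[l0 l1] kc cPhi PhiB crho cth cW drho hth hrho hW.
have cF := is_derive_continuous dF.
have cFr : cSq (fun p => F (rho p)) by exact: within_cont_comp.
have cPr : cSq (fun p => Phi (rho p)) by exact: within_cont_comp.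
have cPl : cSq (fun p => lam * Phi (rho p)) by apply: within_contM => //; exact: (@within_cont_cst R Sq lam).
have l2 : lam ^+ 2 <= lam by rewrite expr2 ger_pMr.
have ab : `|lam * k / 2| <= c * lam / 2.
  by rewrite !normrM (gtr0_norm l0) [`|2^-1|]gtr0_norm// ler_pM2r// mulrC ler_pM2r.
have T1 : `|E W - (E (fun p => F (rho p)) + lam * E (fun p => Phi (rho p)))| <= c * lam ^+ 2.
  rewrite -(EavZ hJ lam cPr) -(EavD hJ)//; apply: (Eav_dist hJ) => //; exact: within_contD.
have T2 := Eav_bend dF dF1 cF2 F1M F2M crho hrho.
have cl2 : c * lam ^+ 2 <= c * lam by rewrite ler_pM2l.
have T3 : `|E (fun p => Phi (rho p)) - K Phi z| <= CA * `|B| * (2 * c * lam).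
  have cl : 0 <= c * lam by rewrite mulr_ge0 ?ltW.
  apply: (HA Phi `|B| (2 * c * lam) z rho th) => //.
  - by move=> t; apply: le_trans (PhiB t) (ler_norm _).
  - by rewrite -mulrA mulr_ge0.
  - by move=> x y x1 y1; apply: le_trans (hth x y x1 y1) _; rewrite -mulrA; lra.
  - move=> x y x1 y1; have y2 : `|y ^+ 2| <= 1 by rewrite normrX exprn_ile1.
    rewrite (_ : _ - _ = (rho (x, y) - (z + x - lam * k / 2 * y ^+ 2)) - lam * k / 2 * y ^+ 2); last by ring.
    rewrite (le_trans (ler_normB _ _))//.
    have : `|lam * k / 2 * y ^+ 2| <= c * lam / 2.
      rewrite normrM -[leRHS]mulr1; apply: ler_pM => //.
    by have := hrho x y x1 y1; rewrite -mulrA; lra.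
rewrite (_ : E W - _ = (E W - (E (fun p => F (rho p)) + lam * E (fun p => Phi (rho p)))) +
  (E (fun p => F (rho p)) - (K F z - lam * k / 2 * (K (fun t => t * F t) z - z * K F z))) +
  lam * (E (fun p => Phi (rho p)) - K Phi z)); last first.
  by move: (E W) (E (fun p => F (rho p))) (E (fun p => Phi (rho p))) (K F z) (K Phi z) (K (fun t => t * F t) z) => *; field.
rewrite (le_trans (ler_normD _ _))//.
have -> : (c + CA * `|B| * (2 * c) + M * (2 * c) ^+ 2 + M * c) * lam ^+ 2 =
  (c * lam ^+ 2 + (M * (2 * c * lam) ^+ 2 + M * (c * lam ^+ 2))) + lam * (CA * `|B| * (2 * c * lam)) by ring.
apply: lerD; last by rewrite normrM (gtr0_norm l0) ler_pM2l.
rewrite (le_trans (ler_normD _ _))//; apply: lerD => //.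
apply: le_trans T2 _; rewrite lerD2r ler_wpM2l//.
have cl : 0 <= c * lam ^+ 2 by rewrite mulr_ge0 ?sqr_ge0 ?ltW.
rewrite ler_pXn2r// ?nnegrE; [|exact: addr_ge0|lra].
by lra.
Qed.

End Pullback.

(** * The tubular chart *)

Section LocallyLipschitz.
Context {R : realType}.
Notation cSq f := {within Sq, continuous f}.

Lemma enorm_le_abs (x : R * R) : enorm x <= `|x.1| + `|x.2|.
Proof.
apply: le_enorm; first exact: addr_ge0.
rewrite sqrrD !real_normK ?num_real// /dotp -!expr2.
have : 0 <= (`|x.1| * `|x.2|) *+ 2 by rewrite mulrn_wge0// mulr_ge0.
by move: (_ *+ 2) => a; lra.
Qed.

Lemma cvg_enorm (x : R * R) (c : R) : 0 < c -> \forall y \near nbhs x, enorm (y - x) < c.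
Proof.
move=> c0; have c2 : 0 < c / 2 by rewrite divr_gt0.
have : \forall y \near nbhs x, `|y - x| < c / 2.
  by near=> y; rewrite distrC; near: y; apply: cvgr_dist_lt => //; exact: cvg_id.
apply: filterS => y h; apply: le_lt_trans (enorm_le_abs _) _.
have h1 : `|(y - x).1| <= `|y - x| by rewrite prod_normE le_max lexx.
have h2 : `|(y - x).2| <= `|y - x| by rewrite prod_normE le_max lexx orbT.
lra.
Unshelve. all: by end_near. Qed.

Lemma locally_Lipschitz_continuous (A : set (R * R)) (f : R * R -> R) (C c : R) : 0 < c ->
  (forall x y, A x -> A y -> enorm (y - x) < c -> `|f y - f x| <= C * enorm (y - x)) ->
  {within A, continuous f}.
Proof.
move=> c0 H; apply/subspace_continuousP => x Ax.
apply/cvgrPdist_le => e e0; have C0 : 0 < `|C| + 1 by rewrite ltr_wpDl.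
have c'0 : 0 < Num.min c (e / (`|C| + 1)) by rewrite lt_min c0/= divr_gt0.
suff : \forall u \near nbhs x, A u -> `|f x - f u| <= e by [].
near=> u => Au.
have /andP[h1 h2] : (enorm (u - x) < c) && (enorm (u - x) < e / (`|C| + 1)).
  by rewrite -lt_min; near: u; exact: cvg_enorm.
rewrite distrC; apply: le_trans (H _ _ Ax Au h1) _.
rewrite ltr_pdivlMr// in h2; apply: le_trans (ltW h2); rewrite mulrC ler_wpM2l ?enorm_ge0//.
by rewrite (le_trans (ler_norm _))// lerDl.
Unshelve. all: by end_near. Qed.

(** The distance function is Lipschitz. *)
Lemma edist_closed (A : set (R * R)) (d : R) : A !=set0 -> closed [set x | edist_set A x <= d].
Proof.
move=> A0; apply: (@preimage_closed _ _ (edist_set A) [set t | t <= d]); last exact: closed_le.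
move=> x _; have : {within setT, continuous (edist_set A)}.
  apply: (@locally_Lipschitz_continuous _ _ 1 1) => // u v _ _ _; rewrite mul1r ler_norml.
  have := edist_set_triangle u v A0; have := edist_set_triangle v u A0; rewrite (enormB u v) => *.
  by apply/andP; split; lra.
by move=> H; exact: ((continuous_subspace_setT (edist_set A)).2 H x).
Qed.
End LocallyLipschitz.

Section Chart.
Context {R : realType}.
Variables (Omega Omegam : set (R * R)) (L d0 : R) (gamma nu : R -> R * R)
  (kap : R -> R) (sc : R * R -> R).
Hypothesis hgeo : geometry Omega Omegam L d0 gamma nu kap sc.
Notation cSq f := {within Sq, continuous f}.
Notation N := (normal_map gamma nu).
Notation Gam := (range gamma).
Notation r := (sdist Omegam Gam).
Notation tau := (tau gamma).

Let hc := geo_curve hgeo.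
Let hn := geo_normal hgeo.
Let d00 : 0 < d0 := geo_d0 hgeo.
Let hk := geo_curvature hgeo.
Let ht := geo_tubular hgeo.
Let L0 : 0 < L := curve_length hc.

Lemma curve_nonempty : Gam !=set0. Proof. by exists (gamma 0), 0. Qed.

Lemma sdist_norm xi : `|r xi| = edist_set Gam xi.
Proof.
have h := edist_set_ge0 xi curve_nonempty.
by rewrite /sdist; case: ifP => _; [rewrite normrN|]; exact: ger0_norm.
Qed.

Lemma tubeE d xi : tube Gam d xi <-> `|r xi| <= d.
Proof. by rewrite sdist_norm. Qed.

Lemma tube_closed d : closed (tube Gam d).
Proof. exact: edist_closed curve_nonempty. Qed.

Lemma sdist_step xi xi' : `|r xi'| <= `|r xi| + enorm (xi' - xi).
Proof. by rewrite !sdist_norm; exact: edist_set_triangle curve_nonempty. Qed.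

Lemma normal_map_periodic (n : int) s t : N (s + n%:~R * L) t = N s t.
Proof.
by rewrite /normal_map (periodic_int (curve_periodic hc)) (periodic_int (normal_periodic hn)).
Qed.

Let dgam (t : R) : derivable gamma t 1.
Proof. by have [H _] := curve_C5 hc; exact: (H 0%N isT). Qed.
Let dnu (t : R) : derivable nu t 1.
Proof. by have [H _] := normal_C4 hn; exact: (H 0%N isT). Qed.

(** On the compact set of parameters whose arc-length difference stays away from
[0] and [L], injectivity makes the distance of the images positive, hence
bounded below. *)
Lemma tubular_separation (dl : R) : 0 < dl -> dl <= L / 4 -> exists2 c : R, 0 < c &
  forall s h t t', dl <= h <= L - dl -> `|t| <= d0 -> `|t'| <= d0 ->
  c <= enorm (N (s + h) t' - N s t).
Proof.
move=> dl0 dlL.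
pose T := ((R * R) * (R * R))%type.
pose f (u : T) : R := dotp (N (u.1.1 + u.1.2) u.2.2 - N u.1.1 u.2.1) (N (u.1.1 + u.1.2) u.2.2 - N u.1.1 u.2.1).
have cD (a b : T -> R) : continuous a -> continuous b -> continuous (fun u => a u + b u).
  by move=> ca cb u; apply: cvgD; [exact: ca|exact: cb].
have cM (a b : T -> R) : continuous a -> continuous b -> continuous (fun u => a u * b u).
  by move=> ca cb u; apply: cvgM; [exact: ca|exact: cb].
have cB (a b : T -> R) : continuous a -> continuous b -> continuous (fun u => a u - b u).
  by move=> ca cb u; apply: cvgB; [exact: ca|exact: cb].
have cC (g : R -> R) (a : T -> R) : continuous g -> continuous a -> continuous (fun u => g (a u)).
  by move=> cg ca u; apply: continuous_comp; [exact: ca|exact: cg].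
have c11 : continuous (fun u : T => u.1.1).
  by move=> u; apply: (@continuous_comp _ _ _ fst fst); exact: cvg_fst.
have c12 : continuous (fun u : T => u.1.2).
  by move=> u; apply: (@continuous_comp _ _ _ fst snd); [exact: cvg_fst|exact: cvg_snd].
have c21 : continuous (fun u : T => u.2.1).
  by move=> u; apply: (@continuous_comp _ _ _ snd fst); [exact: cvg_snd|exact: cvg_fst].
have c22 : continuous (fun u : T => u.2.2).
  by move=> u; apply: (@continuous_comp _ _ _ snd snd); exact: cvg_snd.
have cg1 := is_derive_continuous (fun t : R => is_derive_fst (@dgam t)).
have cg2 := is_derive_continuous (fun t : R => is_derive_snd (@dgam t)).
have cn1 := is_derive_continuous (fun t : R => is_derive_fst (@dnu t)).
have cn2 := is_derive_continuous (fun t : R => is_derive_snd (@dnu t)).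
have cf : continuous f.
  rewrite /f /dotp /normal_map /=.
  have cp := cD _ _ c11 c12.
  have c1 := cB _ _ (cD _ _ (cC _ _ cg1 cp) (cM _ _ c22 (cC _ _ cn1 cp)))
    (cD _ _ (cC _ _ cg1 c11) (cM _ _ c21 (cC _ _ cn1 c11))).
  have c2 := cB _ _ (cD _ _ (cC _ _ cg2 cp) (cM _ _ c22 (cC _ _ cn2 cp)))
    (cD _ _ (cC _ _ cg2 c11) (cM _ _ c21 (cC _ _ cn2 c11))).
  exact: (cD _ _ (cM _ _ c1 c1) (cM _ _ c2 c2)).
pose A : set T := (`[0, L]%classic `*` `[dl, L - dl]%classic) `*` (`[- d0, d0]%classic `*` `[- d0, d0]%classic).
have cA : compact A by do !apply: compact_setX; exact: segment_compact.
have A0 : A !=set0.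
  exists ((0, dl), (0, 0)); have d0' := d00; have L0' := L0.
  by split; split; rewrite /= in_itv/=; apply/andP; split; lra.
have [u uA umin] := compact_EVT_min A0 cA (continuous_subspaceT cf).
have fu0 : 0 < f u.
  rewrite lt_neqAle dotp_ge0 andbT eq_sym; apply/eqP => f0.
  have [[h1 h2] [h3 h4]] : A u by rewrite inE in uA.
  rewrite /= in_itv/= in h1; rewrite /= in_itv/= in h2.
  rewrite /= in_itv/= in h3; rewrite /= in_itv/= in h4.
  have e0 : enorm (N (u.1.1 + u.1.2) u.2.2 - N u.1.1 u.2.1) <= 0.
    by apply: le_enorm => //; rewrite expr0n; rewrite -[leLHS]/(f u) f0.
  have E : N (u.1.1 + u.1.2) u.2.2 = N u.1.1 u.2.1.
    apply/eqP; rewrite -subr_eq0; move: e0; set w := _ - _ => e0; clearbody w.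
    have := le_trans (abs_le_enorm1 w) e0; have := le_trans (abs_le_enorm2 w) e0.
    by rewrite !normr_le0; case: w {e0} => a b /= /eqP -> /eqP ->.
  have r1 : `|u.2.2| <= d0 by rewrite ler_norml.
  have r2 : `|u.2.1| <= d0 by rewrite ler_norml.
  have [[n En] _] := tubular_inj ht r1 r2 E.
  have hn' : u.1.2 = (- n)%:~R * L by rewrite mulrNz mulNr; apply/eqP; rewrite -addr_eq0; move: En; move: (n%:~R * L) (u.1.1) (u.1.2) => a b c Eb; apply/eqP; lra.
  move: h2; rewrite hn' => /andP[g1 g2].
  have : 0 < (- n)%:~R * L by lra.
  have : (- n)%:~R * L < 1%:~R * L by rewrite mul1r; lra.
  by rewrite ltr_pM2r// ltr_int pmulr_lgt0// ltr0z gtz0_ge1 leNgt => ->.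
exists (Num.sqrt (f u)); first by rewrite sqrtr_gt0.
move=> s h t t' h1 t1 t1'.
have [n /andP[n1 n2]] := reduce_mod s L0.
have := umin ((s + n%:~R * L, h), (t, t')); rewrite inE => H.
have {}H : f u <= f ((s + n%:~R * L, h), (t, t')).
  apply: H; split; split; rewrite /= in_itv//= -?ler_norml//.
  by rewrite n1 ltW.
have E1 : N (s + n%:~R * L + h) t' = N (s + h) t' by rewrite addrAC normal_map_periodic.
apply: ler_wsqrtr; apply: le_trans H _.
by rewrite /f [X in N X t]/= normal_map_periodic [X in N X t']/= E1.
Qed.

(** Any two nearby points of the tube have representatives of their arc-length
parameters that are close, by [tubular_separation], so that [normal_map_local]
applies.  The coordinate [sc] is only meaningful modulo [L], which is why the
lemma transports periodic functions along the shift [h]. *)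
Lemma chart_comparison : exists c C : R, [/\ 0 < c, 0 < C & forall xi xi',
  tube Gam d0 xi -> tube Gam d0 xi' -> enorm (xi' - xi) < c -> exists h : R,
  let s := sc xi in let D := xi' - xi in
  (forall (T : Type) (f : R -> T), (forall t, f (t + L) = f t) -> f (sc xi') = f (s + h)) /\
  [/\ `|h| <= C * enorm D, `|r xi' - r xi| <= C * enorm D,
      `|dotp D (tau s) - (1 - kap s * r xi) * h| <= C * enorm D ^+ 2 &
      `|dotp D (nu s) - (r xi' - r xi) - kap s / 2 * (1 - kap s * r xi) * h ^+ 2| <= C * enorm D ^+ 3]].
Proof.
have [dl [C [dl0 dlL C0 HN]]] := normal_map_local hc hn d00 hk.
have [c c0 Hc] := tubular_separation dl0 dlL.
exists c, C; split => // xi xi' t1 t2 e1.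
have [n /andP[n1 n2]] := reduce_mod (sc xi' - sc xi) L0.
have r1 := (tubeE d0 xi).1 t1; have r2 := (tubeE d0 xi').1 t2.
have E1 := geo_coord hgeo t1; have E2 := geo_coord hgeo t2.
(* the offset modulo [L] is close to [0], close to [L], or excluded by separation *)
have [m Hm] : exists m : int, `|sc xi' + m%:~R * L - sc xi| <= dl.
  set h0 := sc xi' - sc xi + n%:~R * L in n1 n2.
  have [g1|g1] := lerP h0 dl.
    by exists n; rewrite addrAC -/h0 ger0_norm.
  have [g2|g2] := lerP h0 (L - dl); last first.
    exists (n - 1); rewrite intrB mulrBl mul1r.
    rewrite (_ : _ - sc xi = h0 - L); last by rewrite /h0; ring.
    by rewrite ltr0_norm ?subr_lt0//; lra.
  have := Hc (sc xi) h0 (r xi) (r xi'); rewrite (ltW g1) g2 => /(_ isT r1 r2).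
  rewrite (_ : sc xi + h0 = sc xi' + n%:~R * L); last by rewrite /h0; ring.
  by rewrite normal_map_periodic E1 E2 leNgt e1.
exists (sc xi' + m%:~R * L - sc xi) => s D; split.
  by move=> T f fL; rewrite /s addrC subrK (periodic_int fL).
have := HN (sc xi) (sc xi' + m%:~R * L) (r xi) (r xi') r1 r2 Hm.
by rewrite normal_map_periodic E1 E2.
Qed.

End Chart.

(** * The chart on the range of the interaction *)

(** Eliminates the tangential shift [h] in favour of the offset [y]: to leading
order [(1 - k t) h = lam y], and the curvature of the parallel curve
[k / (1 - k t)] appears. *)
Lemma bend_algebra (R : realType) (lam C d0 a k t t' h x y : R) :
  0 < lam <= 1 -> 0 < C -> 0 < d0 -> `|y| <= 1 -> a ^+ 2 = lam ^+ 2 * y ^+ 2 ->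
  2^-1 <= 1 - k * t -> `|k| <= (2 * d0)^-1 ->
  `|a - (1 - k * t) * h| <= 4 * C * lam ^+ 2 ->
  `|lam * x - (t' - t) - k / 2 * (1 - k * t) * h ^+ 2| <= 8 * C * lam ^+ 3 ->
  `|t' / lam - (t / lam + x - lam * (k / (1 - k * t)) / 2 * y ^+ 2)|
    <= (8 * C + d0^-1 * (8 * C + 16 * C ^+ 2)) * lam ^+ 2.
Proof.
move=> /andP[l0 l1] C0 d00 y1 ay w k1; set W := 1 - k * t in w *.
have W0 : 0 < W by apply: lt_le_trans w.
set E := a - W * h => E1 A4; set F := _ - _ - _ in A4.
have a1 : `|a| <= lam.
  rewrite -(@ler_pXn2r _ 2)// ?nnegrE ?(ltW l0)// real_normK ?num_real// ay ger_pMr ?exprn_gt0//.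
  by rewrite -(real_normK (num_real y)) exprn_ile1.
have l20 : 0 <= lam ^+ 2 by exact: sqr_ge0.
have E2 : `|E ^+ 2 - 2 * a * E| <= (8 * C + 16 * C ^+ 2) * lam ^+ 3.
  rewrite (le_trans (ler_normB _ _))// normrX !normrM [`|2|]gtr0_norm//.
  have h1 : `|E| ^+ 2 <= 16 * C ^+ 2 * lam ^+ 3.
    apply: (@le_trans _ _ ((4 * C * lam ^+ 2) ^+ 2)).
      by rewrite ler_pXn2r ?nnegrE// !mulr_ge0// ltW.
    rewrite (_ : (4 * C * lam ^+ 2) ^+ 2 = 16 * C ^+ 2 * (lam ^+ 4)); last by ring.
    apply: ler_wpM2l; first by rewrite mulr_ge0 ?sqr_ge0.
    by rewrite [lam ^+ 4]exprSr ger_pMr// exprn_gt0.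
  have h2 : `|a| * `|E| <= 4 * C * lam ^+ 3.
    rewrite (_ : 4 * C * lam ^+ 3 = lam * (4 * C * lam ^+ 2)); last by ring.
    exact: ler_pM.
  by move: h1 h2; lra.
have lamn : lam != 0 by rewrite gt_eqF.
have Wn : W != 0 by rewrite gt_eqF.
have -> : t' / lam - (t / lam + x - lam * (k / W) / 2 * y ^+ 2) =
  (- F - (k / 2 / W) * (E ^+ 2 - 2 * a * E)) / lam.
  have -> : y ^+ 2 = a ^+ 2 / lam ^+ 2 by rewrite ay mulrAC divff ?mul1r// expf_neq0.
  by rewrite /F /E; field; rewrite lamn Wn.
rewrite normrM normfV (gtr0_norm l0) ler_pdivrMr// -[leRHS]mulrA -exprSr [leRHS]mulrDl.
rewrite (le_trans (ler_normB _ _))// normrN; apply: lerD => //.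
rewrite normrM -[leRHS]mulrA; apply: ler_pM => //.
rewrite normrM normfV (gtr0_norm W0) normrM [`|2^-1|]gtr0_norm// ler_pdivrMr//.
have i0 : 0 < d0^-1 by rewrite invr_gt0.
have h3 : d0^-1 * 2^-1 <= d0^-1 * W by rewrite ler_pM2l.
by move: k1; rewrite invfM; lra.
Qed.

Section Pull.
Context {R : realType}.
Variables (Omega Omegam : set (R * R)) (L d0 : R) (gamma nu : R -> R * R)
  (kap : R -> R) (sc : R * R -> R).
Hypothesis hgeo : geometry Omega Omegam L d0 gamma nu kap sc.
Notation cSq f := {within Sq, continuous f}.
Notation Gam := (range gamma).
Notation r := (sdist Omegam Gam).
Notation tau := (tau gamma).

Let hc := geo_curve hgeo.
Let hn := geo_normal hgeo.
Let d00 : 0 < d0 := geo_d0 hgeo.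
Let hk := geo_curvature hgeo.

Variables (c C : R).
Hypotheses (c0 : 0 < c) (C0 : 0 < C).
Hypothesis Hcmp : forall xi xi',
  tube Gam d0 xi -> tube Gam d0 xi' -> enorm (xi' - xi) < c -> exists h : R,
  let s := sc xi in let D := xi' - xi in
  (forall (T : Type) (f : R -> T), (forall t, f (t + L) = f t) -> f (sc xi') = f (s + h)) /\
  [/\ `|h| <= C * enorm D, `|r xi' - r xi| <= C * enorm D,
      `|dotp D (tau s) - (1 - kap s * r xi) * h| <= C * enorm D ^+ 2 &
      `|dotp D (nu s) - (r xi' - r xi) - kap s / 2 * (1 - kap s * r xi) * h ^+ 2| <= C * enorm D ^+ 3].

Definition tube_Lipschitz (f : R * R -> R) (B : R) := forall xi xi',
  tube Gam d0 xi -> tube Gam d0 xi' -> enorm (xi' - xi) < c ->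
  `|f xi' - f xi| <= B * enorm (xi' - xi).

Lemma tube_Lipschitz_sdist : tube_Lipschitz r C.
Proof. by move=> xi xi' t1 t2 e1; have [h [_ [_ H _ _]]] := Hcmp t1 t2 e1. Qed.

Lemma tube_Lipschitz_sc (f : R -> R) (B : R) : 0 <= B -> (forall t, f (t + L) = f t) ->
  (forall s s', `|f s' - f s| <= B * `|s' - s|) -> tube_Lipschitz (fun xi => f (sc xi)) (B * C).
Proof.
move=> B0 fL fB xi xi' t1 t2 e1; have [h [Hp [Hh _ _ _]]] := Hcmp t1 t2 e1.
rewrite (Hp _ f fL); apply: le_trans (fB _ _) _.
by rewrite addrAC subrr add0r -mulrA ler_wpM2l.
Qed.

Lemma curv_bounds s t : `|t| <= d0 -> 2^-1 <= 1 - kap s * t /\ `|kap s * t| <= 2^-1.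
Proof.
move=> t1; have h : `|kap s * t| <= 2^-1.
  by apply: le_trans (hk s); rewrite normrM ler_wpM2l.
by split=> //; move: h; rewrite ler_norml => /andP[? ?]; lra.
Qed.

Lemma curv_coeff s t : `|t| <= d0 -> `|kap s / 2 * (1 - kap s * t)| <= d0^-1.
Proof.
move=> t1; have [_ h] := curv_bounds s t1; have k1 := kap_le d00 hk s.
have i0 : 0 <= d0^-1 by rewrite invr_ge0 ltW.
have -> : d0^-1 = (2 * d0)^-1 * 2 by rewrite invfM mulrAC mulVf// mul1r.
rewrite mulrAC -mulrA normrM; apply: ler_pM => //.
rewrite normrM [`|2^-1|]gtr0_norm// ler_pdivrMr//.
by rewrite (le_trans (ler_normB _ _))// normr1; move: h; lra.
Qed.

(** The curvature of the curve parallel to [Gam] through [xi]. *)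
Definition parallel_curv (xi : R * R) : R := kap (sc xi) / (1 - kap (sc xi) * r xi).

Lemma parallel_curv_bounds xi : tube Gam d0 xi -> `|parallel_curv xi| <= d0^-1 /\ `|parallel_curv xi * r xi| <= 1.
Proof.
move=> /(tubeE Omegam) t1; have [w h] := curv_bounds (sc xi) t1; have k1 := kap_le d00 hk (sc xi).
rewrite /parallel_curv; move: (kap _) (r xi) t1 w h k1 => k t t1 w h k1.
have w0 : 0 < 1 - k * t by apply: lt_le_trans w.
rewrite mulrAC !normrM normfV (gtr0_norm w0) -normrM !ler_pdivrMr//; split; last by rewrite mul1r; lra.
apply: le_trans k1 _; rewrite invfM mulrC ler_wpM2l// invr_ge0; exact: ltW.
Qed.

Lemma tube_Lipschitz_parallel_curv : exists2 B : R, 0 < B & tube_Lipschitz parallel_curv B.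
Proof.
have [B B0 HB] := kap_Lipschitz hc hn.
have kL := tube_Lipschitz_sc (ltW B0) (kap_periodic hc hn) HB.
pose kk := (2 * d0)^-1; have kk0 : 0 < kk by rewrite invr_gt0 mulr_gt0.
exists (4 * (B * C + kk ^+ 2 * C)); first by rewrite mulr_gt0// addr_gt0// mulr_gt0// exprn_gt0.
move=> xi xi' t1 t2 e1; have h1 := kL _ _ t1 t2 e1; have h2 := tube_Lipschitz_sdist t1 t2 e1.
have [w _] := curv_bounds (sc xi) ((tubeE Omegam gamma d0 xi).1 t1).
have [w' _] := curv_bounds (sc xi') ((tubeE Omegam gamma d0 xi').1 t2).
have k1 := kap_le d00 hk (sc xi); have k2 := kap_le d00 hk (sc xi').
rewrite /parallel_curv; move: h1 h2 w w' k1 k2; rewrite -/kk.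
move: (kap (sc xi)) (kap (sc xi')) (r xi) (r xi') (enorm _) => k k' t t' e h1 h2 w w' k1 k2.
have w0 : 0 < 1 - k * t by apply: lt_le_trans w.
have w0' : 0 < 1 - k' * t' by apply: lt_le_trans w'.
have -> : k' / (1 - k' * t') - k / (1 - k * t) =
    ((k' - k) + k * k' * (t' - t)) / ((1 - k' * t') * (1 - k * t)).
  by field; rewrite (gt_eqF w0) (gt_eqF w0').
have q1 : 4^-1 <= (1 - k' * t') * (1 - k * t).
  rewrite (_ : 4^-1 = 2^-1 * 2^-1); last by field.
  exact: ler_pM.
have q0 : 0 < (1 - k' * t') * (1 - k * t) by apply: lt_le_trans q1.
rewrite normrM normfV (gtr0_norm q0) ler_pdivrMr//.
have n1 : `|k' - k + k * k' * (t' - t)| <= B * C * e + kk ^+ 2 * (C * e).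
  rewrite (le_trans (ler_normD _ _))// lerD// !normrM expr2.
  by apply: ler_pM => //; apply: ler_pM.
have e0 : 0 <= (B * C + kk ^+ 2 * C) * e.
  by have := le_trans (normr_ge0 _) n1; rewrite mulrDl mulrA.
apply: le_trans n1 _; rewrite mulrA -mulrDl.
set a := _ * e in e0 *; rewrite (_ : 4 * _ * _ * _ = a * (4 * ((1 - k' * t') * (1 - k * t)))); last by rewrite /a; ring.
by rewrite -[leLHS]mulr1 ler_wpM2l// mulrC -ler_pdivrMr// mul1r.
Qed.

Variables (lam : R) (xi : R * R).
Hypotheses (lam0 : 0 < lam) (lamc : 8 * lam < c) (lamd : 16 * lam <= d0).
Hypothesis xid : `|r xi| <= 3 / 4 * d0.

Let n0 := nu (sc xi).

(** The interaction disc of radius [lam] around [xi] in coordinates whose first axis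
is normal to the interface. *)
Definition frame_pt (u : R * R) : R * R :=
  (xi.1 + lam * (n0.1 * u.1 - n0.2 * u.2), xi.2 + lam * (n0.2 * u.1 + n0.1 * u.2)).

Let n0u : n0.1 ^+ 2 + n0.2 ^+ 2 = 1.
Proof. by have := nu_unit hn (sc xi); rewrite /dotp -!expr2. Qed.

Lemma pt_dist u v : enorm (frame_pt v - frame_pt u) = lam * enorm (v - u).
Proof.
rewrite -[lam in RHS](ger0_norm (ltW lam0)) -sqrtr_sqr /enorm -sqrtrM ?sqr_ge0//.
congr Num.sqrt; rewrite /dotp /=.
transitivity (lam ^+ 2 * ((n0.1 ^+ 2 + n0.2 ^+ 2) * ((v.1 - u.1) * (v.1 - u.1) + (v.2 - u.2) * (v.2 - u.2)))).
  by ring.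
by rewrite n0u mul1r.
Qed.

Lemma pt_dist0 u : enorm (frame_pt u - xi) = lam * enorm u.
Proof.
have -> : xi = frame_pt 0 by rewrite /frame_pt /= !mulr0 subr0 addr0 mulr0 !addr0; case: (xi).
by rewrite pt_dist subr0.
Qed.

Lemma pt0_nu u : dotp (frame_pt u - xi) n0 = lam * u.1.
Proof. rewrite -[RHS]mulr1 -n0u /dotp /frame_pt /=; ring. Qed.

(** Squared, because the frame may be oriented against the curve. *)
Lemma pt0_tau u : (dotp (frame_pt u - xi) (tau (sc xi))) ^+ 2 = lam ^+ 2 * u.2 ^+ 2.
Proof.
have h1 := nu_tau hn (sc xi); have h2 := tau_unit hc (sc xi).
move: h1 h2; rewrite -/n0 /dotp /frame_pt /= -/n0; move: (tau (sc xi)) n0u => [a b] /=.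
move: (n0.1) (n0.2) (xi.1) (xi.2) u => p q x y [u v] /= pq h1 h2.
have -> : (x + lam * (p * u - q * v) - x) * a + (y + lam * (q * u + p * v) - y) * b =
   lam * (p * a + q * b) * u + lam * v * (p * b - q * a) by ring.
rewrite h1 mulr0 mul0r add0r.
have -> : (lam * v * (p * b - q * a)) ^+ 2 = lam ^+ 2 * v ^+ 2 * ((p ^+ 2 + q ^+ 2) * (a * a + b * b) - (p * a + q * b) ^+ 2) by ring.
by rewrite h1 h2 pq; ring.
Qed.

Lemma pt_tube u : enorm u <= 4 -> tube Gam d0 (frame_pt u).
Proof.
move=> u4; apply/(tubeE Omegam); apply: le_trans (sdist_step _ _ xi _) _; rewrite pt_dist0.
have : lam * enorm u <= lam * 4 by rewrite ler_pM2l.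
have d0' := d00; have l := lamd; have x := xid; lra.
Qed.

Lemma xi_tube : tube Gam d0 xi.
Proof. by apply/(tubeE Omegam); apply: le_trans xid _; have := d00; lra. Qed.

Lemma Sq_enorm (u : R * R) : Sq u -> enorm u <= 2.
Proof. by case: u => x y /SqE[x1 y1]; apply: le_trans (enorm_le_abs _) _; rewrite /=; lra. Qed.

Lemma pull_near f B u : 0 <= B -> tube_Lipschitz f B -> Sq u -> `|f (frame_pt u) - f xi| <= 2 * B * lam.
Proof.
move=> B0 fB /Sq_enorm u2; have u4 : enorm u <= 4 by lra.
have e : enorm (frame_pt u - xi) <= 2 * lam by rewrite pt_dist0 mulrC ler_pM2r.
have ec : enorm (frame_pt u - xi) < c by have := lamc; have := lam0; lra.
apply: le_trans (fB _ _ xi_tube (pt_tube u4) ec) _.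
by rewrite [2 * B]mulrC -mulrA ler_wpM2l.
Qed.

Lemma pull_cSq f B : tube_Lipschitz f B -> cSq (fun u => f (frame_pt u)).
Proof.
move=> fB; apply: (@locally_Lipschitz_continuous _ _ _ (B * lam) (c / lam)) => [|u v Su Sv e].
  exact: divr_gt0.
have := fB (frame_pt u) (frame_pt v); rewrite pt_dist mulrA; apply.
- by apply: pt_tube; have := Sq_enorm Su; lra.
- by apply: pt_tube; have := Sq_enorm Sv; lra.
- by rewrite mulrC -ltr_pdivlMr.
Qed.

Let rho (u : R * R) : R := r (frame_pt u) / lam.
Let th (u : R * R) : R := dotp (nu (sc (frame_pt u))) n0.

Lemma tube_Lipschitz_nu : exists2 B : R, 0 < B & forall s0,
  tube_Lipschitz (fun xi => dotp (nu (sc xi)) (nu s0)) B.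
Proof.
have [B B0 HB] := nu_Lipschitz hc hn.
exists (B * C); first exact: mulr_gt0.
move=> s0; apply: (@tube_Lipschitz_sc (fun s => dotp (nu s) (nu s0))); first exact: ltW.
  by move=> t; rewrite (normal_periodic hn).
by move=> s s'; apply: HB; exact: (normal_unit hn).
Qed.

Lemma pull_derive (x y : R) : `|x| <= 1 -> `|y| <= 1 ->
  is_derive x 1 (fun t => rho (t, y)) (th (x, y)).
Proof.
move=> x1 y1.
have main : is_derive x 1 (fun t => r (frame_pt (t, y))) (lam * th (x, y)).
  apply: (@is_derive_quadratic _ _ x _ (C * lam ^+ 3 + d0^-1 * (C * lam) ^+ 2) 1) => // h h1.
  have u1 : enorm (x, y) <= 4 by apply: le_trans (enorm_le_abs _) _; rewrite /=; lra.
  have u2 : enorm (x + h, y) <= 4.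
    apply: le_trans (enorm_le_abs _) _; rewrite /=; have := ler_normD x h; lra.
  have E : enorm (frame_pt (x + h, y) - frame_pt (x, y)) = lam * `|h|.
    rewrite pt_dist /=; congr (_ * _); rewrite /enorm /dotp /= subrr mulr0 addr0.
    by rewrite addrAC subrr add0r -expr2 sqrtr_sqr.
  have ec : enorm (frame_pt (x + h, y) - frame_pt (x, y)) < c.
    have : lam * `|h| <= lam * 1 by rewrite ler_pM2l.
    by rewrite E; have := lamc; have := lam0; lra.
  have [h' [_ [A1 _ _ A4]]] := Hcmp (pt_tube u1) (pt_tube u2) ec.
  rewrite E in A1 A4.
  have t1 := (tubeE Omegam gamma d0 _).1 (pt_tube u1).
  have [_ kr] := curv_bounds (sc (frame_pt (x, y))) t1; have k1 := kap_le d00 hk (sc (frame_pt (x, y))).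
  have DE : frame_pt (x + h, y) - frame_pt (x, y) = (lam * h) *: n0.
    rewrite /frame_pt; move: n0 => [p1 p2]; congr (_, _) => /=; rewrite /GRing.scale /=; ring.
  have k2 := curv_coeff (sc (frame_pt (x, y))) t1.
  rewrite DE dotpZl [dotp n0 _]dotpC -/(th (x, y)) in A4.
  set k := kap _ / 2 * _ in A4 k2.
  move: A1 A4 k2; clearbody k; move: (th (x, y)) (r (frame_pt (x + h, y))) (r (frame_pt (x, y))) => t a b A1 A4 k2.
  have hh : `|h| ^+ 2 = h ^+ 2 by rewrite real_normK ?num_real.
  rewrite (_ : a - b - h * (lam * t) = - (lam * h * t - (a - b) - k * h' ^+ 2) - k * h' ^+ 2); last by ring.
  rewrite (le_trans (ler_normB _ _))// normrN mulrDl; apply: lerD.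
    apply: le_trans A4 _; rewrite exprMn mulrA ler_wpM2l//.
      by rewrite mulr_ge0 ?exprn_ge0 ?ltW.
    by rewrite -hh exprS ler_piMl// exprn_ge0.
  rewrite normrM -[leRHS]mulrA; apply: ler_pM => //.
  by rewrite normrX -hh -exprMn ler_pXn2r ?nnegrE// -?mulrA// !mulr_ge0// ltW.
have -> : (fun t => rho (t, y)) = fun t => lam^-1 * r (frame_pt (t, y)) by apply/funext => t; rewrite mulrC.
by refine (isd_eq (isdZ main _) _); rewrite mulKf// gt_eqF.
Qed.

Lemma pull_th : cSq th /\ forall B, 0 <= B -> (forall s0,
  tube_Lipschitz (fun xi => dotp (nu (sc xi)) (nu s0)) B) ->
  forall u, Sq u -> `|th u - 1| <= 2 * B * lam.
Proof.
split; first by have [B _ HB] := tube_Lipschitz_nu; exact: pull_cSq (HB (sc xi)).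
by move=> B B0 HB u Su; have := pull_near B0 (HB (sc xi)) Su; rewrite (nu_unit hn).
Qed.

Lemma pull_rho_cSq : cSq rho.
Proof.
have -> : rho = fun u => r (frame_pt u) * lam^-1 by [].
by apply: within_contM; [exact: pull_cSq tube_Lipschitz_sdist|exact: (@within_cont_cst R Sq lam^-1)].
Qed.

(** Up to [O(lam^2)] the rescaled normal coordinate is an affine function of [x]
bent by the curvature. *)
Lemma pull_rho (x y : R) : lam <= 1 -> `|x| <= 1 -> `|y| <= 1 ->
  `|rho (x, y) - (r xi / lam + x - lam * parallel_curv xi / 2 * y ^+ 2)|
    <= (8 * C + d0^-1 * (8 * C + 16 * C ^+ 2)) * lam ^+ 2.
Proof.
move=> l1 x1 y1; have u2 : enorm (x, y) <= 2 by apply: Sq_enorm; apply/SqE.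
have e : enorm (frame_pt (x, y) - xi) <= 2 * lam by rewrite pt_dist0 mulrC ler_pM2r.
have ec : enorm (frame_pt (x, y) - xi) < c by have := lamc; have := lam0; lra.
have u4 : enorm (x, y) <= 4 by lra.
have [h [_ [_ _ A3 A4]]] := Hcmp xi_tube (pt_tube u4) ec.
have P2 := pt0_tau (x, y); have P1 := pt0_nu (x, y).
have t1 := (tubeE Omegam gamma d0 _).1 xi_tube.
have [w kr] := curv_bounds (sc xi) t1; have k1 := kap_le d00 hk (sc xi).
rewrite P1 /= in A4; rewrite /= in P2.
have l0 := lam0; have C0' := C0; have e0 := enorm_ge0 (frame_pt (x, y) - xi).
apply: (bend_algebra (a := dotp (frame_pt (x, y) - xi) (tau (sc xi))) (h := h)) => //.
- by apply/andP.
- apply: le_trans A3 _; rewrite [4 * C]mulrC -mulrA ler_pM2l//.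
  by rewrite (_ : 4 * lam ^+ 2 = (2 * lam) ^+ 2) ?ler_pXn2r ?nnegrE// ?mulr_ge0 ?ltW//; ring.
- apply: le_trans A4 _; rewrite [8 * C]mulrC -mulrA ler_pM2l//.
  by rewrite (_ : 8 * lam ^+ 3 = (2 * lam) ^+ 3) ?ler_pXn2r ?nnegrE// ?mulr_ge0 ?ltW//; ring.
Qed.

End Pull.

(** * Correctors and the expansion of the local weight *)

Section Correctors.
Context {R : realType}.
Variables (beta : R) (hbeta : 1 < beta).
Variables (mb : R) (hmb : 0 < mb) (hmb_eq : mb = tanh (beta * mb)).
Variables (J : R * R -> R) (hJ : interaction_kernel J).
Variables (mbar : R -> R) (hmbar : instanton beta J mb mbar).
Notation K := (Jstar J).
Notation mu := (mu mbar).
Notation sg := (sg beta mbar).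

(** The derivative of [1 / sigma] at the point [mbar z]. *)
Definition dinv_sigma (z : R) : R := 2 * beta * mbar z / sg z ^+ 2.

(** The right-hand side [- sigma (1 / sigma)' b mu] is odd because [mbar] is odd and
[b], [mu] are even, so [instanton_poisson] applies. *)
Lemma corrector (b : R -> R) (B : R) : continuous b -> (forall z, b (- z) = b z) ->
  (forall z, `|b z| <= B) -> exists2 C : R, 0 < C & forall eta : R, 0 < eta -> exists psi : R -> R,
  [/\ continuous psi, forall z, `|psi z| <= C * Num.sqrt (mu z) &
    forall z, `|K psi z - (psi z / sg z + dinv_sigma z * (b z * mu z))| <= C * eta].
Proof.
move=> cb be bB; have [CP CP0 HP] := instanton_poisson hbeta hmb hmb_eq hJ hmbar.
have sm0 := sgmin_gt0 hbeta hmb hmb_eq.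
have sge z : sgmin beta mb <= sg z by exact: (sg_ge hbeta hmb hmbar).
have s0 z : 0 < sg z by exact: lt_le_trans (sge z).
set sm := sgmin beta mb in sm0 sge.
have B0 : 0 <= B by apply: le_trans (bB 0).
have b0 : 0 < beta by apply: lt_trans hbeta.
have mu0 z : 0 < mu z := mu_gt0 hbeta hmb hmb_eq hJ hmbar z.
pose F z := - (2 * beta * mbar z / sg z * (b z * mu z)).
pose A := 2 * beta / sm * B.
have A0 : 0 <= A by do !apply: mulr_ge0 => //; rewrite ?invr_ge0; exact: ltW.
have cF : continuous F.
  move=> z; apply: cvgN; apply: cvgM; last by apply: cvgM; [exact: cb|exact: (mu_cont hmbar)].
  apply: cvgM; first by apply: cvgM; [exact: cvg_cst|exact: (mbar_cont hmbar)].
  by apply: cvgV; [rewrite gt_eqF|exact: (sg_cont hmbar)].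
have Fo x : F (- x) = - F x.
  rewrite /F (sg_even hmbar) be (mu_even hmbar) (instanton_odd hmbar).
  by move: (mbar x) (sg x) (b x) (mu x) => *; ring.
have FA z : `|F z| <= A * mu z.
  rewrite normrN mulrA normrM (gtr0_norm (mu0 z)) ler_pM2r// normrM; apply: ler_pM => //.
  rewrite normrM normfV (gtr0_norm (s0 z)); apply: ler_pM => //; first by rewrite invr_ge0 ltW.
    have m1 : `|mbar z| <= 1 by apply: le_trans (mbar_norm hmbar z) (ltW (mb_lt1 hmb_eq)).
    by rewrite normrM gtr0_norm ?mulr_gt0// -[leRHS]mulr1 ler_pM2l ?mulr_gt0.
  by rewrite lef_pV2 ?posrE.
exists (CP * A + sm^-1); first by rewrite ltr_wpDl ?invr_gt0// mulr_ge0// ltW.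
move=> eta eta0; have [psi [c1 c2 c3]] := HP F A eta A0 cF Fo FA eta0.
exists psi; split => // z.
  by apply: le_trans (c2 z) _; rewrite ler_wpM2r ?sqrtr_ge0// lerDl invr_ge0 ltW.
have := c3 z; rewrite /F /dinv_sigma; move: (s0 z) (sge z); move: (K psi z) (psi z) (sg z) (mbar z) (b z) (mu z).
move=> k p s m b' u s00 ss h.
rewrite (_ : k - _ = - (p - s * k - - (2 * beta * m / s * (b' * u))) / s); last by field; rewrite gt_eqF.
rewrite normrM normrN normfV (gtr0_norm s00) ler_pdivrMr//; apply: le_trans h _.
have h1 : 1 <= sm^-1 * s by rewrite -ler_pdivrMl ?invr_gt0// invrK mulr1.
rewrite -[leLHS]mul1r -mulrA [eta * s]mulrC mulrA ler_pM2r//; apply: le_trans h1 _.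
by rewrite ler_wpM2r ?(ltW s00)// lerDr mulr_ge0// ltW.
Qed.
End Correctors.

(** Here [w1] is the leading part of the ansatz and [P] its corrector part. *)
Lemma weight_expansion (R : realType) (beta a sm B : R) : 0 < beta -> 0 < a -> 0 < sm -> 0 < B ->
  exists2 C : R, 0 < C & forall lam m u q s sA w1 mu P : R,
  0 < lam <= 1 -> `|m| <= 1 -> `|u| <= B -> `|q| <= B -> `|w1| <= B -> `|w1 - mu| <= B * lam ->
  `|P| <= B -> sm <= s -> a <= sA -> s = sigma beta m -> sA = sigma beta (m + lam * u + lam ^+ 2 * q) ->
  `|sA^-1 - s^-1| <= C * lam /\
  `|(w1 + lam * P) / sA - (w1 / s + lam * (P / s + 2 * beta * m / s ^+ 2 * (u * mu)))| <= C * lam ^+ 2.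
Proof.
move=> b0 a0 sm0 B0.
pose C1 := beta * (4 * B + 4 * B ^+ 2) / (sm * a).
pose C2 := beta * (4 * B ^+ 2) / (sm * a) + 2 * beta * (2 * B) * (C1 / sm) + 2 * beta * B / sm ^+ 2.
have C10 : 0 < C1 by rewrite divr_gt0 ?mulr_gt0// addr_gt0 ?mulr_gt0 ?exprn_gt0.
have C20 : 0 < C2 by do ![apply: addr_gt0|apply: divr_gt0|apply: mulr_gt0|apply: exprn_gt0] => //.
pose C3 := 2 * beta / sm ^+ 2 * B * B.
have C30 : 0 < C3 by do ![apply: divr_gt0|apply: mulr_gt0|apply: exprn_gt0] => //.
exists (C1 + C2 * B + C3 + C1 * B); first by rewrite !addr_gt0// mulr_gt0.
move=> lam m u q s sA w1 mu P /andP[l0 l1] m1 uB qB wB wmu PB ss sa sE sAE.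
have s0 : 0 < s by apply: lt_le_trans ss.
have sA0 : 0 < sA by apply: lt_le_trans sa.
have l20 : 0 < lam ^+ 2 by rewrite exprn_gt0.
have l2 : lam ^+ 2 <= lam by rewrite expr2 ger_pMr.
pose de := lam * u + lam ^+ 2 * q.
have deB : `|de| <= 2 * B * lam.
  rewrite (le_trans (ler_normD _ _))// normrM (gtr0_norm l0) normrM (gtr0_norm l20).
  have h1 : lam * `|u| <= lam * B by rewrite ler_pM2l.
  have h2 : lam ^+ 2 * `|q| <= lam * B by apply: ler_pM => //; exact: ltW.
  by lra.
have de2 : `|de ^+ 2| <= 4 * B ^+ 2 * lam ^+ 2.
  rewrite normrX (_ : 4 * _ * _ = (2 * B * lam) ^+ 2); last by ring.
  by rewrite ler_pXn2r ?nnegrE// !mulr_ge0// ltW.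
have d1 : s - sA = beta * (2 * m * de + de ^+ 2).
  by rewrite sE sAE /sigma /de; ring.
have ssA : sm * a <= s * sA by apply: ler_pM => //; exact: ltW.
have ssA0 : 0 < sm * a by exact: mulr_gt0.
have issA : (s * sA)^-1 <= (sm * a)^-1 by rewrite lef_pV2 ?posrE ?mulr_gt0.
have iss : s^-1 <= sm^-1 by rewrite lef_pV2 ?posrE.
have is0 : 0 < s^-1 by rewrite invr_gt0.
have issA0 : 0 < (s * sA)^-1 by rewrite invr_gt0 mulr_gt0.
have sn : s != 0 by rewrite gt_eqF.
have sAn : sA != 0 by rewrite gt_eqF.
have E1 : sA^-1 - s^-1 = beta * (2 * m * de + de ^+ 2) * (s * sA)^-1.
  by rewrite -d1; field; rewrite sn sAn.
have T1 : `|sA^-1 - s^-1| <= C1 * lam.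
  rewrite E1 normrM (gtr0_norm issA0) /C1 [leRHS]mulrAC; apply: ler_pM => //; first exact: ltW.
  rewrite normrM (gtr0_norm b0) -[leRHS]mulrA ler_pM2l// (le_trans (ler_normD _ _))//.
  have h1 : `|2 * m * de| <= 2 * (2 * B * lam).
    rewrite -mulrA normrM [`|2|]gtr0_norm// ler_pM2l// normrM -[leRHS]mul1r.
    exact: ler_pM.
  have h2 : 4 * B ^+ 2 * lam ^+ 2 <= 4 * B ^+ 2 * lam by rewrite ler_wpM2l// mulr_ge0// sqr_ge0.
  by move: de2 h1 h2; rewrite mulrDl; lra.
have E2 : sA^-1 - s^-1 - lam * (2 * beta * m / s ^+ 2 * u) =
   beta * de ^+ 2 * (s * sA)^-1 + 2 * beta * m * de * ((sA^-1 - s^-1) * s^-1) + 2 * beta * m * (lam ^+ 2 * q) * (s ^+ 2)^-1.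
  rewrite {1}E1 /de; have -> : (sA^-1 - s^-1) * s^-1 = (s * sA)^-1 - (s ^+ 2)^-1 by field; rewrite sn sAn.
  by move: (s * sA)^-1 (s ^+ 2)^-1 => x y; ring.
have T2 : `|sA^-1 - s^-1 - lam * (2 * beta * m / s ^+ 2 * u)| <= C2 * lam ^+ 2.
  rewrite E2 (le_trans (ler_normD _ _))// /C2 [leRHS]mulrDl; apply: lerD.
    rewrite (le_trans (ler_normD _ _))// [leRHS]mulrDl; apply: lerD.
      rewrite normrM (gtr0_norm issA0) [leRHS]mulrAC; apply: ler_pM => //; first exact: ltW.
      by rewrite normrM (gtr0_norm b0) -[leRHS]mulrA ler_pM2l.
    rewrite (_ : 2 * beta * (2 * B) * (C1 / sm) * lam ^+ 2 = (2 * beta * (2 * B * lam)) * (C1 * lam * sm^-1)); last by field; rewrite gt_eqF.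
    rewrite normrM; apply: ler_pM => //.
      rewrite normrM; apply: ler_pM => //; rewrite normrM gtr0_norm ?mulr_gt0// -[leRHS]mulr1 ler_pM2l ?mulr_gt0//.
    by rewrite normrM (gtr0_norm is0); apply: ler_pM => //; exact: ltW.
  rewrite normrM [leRHS]mulrAC; apply: ler_pM => //.
    rewrite normrM -[leRHS]mulrA; apply: ler_pM => //.
      by rewrite normrM gtr0_norm ?mulr_gt0// -[leRHS]mulr1 ler_pM2l ?mulr_gt0.
    by rewrite normrM (gtr0_norm l20) mulrC ler_pM2r.
  rewrite gtr0_norm ?invr_gt0 ?exprn_gt0// lef_pV2 ?posrE ?exprn_gt0//.
  by rewrite ler_pXn2r ?nnegrE// ltW.
have S1 : `|2 * beta * m / s ^+ 2| <= 2 * beta / sm ^+ 2.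
  rewrite normrM; apply: ler_pM => //.
    by rewrite normrM gtr0_norm ?mulr_gt0// -[leRHS]mulr1 ler_pM2l ?mulr_gt0.
  rewrite gtr0_norm ?invr_gt0 ?exprn_gt0// lef_pV2 ?posrE ?exprn_gt0//.
  by rewrite ler_pXn2r ?nnegrE// ltW.
split.
  apply: le_trans T1 _; rewrite ler_pM2r//.
  have p1 : 0 < C2 * B by exact: mulr_gt0.
  have p2 : 0 < C1 * B by exact: mulr_gt0.
  by move: C30; lra.
rewrite (_ : _ - _ = (sA^-1 - s^-1 - lam * (2 * beta * m / s ^+ 2 * u)) * w1 +
  lam * (2 * beta * m / s ^+ 2 * u * (w1 - mu)) + lam * (P * (sA^-1 - s^-1))); last first.
  by move: (2 * beta * m / s ^+ 2) (s^-1) (sA^-1) => x y z; ring.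
have U1 : `|(sA^-1 - s^-1 - lam * (2 * beta * m / s ^+ 2 * u)) * w1| <= C2 * B * lam ^+ 2.
  by rewrite normrM [leRHS]mulrAC; apply: ler_pM.
have U2 : `|lam * (2 * beta * m / s ^+ 2 * u * (w1 - mu))| <= C3 * lam ^+ 2.
  rewrite normrM (gtr0_norm l0) (_ : C3 * lam ^+ 2 = lam * (2 * beta / sm ^+ 2 * B * (B * lam))); last by rewrite /C3; field; rewrite gt_eqF.
  by rewrite ler_pM2l// normrM; apply: ler_pM => //; rewrite normrM; apply: ler_pM.
have U3 : `|lam * (P * (sA^-1 - s^-1))| <= C1 * B * lam ^+ 2.
  rewrite normrM (gtr0_norm l0) (_ : C1 * B * lam ^+ 2 = lam * (B * (C1 * lam))); last by ring.
  by rewrite ler_pM2l// normrM; apply: ler_pM.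
rewrite (le_trans (ler_normD _ _))// (le_trans (lerD (ler_normD _ _) (lexx _)))//.
have p : 0 < C1 * lam ^+ 2 by exact: mulr_gt0.
by lra.
Qed.

(** * The ansatz *)

Lemma normr_half_le (R : realType) (x b : R) : `|x| <= b -> `|x / 2| <= b.
Proof.
move=> h; rewrite normrM [`|2^-1|]gtr0_norm// ler_pdivrMr//; apply: (le_trans h).
by rewrite ler_peMr ?ler1n//; exact: le_trans (normr_ge0 x) h.
Qed.

Lemma sixteenth_le (R : realType) (l c : R) : 0 < l -> l <= c / 16 -> 8 * l < c /\ 16 * l <= c.
Proof. by move=> *; split; lra. Qed.

Lemma sum5_ge (R : realType) (a b c d e : R) : 0 <= a -> 0 <= b -> 0 <= c -> 0 <= d -> 0 <= e ->
  let B := 1 + a + b + c + d + e in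
  [/\ 0 < B, a + b <= B, b <= B, c <= B & d <= B /\ e <= B].
Proof. by move=> a0 b0 c0 d0 e0 B; rewrite /B; split; last split; lra. Qed.

(** Inside an interaction disc the slowly varying coefficients can be frozen. *)
Lemma ansatz_freeze (R : realType) (lam t m ph p1 k k' g g' f f' b1 b2 b3 BZ Bp : R) : 0 < lam ->
  `|t * m| <= BZ -> `|ph| <= Bp -> `|p1| <= Bp ->
  `|k' - k| <= b1 * lam -> `|g' - g| <= b2 * lam -> `|f' - f| <= b3 * lam ->
  `|m * (1 + k' * (lam * t) / 2) + lam * (ph * g' + p1 * f')
     - (m + lam * (k / 2 * (t * m) + (g * ph + f * p1)))|
    <= (b1 * BZ + b2 * Bp + b3 * Bp) * lam ^+ 2.
Proof.
move=> l0 tB phB p1B kB gB fB.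
rewrite (_ : _ - _ = lam * ((k' - k) / 2 * (t * m) + (g' - g) * ph + (f' - f) * p1)); last by field.
rewrite normrM (gtr0_norm l0) expr2 [leRHS]mulrCA ler_pM2l//.
rewrite (le_trans (ler_normD _ _))// (le_trans (lerD (ler_normD _ _) (lexx _)))//.
have s1 : `|(k' - k) / 2 * (t * m)| <= b1 * lam * BZ.
  rewrite normrM; apply: ler_pM => //; apply: le_trans kB.
  by rewrite normrM [`|2^-1|]gtr0_norm// ler_pdivrMr// ler_peMr// ler1n.
have s2 : `|(g' - g) * ph| <= b2 * lam * Bp by rewrite normrM; apply: ler_pM.
have s3 : `|(f' - f) * p1| <= b3 * lam * Bp by rewrite normrM; apply: ler_pM.
by apply: le_trans (lerD (lerD s1 s2) s3) _; lra.
Qed.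

Lemma average_assembly (R : realType) (lam E kZ kh k1 ph p1 m h d g f k z s isA Cb CP CA CW : R) :
  0 < lam -> `|g| <= Cb -> `|f| <= Cb ->
  `|kh - (ph / s + d * (h * m))| <= CP * lam -> `|k1 - (p1 / s + d * (1 * m))| <= CP * lam ->
  `|E - (m / s * (1 + lam * k * z / 2) - lam * k / 2 * kZ
     + lam * (k / 2 * kZ + (g * kh + f * k1)))| <= CA * lam ^+ 2 ->
  `|(m * (1 + k * (lam * z) / 2) + lam * (ph * g + p1 * f)) * isA -
     (m * (1 + k * (lam * z) / 2) / s + lam * ((ph * g + p1 * f) / s + d * ((h * g + f) * m)))|
     <= CW * lam ^+ 2 ->
  `|E - (m * (1 + k * (lam * z) / 2) + lam * (ph * g + p1 * f)) * isA|
    <= (CW + CA + 2 * Cb * CP) * lam ^+ 2.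
Proof.
move=> l0 gB fB h1 h2.
set A := kh - _ in h1; set B := k1 - _ in h2; set X := E - _; set Y := _ * isA - _ => T f2.
have D : `|g * A + f * B| <= 2 * Cb * (CP * lam).
  have t1 : `|g * A| <= Cb * (CP * lam) by rewrite normrM; apply: ler_pM.
  have t2 : `|f * B| <= Cb * (CP * lam) by rewrite normrM; apply: ler_pM.
  by rewrite (le_trans (ler_normD _ _))//; lra.
rewrite (_ : E - _ = X - Y + lam * (g * A + f * B)); last first.
  by rewrite /X /Y /A /B; move: (s^-1) => v; field.
rewrite (le_trans (ler_normD _ _))// (le_trans (lerD (ler_normB _ _) (lexx _)))//.
rewrite normrM (gtr0_norm l0).
have : lam * `|g * A + f * B| <= lam * (2 * Cb * (CP * lam)) by rewrite ler_pM2l.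
by lra.
Qed.

Section Super.
Context {R : realType}.
Variables (beta : R) (hbeta : 1 < beta) (mb : R) (hmb : 0 < mb) (hmb_eq : mb = tanh (beta * mb)).
Variables (J : R * R -> R) (hJ : interaction_kernel J).
Variables (mbar : R -> R) (hmbar : instanton beta J mb mbar).
Variables (Omega Omegam : set (R * R)) (L d0 : R) (gamma nu : R -> R * R)
  (kap : R -> R) (sc : R * R -> R).
Hypothesis hgeo : geometry Omega Omegam L d0 gamma nu kap sc.
Variables (lam0 : R) (h1 g : R -> R) (phi : R * R -> R) (q mA : R -> R * R -> R).
Hypothesis hmA : approx_family beta mb mbar Omega Omegam L d0 gamma sc lam0 h1 g phi q mA.
Notation cSq f := {within Sq, continuous f}.
Notation Gam := (range gamma).
Notation r := (sdist Omegam Gam).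
Notation mu := (mu mbar).
Notation sg := (sg beta mbar).
Notation K := (Jstar J).
Notation kp := (parallel_curv Omegam gamma kap sc).
Notation frame_pt := (frame_pt nu sc).

Let d00 : 0 < d0 := geo_d0 hgeo.
Let mu0 z : 0 < mu z := mu_gt0 hbeta hmb hmb_eq hJ hmbar z.

(** The approximate null function: [mu] with its curvature factor, plus the
correctors for the two first-order terms [h1 g] and [phi] of [m_A]. *)
Definition ansatz (lam : R) (psih psi1 : R -> R) (xi : R * R) : R :=
  mu (r xi / lam) * (1 + kp xi * r xi / 2)
  + lam * (psih (r xi / lam) * g (sc xi) + psi1 (r xi / lam) * phi xi).

Definition is_corrector (C lam : R) (b psi : R -> R) :=
  [/\ continuous psi, forall z, `|psi z| <= C * Num.sqrt (mu z) &
    forall z, `|K psi z - (psi z / sg z + dinv_sigma beta mbar z * (b z * mu z))| <= C * lam].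

Lemma g_Lipschitz : exists2 B : R, 0 <= B & forall s s', `|g s' - g s| <= B * `|s' - s|.
Proof.
have [H _] := fam_g_C3 hmA.
have dg (t : R) : is_derive t 1 g (derive1 g t).
  by have /derivableP := H 0%N isT t; rewrite derive1E.
have cg : continuous (derive1 g : R -> R).
  by move=> t; apply/differentiable_continuous/derivable1_diffP; exact: (H 1%N isT t).
have [B HB] := periodic_bounded (curve_length (geo_curve hgeo)) (derive1_periodic (fam_g_periodic hmA)) cg.
exists B; first by apply: le_trans (HB 0).
by move=> s s'; apply: Lipschitz_of_derive => // t _; exact: HB.
Qed.

Lemma h1_cont : continuous h1.
Proof.
have [H _] := fam_h1_C1 hmA.
by move=> t; apply/differentiable_continuous/derivable1_diffP; exact: (H 0%N isT t).
Qed.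

(** Makes the curvature correction bounded although it contains [z]. *)
Lemma zmu_bounded : exists2 B : R, 0 < B & forall z, `|z * mu z| <= B.
Proof.
have [C C0 HC] := mu_decay hbeta hmb hmb_eq hJ hmbar.
have [M M0 HM] := mu_bounds hbeta hmb hmb_eq hJ hmbar.
exists (M + C); first exact: addr_gt0.
move=> z; rewrite normrM (gtr0_norm (mu0 z)); have [muM _ _] := HM z; have hC := HC z.
have hz : `|z| <= 1 + z ^+ 2.
  have := sqr_ge0 (`|z| - 1); rewrite sqrrB real_normK ?num_real// expr1n mulr1.
  by have := sqr_ge0 z; move: (z ^+ 2) => *; lra.
apply: (@le_trans _ _ ((1 + z ^+ 2) * mu z)); first by rewrite ler_pM2r.
by rewrite mulrDl mul1r [z ^+ 2 * _]mulrC lerD.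
Qed.

Lemma psi_bounded (CP lam : R) (b psi : R -> R) (M : R) : 0 < CP -> (forall z, mu z <= M) ->
  is_corrector CP lam b psi -> forall z, `|psi z| <= CP * Num.sqrt M.
Proof.
by move=> CP0 muM [_ H _] z; apply: le_trans (H z) _; rewrite ler_pM2l// ler_wsqrtr.
Qed.

Lemma Jstar_linear3 (a b c : R) (f1 f2 f3 : R -> R) z : continuous f1 -> continuous f2 -> continuous f3 ->
  K (fun t => a * f1 t + (b * f2 t + c * f3 t)) z = a * K f1 z + (b * K f2 z + c * K f3 z).
Proof.
move=> c1 c2 c3; have cc (a' : R) (f : R -> R) : continuous f -> continuous (fun t => a' * f t).
  by move=> cf t; apply: cvgM; [exact: cvg_cst|exact: cf].
rewrite -(EavZ hJ a (cSq_shift z c1)) -(EavZ hJ b (cSq_shift z c2)) -(EavZ hJ c (cSq_shift z c3)).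
have s1 := cSq_shift z (cc a _ c1); have s2 := cSq_shift z (cc b _ c2); have s3 := cSq_shift z (cc c _ c3).
by rewrite /Jstar (EavD hJ s1 (within_contD s2 s3)) (EavD hJ s2 s3).
Qed.

(** Both [J^lam * w0] and [w0 / sigma(m_A)] have the same expansion up to
[O(lam^2)]: the former by [Eav_ansatz] and the corrector equations, the latter
by [weight_expansion]. *)
Lemma inner_estimate (CP : R) : 0 < CP -> exists l1 C : R, [/\ 0 < l1, l1 <= lam0, 0 < C &
  forall lam psih psi1, 0 < lam <= l1 ->
  is_corrector CP lam h1 psih -> is_corrector CP lam (fun=> 1) psi1 ->
  {within tube Gam d0, continuous (ansatz lam psih psi1)} /\
  forall xi, `|r xi| <= 3 / 4 * d0 ->
  [/\ cSq (fun u => ansatz lam psih psi1 (frame_pt lam xi u)),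
     `|(sigma beta (mA lam xi))^-1 - (sg (r xi / lam))^-1| <= C * lam &
     `|Eav J (fun u => ansatz lam psih psi1 (frame_pt lam xi u)) -
       ansatz lam psih psi1 xi / sigma beta (mA lam xi)| <= C * lam ^+ 2]].
Proof.
move=> CP0.
have [c [C [c0 C0 Hcmp]]] := chart_comparison hgeo.
have [M M0 HM] := mu_bounds hbeta hmb hmb_eq hJ hmbar.
have muM z : mu z <= M by have [] := HM z.
have mu'M z : `|mu' mbar z| <= M by have [] := HM z.
have mu''M z : `|mu'' mbar z| <= M by have [] := HM z.
have [BZ BZ0 HBZ] := zmu_bounded.
have [H HH] := fam_h1_bounded hmA.
have [Cb HCb] := fam_bounded hmA.
have [a [a0 Ha]] := fam_sigma hmA.
have /andP[l00 l01] := fam_lam0 hmA.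
have [B1 B10 L1] := tube_Lipschitz_parallel_curv hgeo C0 Hcmp.
have [Bg Bg0 Lg] := g_Lipschitz.
have L2 := tube_Lipschitz_sc Hcmp Bg0 (fam_g_periodic hmA) Lg; set B2 := Bg * C in L2.
have B20 : 0 <= B2 by rewrite mulr_ge0// ltW.
have [B3' L3'] := fam_phi_Lip hmA.
pose B3 := `|B3'|; have B30 : 0 <= B3 by exact: normr_ge0.
have L3 : tube_Lipschitz d0 gamma c phi B3.
  move=> x y tx ty _; rewrite enormB; apply: le_trans (_ : B3' * enorm (x - y) <= _).
    by rewrite distrC; exact: L3'.
  by rewrite ler_wpM2r ?enorm_ge0// ler_norm.
have [B4 B40 L4] := tube_Lipschitz_nu hgeo C0 Hcmp.
pose Bp := CP * Num.sqrt M; have Bp0 : 0 <= Bp by rewrite mulr_ge0 ?sqrtr_ge0// ltW.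
have Cb0 : 0 <= Cb.
  have gam0 : tube Gam d0 (gamma 0).
    apply: le_trans (edist_set_le (A := Gam) _ (ex_intro2 _ _ 0 I erefl)) _.
    by rewrite subrr /enorm /dotp /= mulr0 addr0 sqrtr0 ltW.
  have lam00 : 0 < lam0 <= lam0 by rewrite l00 lexx.
  by apply: le_trans (HCb lam0 lam00 _ gam0); rewrite !addr_ge0.
have i0 : 0 < d0^-1 by rewrite invr_gt0.
pose BPhi := d0^-1 * BZ + (Cb * Bp + Cb * Bp).
pose cA := d0^-1 + 2 * B4 + (8 * C + d0^-1 * (8 * C + 16 * C ^+ 2)) + 2 * (B1 * BZ + B2 * Bp + B3 * Bp).
have c4 : 0 <= 2 * B4 by rewrite mulr_ge0 ?ltW.
have c5 : 0 <= 8 * C + d0^-1 * (8 * C + 16 * C ^+ 2).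
  by rewrite addr_ge0// ?mulr_ge0// ?addr_ge0 ?mulr_ge0 ?sqr_ge0 ?ltW.
have c6 : 0 <= 2 * (B1 * BZ + B2 * Bp + B3 * Bp) by rewrite mulr_ge0// !addr_ge0// mulr_ge0// ltW.
have cA1 : d0^-1 <= cA by rewrite /cA; lra.
have cA2 : 2 * B4 <= cA by rewrite /cA; lra.
have cA3 : 8 * C + d0^-1 * (8 * C + 16 * C ^+ 2) <= cA by rewrite /cA; lra.
have cA4 : 2 * B1 * BZ + 2 * B2 * Bp + 2 * B3 * Bp <= cA by rewrite /cA; lra.
have cA0 : 0 < cA by exact: lt_le_trans cA1.
clearbody cA.
have [CA CA0 HA] := Eav_ansatz hJ (is_derive_mu hmbar) (is_derive_mu' hmbar) (mu''_cont hmbar) mu'M mu''M BPhi cA0.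
have b0 : 0 < beta by apply: lt_trans hbeta.
have sm0 := sgmin_gt0 hbeta hmb hmb_eq.
have H0 : 0 <= H by apply: le_trans (HH 0).
have e1 : 0 <= H * Cb by exact: mulr_ge0.
have e2 : 0 <= d0^-1 * BZ by rewrite mulr_ge0 ?ltW.
have e3 : 0 <= Bp * Cb + Bp * Cb by rewrite addr_ge0// mulr_ge0.
have e4 : 0 <= M * 2 by rewrite mulr_ge0// ltW.
have := sum5_ge e1 Cb0 e4 e2 e3; set B := _ + (_ + _) => -[B0 D1 D2 D3 [D4 D5]].
clearbody B.
have [CW CW0 HW] := weight_expansion b0 a0 sm0 B0.
pose l1 := Num.min lam0 (Num.min (c / 16) (d0 / 16)).
have l10 : 0 < l1 by rewrite /l1 !lt_min l00 !divr_gt0.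
exists l1, (CW + CA + 2 * Cb * CP); split => //.
- by rewrite /l1 ge_min lexx.
- by rewrite ltr_pwDl// ?mulr_ge0 ?addr_gt0// ltW.
move=> lam psih psi1 /andP[lamp laml] hh hp1.
have laml0 : lam <= lam0 by apply: le_trans laml _; rewrite /l1 ge_min lexx.
have lam1 : lam <= 1 by exact: le_trans l01.
have lamc : 8 * lam < c.
  have H1 : lam <= c / 16 by apply: le_trans laml _; rewrite /l1 !ge_min lexx orbT.
  by have [] := sixteenth_le lamp H1.
have lamd : 16 * lam <= d0.
  have H1 : lam <= d0 / 16 by apply: le_trans laml _; rewrite /l1 !ge_min lexx !orbT.
  by have [] := sixteenth_le lamp H1.
have lamP : 0 < lam <= lam0 by rewrite lamp.
have hhB t : `|psih t| <= Bp := psi_bounded CP0 muM hh t.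
have hpB t : `|psi1 t| <= Bp := psi_bounded CP0 muM hp1 t.
clearbody Bp.
have [ch hh1 hhK] := hh; have [cp hp2 hpK] := hp1.
have muc := mu_cont hmbar.
have Cg x : tube Gam d0 x -> `|g (sc x)| <= Cb.
  by move=> tx; apply: le_trans (HCb _ lamP _ tx); rewrite -addrA lerDl addr_ge0.
have Cphi x : tube Gam d0 x -> `|phi x| <= Cb.
  by move=> tx; apply: le_trans (HCb _ lamP _ tx); rewrite addrAC lerDr addr_ge0.
have Cq x : tube Gam d0 x -> `|q lam x| <= Cb.
  by move=> tx; apply: le_trans (HCb _ lamP _ tx); rewrite lerDr addr_ge0.
have combo (A : set (R * R)) (f1 f2 f3 f4 : R * R -> R) : {within A, continuous f1} ->
  {within A, continuous f2} -> {within A, continuous f3} -> {within A, continuous f4} ->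
  {within A, continuous (fun p => mu (f1 p / lam) * (1 + f2 p * f1 p / 2)
    + lam * (psih (f1 p / lam) * f3 p + psi1 (f1 p / lam) * f4 p))}.
  move=> w1 w2 w3 w4.
  have wz : {within A, continuous (fun p => f1 p / lam)} by apply: within_contM => //; exact: within_cont_cst.
  apply: within_contD.
    apply: within_contM; first by exact: within_cont_comp muc wz.
    by apply: within_contD; [exact: within_cont_cst|apply: within_contM; [exact: within_contM|exact: within_cont_cst]].
  apply: within_contM; first exact: within_cont_cst.
  by apply: within_contD; apply: within_contM => //; [exact: within_cont_comp ch wz|exact: within_cont_comp cp wz].
split.
  by apply: combo; apply: (locally_Lipschitz_continuous c0);
    [exact: (tube_Lipschitz_sdist Hcmp)|exact: L1|exact: L2|exact: L3].
move=> xi xid.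
have txi := xi_tube hgeo xid.
have pl f Bf := @pull_cSq _ _ _ _ _ _ _ _ _ hgeo c c0 lam xi lamp lamd xid f Bf.
have pn f Bf u := @pull_near _ _ _ _ _ _ _ _ _ hgeo c lam xi lamp lamc lamd xid f Bf u.
have cw : cSq (fun u => ansatz lam psih psi1 (frame_pt lam xi u)).
  exact: (combo Sq (fun u => r (frame_pt lam xi u)) (fun u => kp (frame_pt lam xi u)) (fun u => g (sc (frame_pt lam xi u)))
    (fun u => phi (frame_pt lam xi u)) (pl _ _ (tube_Lipschitz_sdist Hcmp)) (pl _ _ L1) (pl _ _ L2) (pl _ _ L3)).
have [k1 k2] := parallel_curv_bounds hgeo txi.
set z := r xi / lam.
have zE : r xi = lam * z by rewrite /z mulrCA divff ?mulr1// gt_eqF.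
pose Zf (t : R) := t * mu t.
have cZ : continuous Zf by move=> t; apply: cvgM; [exact: cvg_id|exact: muc].
(* coefficients frozen at the centre of the disc *)
pose Phi t := kp xi / 2 * Zf t + (g (sc xi) * psih t + phi xi * psi1 t).
have k2' : `|kp xi / 2| <= d0^-1.
  exact: normr_half_le k1.
have cPhi : continuous Phi.
  have cc (a' : R) (f : R -> R) : continuous f -> continuous (fun t => a' * f t).
    by move=> cf t; apply: cvgM; [exact: cvg_cst|exact: cf].
  move=> t; apply: cvgD; first exact: (cc _ _ cZ).
  by apply: cvgD; [exact: (cc _ _ ch)|exact: (cc _ _ cp)].
have PhiB t : `|Phi t| <= BPhi.
  rewrite (le_trans (ler_normD _ _))// lerD//.
    by rewrite normrM; apply: ler_pM => //; exact: HBZ.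
  by rewrite (le_trans (ler_normD _ _))// lerD// normrM; apply: ler_pM => //; [exact: Cg|exact: Cphi].
have crho := pull_rho_cSq hgeo c0 Hcmp lamp lamd xid.
have [cth Hth] := pull_th hgeo c0 C0 Hcmp lamp lamc lamd xid.
have Wd u : Sq u -> `|ansatz lam psih psi1 (frame_pt lam xi u) -
    (mu (r (frame_pt lam xi u) / lam) + lam * Phi (r (frame_pt lam xi u) / lam))| <= cA * lam ^+ 2.
  move=> Su; have q1 := pn _ _ u (ltW B10) L1 Su; have q2 := pn _ _ u B20 L2 Su.
  have q3 := pn _ _ u B30 L3 Su.
  rewrite /ansatz; set t := r (frame_pt lam xi u) / lam.
  have -> : r (frame_pt lam xi u) = lam * t by rewrite /t mulrCA divff ?mulr1// gt_eqF.
  apply: le_trans (ansatz_freeze lamp (HBZ t) (hhB t) (hpB t) q1 q2 q3) _.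
  by rewrite ler_pM2r ?exprn_gt0.
have kA : `|kp xi| <= cA by exact: le_trans k1 _.
have lamP1 : 0 < lam <= 1 by rewrite lamp.
have T := HA lam (kp xi) z _ _ _ Phi lamP1 kA cPhi PhiB crho cth cw
  (pull_derive hgeo C0 Hcmp lamp lamc lamd xid).
have {}T := T _ _ Wd.
have {}T : `|Eav J (fun u => ansatz lam psih psi1 (frame_pt lam xi u)) -
   (K mu z * (1 + lam * kp xi * z / 2) - lam * kp xi / 2 * K Zf z + lam * K Phi z)| <= CA * lam ^+ 2.
  apply: T => x y x1 y1.
    have Sxy : Sq (x, y) by apply/SqE.
    by apply: le_trans (Hth B4 (ltW B40) L4 _ Sxy) _; rewrite ler_pM2r.
  apply: le_trans (pull_rho hgeo C0 Hcmp lamp lamc lamd xid lam1 x1 y1) _.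
  by rewrite ler_pM2r ?exprn_gt0.
have KPhi : K Phi z = kp xi / 2 * K Zf z + (g (sc xi) * K psih z + phi xi * K psi1 z).
  exact: Jstar_linear3.
have muE' := mu_eq hJ hmbar z.
have sz0 : 0 < sg z by exact: (sg_gt0 hbeta hmb hmb_eq hmbar).
have KmuE : K mu z = mu z / sg z by rewrite [in RHS]muE' mulrAC divff ?mul1r// gt_eqF.
pose w1 := mu z * (1 + kp xi * r xi / 2).
pose P := psih z * g (sc xi) + psi1 z * phi xi.
pose u0 := h1 z * g (sc xi) + phi xi.
have Oxi : Omega xi by exact: (geo_tube_sub hgeo).
have [f1 f2] : `|(sigma beta (mA lam xi))^-1 - (sg z)^-1| <= CW * lam /\
   `|(w1 + lam * P) / sigma beta (mA lam xi) -
     (w1 / sg z + lam * (P / sg z + 2 * beta * mbar z / sg z ^+ 2 * (u0 * mu z)))| <= CW * lam ^+ 2.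
  apply: (HW lam (mbar z) u0 (q lam xi)) => //.
  - by apply: le_trans (mbar_norm hmbar z) (ltW (mb_lt1 hmb_eq)).
  - apply: le_trans D1; rewrite (le_trans (ler_normD _ _))// normrM lerD//; last exact: Cphi.
    by apply: ler_pM => //; exact: Cg.
  - by apply: le_trans (Cq _ txi) _.
  - rewrite /w1 normrM (gtr0_norm (mu0 z)).
    have k3 : `|1 + kp xi * r xi / 2| <= 2.
      by rewrite (le_trans (ler_normD _ _))// normr1 -[leRHS]/(1 + 1) lerD2l; exact: normr_half_le.
    by apply: le_trans D3; apply: ler_pM => //; exact: ltW.
  - rewrite (_ : w1 - mu z = kp xi / 2 * (z * mu z) * lam); last first.
      by rewrite /w1 zE; move: (mu z) (kp xi) => *; field.
    rewrite normrM (gtr0_norm lamp) ler_pM2r// normrM.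
    by apply: le_trans D4; apply: ler_pM => //; exact: HBZ.
  - apply: le_trans D5; rewrite (le_trans (ler_normD _ _))// !normrM lerD//.
      by apply: ler_pM => //; exact: Cg.
    by apply: ler_pM => //; exact: Cphi.
  - exact: (sg_ge hbeta hmb hmbar).
  - by have /andP[] := Ha lam lamP xi Oxi.
  - by rewrite (fam_expansion hmA lamP txi).
split => //.
  by apply: le_trans f1 _; rewrite ler_pM2r// -addrA lerDl addr_ge0 ?mulr_ge0// ltW.
rewrite -[ansatz lam psih psi1 xi]/(w1 + lam * P).
move: T; rewrite KPhi KmuE => T.
move: f2; rewrite /w1 /P /u0 zE => f2.
exact: (average_assembly lamp (Cg _ txi) (Cphi _ txi) (hhK z) (hpK z) T f2).
Qed.
End Super.

(** * Change of frame and comparison inequalities *)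

Section ScaledAverage.
Context {R : realType}.
Notation RR := (measurableTypeR R * measurableTypeR R)%type.
Notation cSq f := {within Sq, continuous f}.
Variables (J : R * R -> R) (hJ : interaction_kernel J).

Lemma Eav_EFin (f : R * R -> R) : cSq f ->
  (\int[mu2]_(u in (Sq : set RR)) (J u * f u)%:E)%E = (Eav J f)%:E.
Proof.
move=> cf; rewrite /Eav /Rintegral fineK//.
by apply: integrable_fin_num; [exact: Sq_measurable|exact: Eav_int].
Qed.

Variables (lam : R) (xi n : R * R).
Hypotheses (lam0 : 0 < lam) (n1 : n.1 ^+ 2 + n.2 ^+ 2 = 1).
Let P (u : RR) : RR := (xi.1 + lam * (n.1 * u.1 - n.2 * u.2), xi.2 + lam * (n.2 * u.1 + n.1 * u.2)).

Lemma Jscaled_cont : continuous (fun y : R * R => Jscaled J lam (xi - y)).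
Proof.
move=> y; apply: cvgM; first exact: cvg_cst.
have c1 : continuous (fun y : R * R => (xi.1 - y.1) / lam).
  by move=> z; apply: cvgM; [apply: cvgB; [exact: cvg_cst|exact: cvg_fst]|exact: cvg_cst].
have c2 : continuous (fun y : R * R => (xi.2 - y.2) / lam).
  by move=> z; apply: cvgM; [apply: cvgB; [exact: cvg_cst|exact: cvg_snd]|exact: cvg_cst].
apply: (@continuous_comp _ _ _ (fun y : R * R => ((xi.1 - y.1) / lam, (xi.2 - y.2) / lam)) J).
  exact: (cvg_pair (c1 y) (c2 y)).
exact: (J_cont hJ).
Qed.

Lemma Jscaled_pt (u : RR) : Jscaled J lam (xi - P u) = lam ^- 2 * J u.
Proof.
rewrite /Jscaled; congr (_ * _); case: u => x y; apply: (J_radial hJ); rewrite /P /=.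
have ln : lam != 0 by rewrite gt_eqF.
rewrite (_ : (_ / _) ^+ 2 + _ = (n.1 ^+ 2 + n.2 ^+ 2) * (x ^+ 2 + y ^+ 2)); first by rewrite n1 mul1r.
by move: (n.1) (n.2) (xi.1) (xi.2) => *; field.
Qed.

Lemma measurable_pt (w : RR -> R) : measurable_fun setT w -> measurable_fun setT (fun u : RR => w (P u)).
Proof.
move=> mw.
apply/measurable_EFinP; apply: (@measurable_fun_comp2 _ (EFin \o w) (fun u => (P u).1) (fun u => (P u).2)).
- exact/measurable_EFinP.
- have -> : (fun u : RR => (P u).1) = (fun u : R * R => (lam * n.1) * u.1 + (- (lam * n.2)) * u.2 + xi.1).
      by apply/funext => u; rewrite /P /=; ring.
    exact: continuous_affine2.
- have -> : (fun u : RR => (P u).2) = (fun u : R * R => (lam * n.2) * u.1 + (lam * n.1) * u.2 + xi.2).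
      by apply/funext => u; rewrite /P /=; ring.
    exact: continuous_affine2.
Qed.

(** The frame of [frame_pt] differs from the standard one by a similarity, which
the radial kernel does not see. *)
Lemma scaled_average (w : RR -> R) : measurable_fun setT w -> (forall y, 0 <= w y) ->
  (\int[mu2]_y (Jscaled J lam (xi - y) * w y)%:E = \int[mu2]_(u in (Sq : set RR)) (J u * w (P u))%:E)%E.
Proof.
move=> mw w0.
have J0 u : 0 <= J u := kernel_ge0 hJ u.
have mJl : measurable_fun setT (fun y : RR => Jscaled J lam (xi - y)).
  exact: continuous_measurable2 Jscaled_cont.
have mf : measurable_fun setT (fun y : RR => (Jscaled J lam (xi - y) * w y)%:E).
  by apply/measurable_EFinP; exact: measurable_funM.
rewrite -(@ge0_integral_similarity _ _ n.1 n.2 lam xi.1 xi.2 n1 lam0 mf); last first.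
  move=> y; rewrite lee_fin mulr_ge0// /Jscaled mulr_ge0// invr_ge0 exprn_ge0//; exact: ltW.
have mP := measurable_pt mw.
have mJ : measurable_fun setT (J : RR -> R) by exact: continuous_measurable2 (J_cont hJ).
rewrite -ge0_integralZl//; last 3 first.
- have -> : (fun u : RR => (Jscaled J lam (xi - P u) * w (P u))%:E) = (fun u => (lam ^- 2 * J u * w (P u))%:E).
    by apply/funext => u; rewrite Jscaled_pt.
  by apply/measurable_EFinP; apply: measurable_funM => //; apply: measurable_funM.
- move=> u _; rewrite lee_fin mulr_ge0// -/(P u) Jscaled_pt mulr_ge0// invr_ge0 exprn_ge0//; exact: ltW.
- by rewrite lee_fin sqr_ge0.
rewrite [RHS]integral_mkcond; apply: eq_integral => u _; rewrite -/(P u) Jscaled_pt patchE.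
case: ifPn => [_|].
  by rewrite -EFinM; congr EFin; rewrite !mulrA mulfV ?mul1r// expf_neq0// gt_eqF.
by move=> /negP uS; rewrite (J_offSq hJ) ?mulr0 ?mul0r ?mule0// => Su; apply: uS; rewrite inE.
Qed.

Lemma scaled_average_le (w : RR -> R) (b : R) : measurable_fun setT w -> (forall y, 0 <= w y) ->
  (forall u, Sq u -> w (P u) <= b) -> (\int[mu2]_y (Jscaled J lam (xi - y) * w y)%:E <= b%:E)%E.
Proof.
move=> mw w0 wb; rewrite scaled_average//.
have -> : b%:E = (\int[mu2]_(u in (Sq : set RR)) (J u * b)%:E)%E.
  by rewrite (Eav_EFin (f := fun=> b)) ?(Eav_cst hJ)//; exact: within_cont_cst.
have J0 u : 0 <= J u := kernel_ge0 hJ u.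
have mJ : measurable_fun setT (J : RR -> R) by exact: continuous_measurable2 (J_cont hJ).
apply: ge0_le_integral.
- exact: Sq_measurable.
- by move=> u _; rewrite lee_fin mulr_ge0.
- by apply/measurable_EFinP/measurable_funTS/measurable_funM => //; exact: measurable_pt.
- by apply/measurable_EFinP/measurable_funTS/measurable_funM.
- by move=> u Su; rewrite lee_fin ler_wpM2l// wb.
Qed.

End ScaledAverage.

(** Far from the interface the constant part of the weight absorbs the error. *)
Lemma slack_far (R : realType) (l2 Kc A0 isA q isg eta C2 l D : R) : 0 < l2 -> 0 <= l -> 0 < q -> q < 1 ->
  q^-1 <= isg -> eta = (q^-1 - 1) / 2 -> `|isA - isg| <= C2 * l -> C2 * l <= eta -> C2 <= eta * Kc ->
  0 <= Kc -> 0 <= D -> 0 <= l2 * Kc + A0 ->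
  l2 * Kc + (A0 * isA + C2 * l2) <= (isA + D * l2) * (l2 * Kc + A0).
Proof.
move=> l20 l0 q0 q1 hg etaE hA hl hK Kc0 D0 w0.
have iA : 1 + eta <= isA.
  by move: hA; rewrite ler_norml => /andP[h _]; rewrite etaE in hl *; lra.
have h1 : l2 * (1 * Kc + C2) <= l2 * (isA * Kc).
  rewrite ler_pM2l//; apply: le_trans (_ : (1 + eta) * Kc <= _); last exact: ler_wpM2r.
  by rewrite mulrDl lerD2l.
have h2 : 0 <= D * l2 * (l2 * Kc + A0) by rewrite mulr_ge0// mulr_ge0// ltW.
by move: h1 h2; rewrite mulrDl; lra.
Qed.

(** Where [mu] is bounded below, the error is absorbed by [D lam^2 w]. *)
Lemma slack_near (R : realType) (l2 Kc A0 isA m m0 C2 : R) : 0 < l2 -> 0 < m0 -> m0 <= m -> 0 <= isA ->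
  m / 4 <= l2 * Kc + A0 -> 0 <= Kc -> 0 <= C2 ->
  l2 * Kc + (A0 * isA + C2 * l2) <= (isA + 4 * (Kc + C2) / m0 * l2) * (l2 * Kc + A0).
Proof.
move=> l20 m00 mm i0 w0 Kc0 C20.
have h : Kc + C2 <= 4 * (Kc + C2) / m0 * (l2 * Kc + A0).
  have hm : m0 / 4 <= l2 * Kc + A0 by apply: le_trans w0; rewrite ler_pM2r.
  apply: le_trans (_ : 4 * (Kc + C2) / m0 * (m0 / 4) <= _).
    by rewrite le_eqVlt; apply/orP; left; apply/eqP; field; rewrite gt_eqF.
  by apply: ler_wpM2l => //; rewrite divr_ge0 ?mulr_ge0 ?addr_ge0// ltW.
have h2 : l2 * (Kc + C2) <= l2 * (4 * (Kc + C2) / m0 * (l2 * Kc + A0)) by rewrite ler_pM2l.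
have h3 : 0 <= isA * (l2 * Kc) by rewrite mulr_ge0// mulr_ge0// ltW.
by move: h2 h3; move: (4 * (Kc + C2) / m0) => t; lra.
Qed.

Lemma slack_outer (R : realType) (l2 Kc w isA D Cs C5 E2 : R) : 0 < l2 -> 1 < Cs -> Cs <= isA -> 0 <= D ->
  l2 * (Kc - E2) <= w -> 0 <= w -> C5 + Cs * E2 <= (Cs - 1) * Kc ->
  l2 * (Kc + C5) <= (isA + D * l2) * w.
Proof.
move=> l20 Cs1 hA D0 hw w0 hK.
have h1 : Cs * (l2 * (Kc - E2)) <= isA * w.
  apply: le_trans (_ : Cs * w <= _); last exact: ler_wpM2r.
  by rewrite ler_pM2l//; lra.
have h2 : 0 <= D * l2 * w by rewrite mulr_ge0// mulr_ge0// ltW.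
have h3 : l2 * (Kc + C5) <= l2 * (Cs * (Kc - E2)) by rewrite ler_pM2l//; lra.
by lra.
Qed.

(** [l |P| <= l E sqrt m <= m / 4 + E^2 l^2], by completing the square. *)
Lemma ansatz_lower (R : realType) (m e P E l : R) : 0 <= m -> 2^-1 <= e -> 0 <= l -> `|P| <= E * Num.sqrt m ->
  m / 4 - E ^+ 2 * l ^+ 2 <= m * e + l * P.
Proof.
move=> m0 e1 l0; have mE : m = Num.sqrt m ^+ 2 by rewrite sqr_sqrtr.
have x0 := sqrtr_ge0 m; move: mE x0; set x : R := Num.sqrt m; clearbody x => -> x0 hP.
have h1 : x ^+ 2 * 2^-1 <= x ^+ 2 * e by rewrite ler_wpM2l// sqr_ge0.
have h2 : l * `|P| <= l * (E * x) by rewrite ler_wpM2l.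
have h3 : - (l * `|P|) <= l * P by rewrite -mulrN ler_wpM2l// lerNnormlW.
have := sqr_ge0 (x / 2 - E * l); rewrite sqrrB.
have -> : (x / 2) ^+ 2 = x ^+ 2 / 4 by field.
by rewrite exprMn; lra.
Qed.

(** Where [m] is of order [l^2], so is the whole ansatz. *)
Lemma ansatz_upper (R : realType) (m e P E l G : R) : 0 <= m -> `|e| <= 2 -> 0 <= l -> 0 <= G -> 0 <= E ->
  `|P| <= E * Num.sqrt m -> m <= (G * l) ^+ 2 -> m * e + l * P <= (2 * G ^+ 2 + E * G) * l ^+ 2.
Proof.
move=> m0 e1 l0 G0 E0 hP mG.
have sG : Num.sqrt m <= G * l.
  by rewrite -[leRHS](ger0_norm (mulr_ge0 G0 l0)) -sqrtr_sqr ler_wsqrtr.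
have h1 : m * e <= (G * l) ^+ 2 * 2.
  apply: le_trans (ler_norm _) _; rewrite normrM ger0_norm//; exact: ler_pM.
have h2 : l * P <= l * (E * (G * l)).
  rewrite ler_wpM2l// (le_trans (ler_norm _))// (le_trans hP)// ler_wpM2l//.
by rewrite exprMn in h1; lra.
Qed.

(** * The supersolution *)

Lemma outer_distances (R : realType) (d l a b : R) : 0 < d -> 16 * l <= d ->
  3 / 4 * d - 2 * l < a -> a <= b + 2 * l -> d / 4 <= b /\ d / 2 < a.
Proof. by move=> *; split; lra. Qed.

Lemma decay_bound (R : realType) (m d l C r : R) : 0 <= m -> 0 < d -> 0 < l -> 0 <= C ->
  m * (r / l) ^+ 2 <= C -> d / 4 <= `|r| -> m <= (4 * Num.sqrt C / d * l) ^+ 2.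
Proof.
move=> m0 d0 l0 C0 h hr.
have r2 : (d / 4) ^+ 2 <= r ^+ 2.
  by rewrite -(real_normK (num_real r)) ler_pXn2r// nnegrE// ?divr_ge0// ltW.
have h2 : m * r ^+ 2 <= C * l ^+ 2.
  by rewrite -ler_pdivrMr ?exprn_gt0// -mulrA -expr_div_n.
have -> : (4 * Num.sqrt C / d * l) ^+ 2 = C * l ^+ 2 / (d / 4) ^+ 2.
  by rewrite !exprMn sqr_sqrtr// !exprVn; field; rewrite gt_eqF.
rewrite ler_pdivlMr ?exprn_gt0 ?divr_gt0//; apply: le_trans h2.
by rewrite ler_wpM2l.
Qed.

Section Supersolution.
Context {R : realType}.
Notation RR := (measurableTypeR R * measurableTypeR R)%type.
Variables (beta : R) (hbeta : 1 < beta) (mb : R) (hmb : 0 < mb) (hmb_eq : mb = tanh (beta * mb)).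
Variables (J : R * R -> R) (hJ : interaction_kernel J).
Variables (mbar : R -> R) (hmbar : instanton beta J mb mbar).
Variables (Omega Omegam : set (R * R)) (L d0 : R) (gamma nu : R -> R * R)
  (kap : R -> R) (sc : R * R -> R).
Hypothesis hgeo : geometry Omega Omegam L d0 gamma nu kap sc.
Variables (lam0 : R) (h1 g : R -> R) (phi : R * R -> R) (q mA : R -> R * R -> R).
Hypothesis hmA : approx_family beta mb mbar Omega Omegam L d0 gamma sc lam0 h1 g phi q mA.
Notation cSq f := {within Sq, continuous f}.
Notation Gam := (range gamma).
Notation r := (sdist Omegam Gam).
Notation mu := (mu mbar).
Notation sg := (sg beta mbar).
Notation kp := (parallel_curv Omegam gamma kap sc).
Notation frame_pt := (frame_pt nu sc).
Notation ansatz := (ansatz mbar Omegam gamma kap sc g phi).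
Notation is_corrector := (is_corrector beta J mbar).
Notation d1 := (3 / 4 * d0).

Let d00 : 0 < d0 := geo_d0 hgeo.
Let mu0 z : 0 < mu z := mu_gt0 hbeta hmb hmb_eq hJ hmbar z.

Lemma is_correctorW (C C' lam : R) (b psi : R -> R) : 0 <= lam -> C <= C' ->
  is_corrector C lam b psi -> is_corrector C' lam b psi.
Proof.
move=> l0 CC [c1 c2 c3]; split => // z.
  by apply: le_trans (c2 z) _; rewrite ler_wpM2r// sqrtr_ge0.
by apply: le_trans (c3 z) _; rewrite ler_wpM2r.
Qed.

Lemma correctors : exists2 CP : R, 0 < CP & forall lam : R, 0 < lam -> exists psih psi1,
  is_corrector CP lam h1 psih /\ is_corrector CP lam (fun=> 1) psi1.
Proof.
have [H HH] := fam_h1_bounded hmA.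
have [C1 C10 P1] := corrector hbeta hmb hmb_eq hJ hmbar (h1_cont hmA) (fam_h1_even hmA) HH.
have c1 : continuous (fun _ : R => 1 : R) by move=> t; exact: cvg_cst.
have b1 (z : R) : `|(1 : R)| <= 1 by rewrite normr1.
have [C2 C20 P2] := corrector hbeta hmb hmb_eq hJ hmbar c1 (fun=> erefl) b1.
exists (C1 + C2); first exact: addr_gt0.
move=> lam l0; have [psih hh] := P1 lam l0; have [psi1 hp] := P2 lam l0.
exists psih, psi1; split.
  by apply: (is_correctorW (ltW l0) _ hh); rewrite lerDl ltW.
by apply: (is_correctorW (ltW l0) _ hp); rewrite lerDr ltW.
Qed.

Lemma mu_min (Z : R) : 0 < Z -> exists2 m0 : R, 0 < m0 & forall z, `|z| <= Z -> m0 <= mu z.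
Proof.
move=> Z0; have ZZ : - Z <= Z by lra.
have [c _ Hc] := EVT_min ZZ (continuous_subspaceT (mu_cont hmbar)).
by exists (mu c) => // z; rewrite ler_norml => h; apply: Hc; rewrite in_itv.
Qed.

Lemma stable_inv : exists2 Cs : R, 1 < Cs & forall lam : R, 0 < lam <= lam0 -> forall xi, Omega xi ->
  d0 / 2 < `|r xi| -> Cs <= (sigma beta (mA lam xi))^-1.
Proof.
have [Cs [Cs1 H]] := fam_stable hmA; exists Cs => // lam hl xi Oxi hr.
have h := H lam hl; rewrite -lee_fin; apply: (le_trans (ltW h)); apply: ereal_inf_lbound.
exists xi => //; split => //= t; have := (tubeE Omegam gamma (d0 / 2) xi).1 t.
by rewrite leNgt hr.
Qed.

(** The correctors are only controlled by [sqrt mu], not by [mu]. *)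
Lemma coefficient_bound (CP : R) : 0 < CP -> exists2 E : R, 0 <= E & forall (lam : R) psih psi1,
  0 < lam <= lam0 -> is_corrector CP lam h1 psih -> is_corrector CP lam (fun=> 1) psi1 ->
  forall xi, tube Gam d0 xi -> forall z,
  `|psih z * g (sc xi) + psi1 z * phi xi| <= E * Num.sqrt (mu z).
Proof.
move=> CP0; have [Cb HCb] := fam_bounded hmA; exists (CP * `|Cb|); first by rewrite mulr_ge0// ltW.
move=> lam psih psi1 hl [_ a1 _] [_ a2 _] xi txi z.
have hb := HCb lam hl xi txi; have := a1 z; have := a2 z.
have s0 := sqrtr_ge0 (mu z); move: s0; set x : R := Num.sqrt _ => x0 b2 b1.
have y0 : 0 <= CP * x by rewrite mulr_ge0// ltW.
rewrite (le_trans (ler_normD _ _))// !normrM.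
have t1 : `|psih z| * `|g (sc xi)| <= CP * x * `|g (sc xi)| by rewrite ler_wpM2r.
have t2 : `|psi1 z| * `|phi xi| <= CP * x * `|phi xi| by rewrite ler_wpM2r.
apply: le_trans (lerD t1 t2) _; rewrite -mulrDr [leRHS]mulrAC ler_wpM2l//.
by apply: le_trans (ler_norm Cb); apply: le_trans hb; rewrite lerDl.
Qed.

Lemma curv_factor xi : tube Gam d0 xi -> 2^-1 <= 1 + kp xi * r xi / 2 /\ `|1 + kp xi * r xi / 2| <= 2.
Proof.
move=> t; have [_ h] := parallel_curv_bounds hgeo t; move: h; rewrite ler_norml => /andP[h2 h3].
by rewrite ler_norml; split; [lra|apply/andP; split; lra].
Qed.

(** The cut of the ansatz at [3 d0 / 4] leaves room for interaction discs inside the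
tube of width [d0], and lies where [m_A] is already close to a pure phase. *)
Definition weight (lam Kc : R) (psih psi1 : R -> R) (xi : RR) : R :=
  lam ^+ 2 * Kc + (ansatz lam psih psi1 \_ (tube Gam d1)) xi.

Lemma tube_d1 xi : tube Gam d1 xi -> tube Gam d0 xi.
Proof. by move=> h; apply: le_trans h _; have := d00; lra. Qed.

Lemma weight_in lam Kc psih psi1 xi : `|r xi| <= d1 ->
  weight lam Kc psih psi1 xi = lam ^+ 2 * Kc + ansatz lam psih psi1 xi.
Proof. by move=> h; rewrite /weight patchE mem_set//; apply/(tubeE Omegam). Qed.

Lemma weight_out lam Kc psih psi1 xi : d1 < `|r xi| -> weight lam Kc psih psi1 xi = lam ^+ 2 * Kc.
Proof.
move=> h; rewrite /weight patchE memNset ?addr0// => t.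
by have := (tubeE Omegam gamma d1 xi).1 t; rewrite leNgt h.
Qed.

Lemma weight_measurable lam Kc psih psi1 :
  {within tube Gam d0, continuous (ansatz lam psih psi1)} -> measurable_fun setT (weight lam Kc psih psi1).
Proof.
move=> cw; apply: measurable_funD; first exact: measurable_cst.
have mt : measurable (tube Gam d1 : set RR) by apply: closed_measurable2; exact: tube_closed.
apply/(measurable_restrictT _ mt); apply: (within_continuous_measurable2 mt).
by apply: continuous_subspaceW cw => x; exact: tube_d1.
Qed.

Lemma supersolution : exists lam2 D : R, [/\ 0 < lam2, lam2 <= lam0, 0 < D &
  forall lam : R, 0 < lam <= lam2 -> exists w : RR -> R,
  [/\ measurable_fun setT w, forall x, 0 < w x & forall xi, Omega xi ->
   (\int[mu2]_y (Jscaled J lam (xi - y) * w y)%:E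
      <= (((sigma beta (mA lam xi))^-1 + D * lam ^+ 2) * w xi)%:E)%E]].
Proof.
have [CP CP0 HP] := correctors.
have [l1 [C2 [l10 l1le C20 HI]]] := inner_estimate hbeta hmb hmb_eq hJ hmbar hgeo hmA CP0.
have [E E0 HE] := coefficient_bound CP0.
have [Cd Cd0 HCd] := mu_decay hbeta hmb hmb_eq hJ hmbar.
have [Z0 [qq [Z00 qq0 qq1 Hq]]] := sg_tail hbeta hmb hmb_eq hmbar.
have [m0 m00 Hm0] := mu_min Z00.
have [Cs Cs1 HCs] := stable_inv.
have [a [a0 Ha]] := fam_sigma hmA.
pose eta := (qq^-1 - 1) / 2.
have eta0 : 0 < eta by rewrite divr_gt0// subr_gt0 invf_gt1.
have etaE : eta = (qq^-1 - 1) / 2 by []; clearbody eta.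
pose G := 4 * Num.sqrt Cd / d0.
have G0 : 0 <= G by rewrite divr_ge0 ?mulr_ge0 ?sqrtr_ge0// ltW.
pose C5 := 2 * G ^+ 2 + E * G.
have C50 : 0 <= C5 by rewrite addr_ge0// mulr_ge0// sqr_ge0.
(* the summands give in turn positivity, the slack for large [|z|], and the slack
   outside the tube *)
pose Kc := E ^+ 2 + 1 + C2 / eta + (C5 + Cs * E ^+ 2) / (Cs - 1).
have k1 : 0 <= C2 / eta by rewrite divr_ge0// ltW.
have E20 : 0 <= E ^+ 2 by exact: sqr_ge0.
have Cs0 : 0 < Cs by exact: lt_trans Cs1.
have Cs2 : 0 < Cs - 1 by rewrite subr_gt0.
have k2 : 0 <= (C5 + Cs * E ^+ 2) / (Cs - 1).
  apply: divr_ge0; last exact: ltW.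
  by apply: addr_ge0 => //; apply: mulr_ge0 => //; exact: ltW.
have KE : E ^+ 2 < Kc by rewrite /Kc; lra.
have Kc0 : 0 < Kc by exact: le_lt_trans KE.
have Keta : C2 <= eta * Kc by rewrite -ler_pdivrMl// mulrC /Kc; lra.
have KCs : C5 + Cs * E ^+ 2 <= (Cs - 1) * Kc by rewrite -ler_pdivrMl// mulrC /Kc; lra.
clearbody Kc.
pose lam2 := Num.min l1 (Num.min (eta / C2) (d0 / 16)).
exists lam2, (4 * (Kc + C2) / m0).
have D0 : 0 < 4 * (Kc + C2) / m0 by rewrite divr_gt0// mulr_gt0// addr_gt0.
split => //.
- by rewrite /lam2 !lt_min l10 !divr_gt0.
- by rewrite /lam2 ge_min l1le.
move=> lam /andP[l0 ll].
have ll1 : lam <= l1 by apply: le_trans ll _; rewrite /lam2 ge_min lexx.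
have lleta : C2 * lam <= eta.
  by rewrite mulrC -ler_pdivlMr//; apply: le_trans ll _; rewrite /lam2 !ge_min lexx !orbT.
have lld : 16 * lam <= d0.
  by rewrite mulrC -ler_pdivlMr//; apply: le_trans ll _; rewrite /lam2 !ge_min lexx !orbT.
have lP : 0 < lam <= lam0 by rewrite l0 (le_trans ll1).
have lP1 : 0 < lam <= l1 by rewrite l0.
have [psih [psi1 [ph p1]]] := HP lam l0.
have [cw HI2] := HI lam psih psi1 lP1 ph p1.
have HE2 := HE lam psih psi1 lP ph p1.
pose w := weight lam Kc psih psi1; exists w.
have l20 : 0 < lam ^+ 2 by rewrite exprn_gt0.
have w_tube xi : `|r xi| <= d1 -> mu (r xi / lam) / 4 + lam ^+ 2 * (Kc - E ^+ 2) <= w xi.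
  move=> h; rewrite /w weight_in// mulrBr.
  have t := tube_d1 ((tubeE Omegam gamma d1 xi).2 h); have [c1 _] := curv_factor t.
  have := ansatz_lower (ltW (mu0 (r xi / lam))) c1 (ltW l0) (HE2 xi t (r xi / lam)).
  by rewrite -[_ + lam * _]/(ansatz lam psih psi1 xi); lra.
have w_ge xi : lam ^+ 2 * (Kc - E ^+ 2) <= w xi.
  have [h|h] := lerP `|r xi| d1.
    by apply: le_trans (w_tube xi h); rewrite lerDr divr_ge0// ltW.
  by rewrite /w weight_out// ler_pM2l// gerBl.
have w0 xi : 0 < w xi by apply: lt_le_trans (w_ge xi); rewrite mulr_gt0// subr_gt0.
have mw : measurable_fun setT w := weight_measurable Kc cw.
split => // xi Oxi.
have w0' y : 0 <= w y by exact: ltW.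
have n1 : (nu (sc xi)).1 ^+ 2 + (nu (sc xi)).2 ^+ 2 = 1.
  by have := nu_unit (geo_normal hgeo) (sc xi); rewrite /dotp -!expr2.
have ptr u : Sq u -> `|r (frame_pt lam xi u)| <= `|r xi| + 2 * lam /\ `|r xi| <= `|r (frame_pt lam xi u)| + 2 * lam.
  move=> /Sq_enorm u2.
  have e2 : enorm (frame_pt lam xi u - xi) <= 2 * lam by rewrite (pt_dist0 hgeo _ l0) mulrC ler_pM2r.
  split; first by apply: le_trans (sdist_step Omegam gamma xi (frame_pt lam xi u)) _; rewrite lerD2l.
  by apply: le_trans (sdist_step Omegam gamma (frame_pt lam xi u) xi) _; rewrite lerD2l enormB.
set isA := (sigma beta (mA lam xi))^-1.
have isA0 : 0 <= isA.
  by have /andP[h _] := Ha lam lP xi Oxi; rewrite invr_ge0; apply: le_trans h; exact: ltW.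
(* inside, the whole interaction disc stays where the ansatz is not cut *)
have [hin|hout] := lerP `|r xi| (d1 - 2 * lam).
  have xd1 : `|r xi| <= d1 by apply: le_trans hin _; rewrite gerBl mulr_ge0// ltW.
  have [cA hs hE] := HI2 xi xd1.
  rewrite (scaled_average hJ xi l0 n1 mw w0').
  have -> : (\int[mu2]_(u in (Sq : set RR)) (J u * w (frame_pt lam xi u))%:E =
    (lam ^+ 2 * Kc + Eav J (fun u => ansatz lam psih psi1 (frame_pt lam xi u)))%:E)%E.
    have cK := @within_cont_cst R Sq (lam ^+ 2 * Kc).
    rewrite -[lam ^+ 2 * Kc in RHS](Eav_cst hJ) -(EavD hJ cK cA) -(Eav_EFin hJ (within_contD cK cA)).
    apply: eq_integral => u; rewrite inE => Su; rewrite /w weight_in//.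
    by have [h _] := ptr u Su; apply: le_trans h _; rewrite -lerBrDr.
  rewrite lee_fin /w weight_in// -/isA.
  have hw := w_tube xi xd1; rewrite /w weight_in// in hw.
  have hwp := w0' xi; rewrite /w weight_in// in hwp.
  rewrite -/isA in hE hs.
  set A0 := ansatz lam psih psi1 xi in hE hw hwp *; set EE := Eav _ _ in hE *.
  have hEE : lam ^+ 2 * Kc + EE <= lam ^+ 2 * Kc + (A0 * isA + C2 * lam ^+ 2).
    by rewrite lerD2l -lerBlDl; apply: le_trans hE; exact: ler_norm.
  apply: le_trans hEE _.
  have [hz|hz] := lerP Z0 `|r xi / lam|.
    apply: (slack_far l20 (ltW l0) qq0 qq1 _ etaE hs lleta Keta (ltW Kc0) (ltW D0) hwp).
    by rewrite lef_pV2 ?posrE//; [exact: Hq|exact: (sg_gt0 hbeta hmb hmb_eq hmbar)].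
  apply: (slack_near l20 m00 (Hm0 _ (ltW hz)) isA0 _ (ltW Kc0) (ltW C20)).
  by apply: le_trans hw; rewrite lerDl mulr_ge0 ?subr_ge0// ltW.
(* outside, the disc only meets points where the ansatz is of order [lam^2] *)
have b1 u : Sq u -> w (frame_pt lam xi u) <= lam ^+ 2 * (Kc + C5).
  move=> Su; have [_ h] := ptr u Su; set p := frame_pt lam xi u in h *.
  have [hp|hp] := lerP `|r p| d1; last by rewrite /w weight_out// ler_pM2l// lerDl.
  rewrite /w weight_in// mulrDr lerD2l [leRHS]mulrC.
  have t := tube_d1 ((tubeE Omegam gamma d1 p).2 hp); have [_ c1] := curv_factor t.
  apply: (ansatz_upper (ltW (mu0 _)) c1 (ltW l0) G0 E0 (HE2 p t _)).
  have [rp _] := outer_distances d00 lld hout h.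
  exact: (decay_bound (ltW (mu0 _)) d00 l0 (ltW Cd0) (HCd (r p / lam)) rp).
apply: le_trans (scaled_average_le hJ (xi := xi) l0 n1 mw w0' b1) _.
rewrite lee_fin; apply: (slack_outer l20 Cs1 _ (ltW D0) (w_ge xi) (w0' xi) KCs).
apply: (HCs lam lP xi Oxi).
have hb : `|r xi| <= (`|r xi| - 2 * lam) + 2 * lam by rewrite subrK.
by have [] := outer_distances d00 lld hout hb.
Qed.
End Supersolution.

(** * The quadratic form *)

Section PlaneSigmaFinite.
Context {R : realType}.
Notation RR := (measurableTypeR R * measurableTypeR R)%type.
Notation leb := (@lebesgue_measure R).

Lemma mu2_sigma_finite : sigma_finite setT (mu2 : set RR -> \bar R).
Proof.
pose I (n : nat) : set R := `[- n%:R, n%:R]%classic.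
exists (fun n => I n `*` I n : set RR).
  apply/seteqP; split => // -[x y] _; pose M := `|x| + `|y|.
  have M0 : 0 <= M by rewrite addr_ge0.
  have hM : M < (Num.truncn M).+1%:R by have /andP[] := truncn_itv M0.
  exists (Num.truncn M).+1 => //; split; rewrite /I /= in_itv/= -ler_norml.
    by apply: ltW (le_lt_trans _ hM); rewrite lerDl.
  by apply: ltW (le_lt_trans _ hM); rewrite lerDr.
move=> n; split; first by apply: measurableX; exact: measurable_itv.
rewrite [mu2 _](_ : _ = leb (I n) * leb (I n))%E; last by rewrite -product_measure1E//; exact: measurable_itv.
by rewrite lebesgue_measure_itv/=; case: ifP => _; rewrite ?mule0 ?lt0y// -EFinB -EFinM ltry.
Qed.
(** Packages [mu2] with its sigma-finiteness, for Tonelli's theorem on pairs of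
points of the plane. *)
Definition plane_measure : {sigma_finite_measure set RR -> \bar R} :=
  HB.pack_for {sigma_finite_measure set RR -> \bar R} (leb \x leb)%E (Measure_isSigmaFinite.Build _ _ _ (leb \x leb)%E mu2_sigma_finite).

End PlaneSigmaFinite.

Theorem theorem2p4 (R : realType)
    (beta : R) (hbeta : 1 < beta)
    (mb : R) (hmb : 0 < mb) (hmb_eq : mb = tanh (beta * mb))
    (J : R * R -> R) (hJ : interaction_kernel J)
    (mbar : R -> R) (hmbar : instanton beta J mb mbar)
    (Omega Omegam : set (R * R)) (L d0 : R) (gamma nu : R -> R * R)
    (kap : R -> R) (sc : R * R -> R)
    (hgeo : geometry Omega Omegam L d0 gamma nu kap sc)
    (lam0 : R) (h1 g : R -> R) (phi : R * R -> R) (q mA : R -> R * R -> R)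
    (hmA : approx_family beta mb mbar Omega Omegam L d0 gamma sc lam0
             h1 g phi q mA) :
  exists lam2 C : R,
    [/\ 0 < lam2, lam2 <= lam0, 0 < C &
      forall lam, 0 < lam <= lam2 -> forall v : R * R -> R, L2 Omega v ->
        - C * lam ^+ 2 * \int[mu2]_(xi in Omega) (v xi ^+ 2) <=
        \int[mu2]_(xi in Omega) (Aop J beta Omega lam (mA lam) v xi * v xi)].
Proof.
have [lam2 [D [l20 l2le D0 H]]] := supersolution hbeta hmb hmb_eq hJ hmbar hgeo hmA.
exists lam2, D; split => // lam /andP[l0 ll] v hv.
have lP : 0 < lam <= lam0 by rewrite l0 (le_trans ll).
have lP2 : 0 < lam <= lam2 by rewrite l0.
have [w [mw w0 sup]] := H lam lP2.
have [a [a0 Ha]] := fam_sigma hmA.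
pose RR := (measurableTypeR R * measurableTypeR R)%type.
pose k (p : RR * RR) : R := Jscaled J lam (p.1 - p.2).
have ln : lam != 0 by rewrite gt_eqF.
have il0 : 0 <= lam ^- 2 by rewrite invr_ge0 exprn_ge0// ltW.
have k0 p : 0 <= k p by rewrite mulr_ge0// (kernel_ge0 hJ).
have ksym x y : k (x, y) = k (y, x).
  rewrite /k /Jscaled; congr (_ * _); apply: (J_radial hJ) => /=.
  by field.
have [B HB] := cSq_bounded (cSqJ hJ).
have kB p : k p <= lam ^- 2 * `|B|.
  rewrite ler_wpM2l//; set u := (_, _); have [Su|Su] := pselect (Sq u).
    by apply: le_trans (ler_norm _) _; apply: le_trans (HB u Su) (ler_norm _).
  by rewrite (J_offSq hJ Su).
have mJ : measurable_fun setT (J : RR -> R) by exact: continuous_measurable2 (J_cont hJ).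
have mk : measurable_fun setT k.
  apply: measurable_funM => //.
  apply: (measurableT_comp mJ).
  apply/measurable_fun_pairP; split => /=.
    apply: measurable_funM => //; apply: measurable_funB.
      by apply: measurableT_comp; [exact: measurable_fst|exact: measurable_fst].
    by apply: measurableT_comp; [exact: measurable_fst|exact: measurable_snd].
  apply: measurable_funM => //; apply: measurable_funB.
    by apply: measurableT_comp; [exact: measurable_snd|exact: measurable_fst].
  by apply: measurableT_comp; [exact: measurable_snd|exact: measurable_snd].
have ki x : mu2.-integrable setT (EFin \o (fun y : RR => k (x, y))).
  apply/integrableP; split.
    apply/measurable_EFinP; apply: (@continuous_measurable2 _ (fun y : R * R => Jscaled J lam (x - y))).
    exact: Jscaled_cont.
  have n1 : (1 : R, 0 : R).1 ^+ 2 + (1 : R, 0 : R).2 ^+ 2 = 1 by rewrite /= expr1n expr0n addr0.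
  have -> : (\int[mu2]_y `|(EFin \o (fun y0 : RR => k (x, y0))) y| = \int[mu2]_y (Jscaled J lam (x - y) * 1)%:E)%E.
    by apply: eq_integral => y _ /=; rewrite ger0_norm// mulr1.
  apply: le_lt_trans (scaled_average_le hJ (w := fun=> 1) (b := 1) l0 n1 _ _ _) _ => //.
  exact: ltry.
have oO := domain_open (geo_domain hgeo).
have mO : measurable (Omega : set RR) by exact: open_measurable2.
have cA : {in Omega, continuous (mA lam)}.
  by move=> x; rewrite inE => Ox; have [H0 _] := fam_C1 hmA lP; exact: H0.
have si1 x : Omega x -> a <= sigma beta (mA lam x) by move=> Ox; have /andP[] := Ha lam lP x Ox.
have msi : measurable_fun (Omega : set RR) (fun x : RR => (sigma beta (mA lam x))^-1).
  apply: measurable_fun_inv_pos => //; last by move=> x Ox; apply: lt_le_trans a0 (si1 x Ox).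
  apply: (within_continuous_measurable2 mO); apply: (@within_cont_comp _ Omega (sigma beta) (mA lam)).
    by move=> m; apply: cvgM; [exact: cvg_cst|apply: cvgB; [exact: cvg_cst|exact: exprn_continuous]].
  exact: continuous_in_subspaceT.
have A0 : 0 <= a^-1 by rewrite invr_ge0 ltW.
have si0 x : Omega x -> 0 <= (sigma beta (mA lam x))^-1.
  by move=> Ox; rewrite invr_ge0 (le_trans (ltW a0))// si1.
have sile x : Omega x -> (sigma beta (mA lam x))^-1 <= a^-1.
  by move=> Ox; rewrite lef_pV2 ?posrE ?si1// (lt_le_trans a0)// si1.
have mvt : measurable_fun setT (v \_ Omega : RR -> R).
  by move: hv; rewrite /L2 inE => /andP[]; rewrite inE.
have ivt2 := Lfun2_integrable_sqr hv.
have := @quadratic_form_bound _ _ R (@plane_measure R) k Omega _ w a^-1 (lam ^- 2 * `|B|) (D * lam ^+ 2)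
  mk k0 ksym kB ki mO msi A0 si0 sile mw w0 sup v mvt ivt2.
by rewrite -(mulNr D).
Qed.
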